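(* Let $n\ge 1$, let $\mathcal{C}_n\subseteq\mathcal{R}_n$ be any zigzag set of rectangulations, and let the initial rectangulation $R_0\in\mathcal{C}_n$ be the rectangulation $\mathrm{id}_n^\square$ consisting of $n$ rectangles placed side by side (all walls vertical). Then Algorithm J$^\square$, run on $\mathcal{C}_n$ with initial rectangulation $R_0$, visits every rectangulation from $\mathcal{C}_n$ exactly once. Moreover, if $n\ge 2$ and $\mathcal{C}_n$ is symmetric, then the ordering of rectangulations generated by Algorithm J$^\square$ is cyclic, i.e., the first and last rectangulation differ in a minimal jump.
   Context: **Rectangulations.** A (generic) rectangulation is a partition of an axis-aligned rectangle into finitely many interior-disjoint axis-aligned rectangles such that no four rectangles of the partition have a point in common. Rectangle $r$ is left of $s$ (and $s$ right of $r$) if the right side of $r$ and the left side of $s$ intersect in a line segment (not just a point); $r$ is below $s$ (and $s$ above $r$) if the top side of $r$ and the bottom side of $s$ intersect in a line segment. Rectangulations are considered up to equivalence preserving the left/right and below/above relations. $\mathcal{R}_n$ is the set of rectangulations with $n$ rectangles, and $\square$ is the unique element of $\mathcal{R}_1$. A vertex is a corner of a rectangle of the partition, an edge is a minimal line segment between two vertices, a wall is a maximal line segment between two vertices that are not corners of the rectangulation. Every vertex that is not a corner of the rectangulation is a T-joint of type $\vdash$ (stem to the right), $\dashv$ (stem to the left), $\top$ (stem down) or $\bot$ (stem up). **Deletion.** For $R\in\mathcal{R}_n$, $n\ge2$, let $r$ be its bottom-right rectangle. If the top-left vertex of $r$ has type $\vdash$, slide the top side of $r$ (a wall) downwards until it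 merges with the bottom side of $r$; if it has type $\top$, slide the left side of $r$ (a wall) to the right until it merges with the right side of $r$. The result is $p(R)\in\mathcal{R}_{n-1}$. The rectangles of $R$ are named $r_n,r_{n-1},\dots,r_1$ in the order in which repeated deletion removes them. **Insertion.** For a rectangulation $R$, choose one interior point on every edge forming the left side of a rectangle touching the bottom boundary of $R$ (vertical insertion points), and one interior point on every edge forming the top side of a rectangle touching the right boundary of $R$ (horizontal insertion points). Order the vertical insertion points lexicographically by $(x,y)$-coordinates, followed by the horizontal ones ordered lexicographically by $(y,x)$-coordinates; this gives $I(R)=(q_1,\dots,q_\nu)$ with $\nu=\nu(R)$. For $R\in\mathcal{R}_{n-1}$ define $c_i(R)\in\mathcal{R}_n$ as follows. If $q_i$ is vertical, insert a new rectangle $r_n$ in the bottom-right corner that has above it exactly the rectangles of $R$ that lie to the right of $q_i$ and touch the bottom boundary, and to its left exactly the rectangles of $R$ that touch the vertical segment through $q_i$ (from the left) below $q_i$. If $q_i$ is horizontal, insert $r_n$ in the bottom-right corner such that it has to its left exactly the rectangles of $R$ that lie below $q_i$ and touch the right boundary, and above it exactly the rectangles of $R$ that touch the horizontal segment through $q_i$ (from above) to the right of $q_i$. $R$ is bottom-based if some rectangle has as its bottom side the entire bottom boundary of $R$, and right-based if some rectangle has as its right side the entire right boundary of $R$. **Jumps.** For $R,R'\in\mathcal{R}_n$, $2\le j\le n$, $d>0$, $R'$ differs from $R$ by a right jump of rectangle $r_j$ by $d$ steps if either (1) $j=n$, $p(R)=p(R')=:P$, and $R=c_k(P)$, $R'=c_{k+d}(P)$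 for some $k>0$; or (2) $j<n$, $R$ and $R'$ are both bottom-based or both right-based, and $p(R')$ differs from $p(R)$ by a right jump of $r_j$ by $d$ steps. A left jump is defined analogously with $c_{k-d}$ in place of $c_{k+d}$. For $\mathcal{C}_n\subseteq\mathcal{R}_n$ put $\mathcal{C}_j:=\{p^{n-j}(R)\mid R\in\mathcal{C}_n\}$. A right jump of $r_j$ is minimal w.r.t. $\mathcal{C}_n$ if, when the recursion in (2) reaches condition (1) (for rectangulations with $j$ rectangles), there is no $\ell$ with $k<\ell<k+d$ and $c_\ell(P)\in\mathcal{C}_j$; for left jumps replace $k<\ell<k+d$ by $k-d<\ell<k$. **Zigzag and symmetric sets.** $\mathcal{C}_n\subseteq\mathcal{R}_n$ is zigzag if either $n=1$ and $\mathcal{C}_1=\{\square\}$, or $n\ge2$, $\mathcal{C}_{n-1}:=\{p(R)\mid R\in\mathcal{C}_n\}$ is zigzag, and for every $R\in\mathcal{C}_{n-1}$ we have $c_1(R)\in\mathcal{C}_n$ and $c_{\nu(R)}(R)\in\mathcal{C}_n$. $\mathcal{C}_n$ is symmetric if it is closed under reflection at the main diagonal (from top-left to bottom-right). **Algorithm J$^\square$.** (J1) Visit the initial rectangulation $R_0$. (J2) Generate an unvisited rectangulation from $\mathcal{C}_n$ by performing a minimal jump (w.r.t. $\mathcal{C}_n$) of the rectangle with largest possible index in the most recently visited rectangulation. If no such jump exists, or the jump direction is ambiguous (both a left and a right minimal jump of that rectangle lead to an unvisited element of $\mathcal{C}_n$), terminate. Otherwise visit this rectangulation and repeat J2. *)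

(* Defs.v *)
From HB Require Import structures.
From mathcomp Require Import all_boot all_order all_algebra.
From mathcomp Require Import generic_quotient.
From mathcomp Require Import boolp classical_sets.
Set Implicit Arguments.
Unset Strict Implicit.
Unset Printing Implicit Defensive.
Import Order.TTheory GRing.Theory Num.Theory.
Local Open Scope ring_scope.
Local Open Scope quotient_scope.
Local Open Scope classical_set_scope.

Record rect (F : realFieldType) := Rect { xl : F; xr : F; yb : F; yt : F }.

Section RectStructures.
Variable F : realFieldType.

Definition tuple_of_rect (r : rect F) : F * F * F * F :=
  (xl r, xr r, yb r, yt r).
Definition rect_of_tuple (t : F * F * F * F) : rect F :=
  let: (a, b, c, d) := t in Rect a b c d.
Lemma tuple_of_rectK : cancel tuple_of_rect rect_of_tuple.
Proof. by case. Qed.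

HB.instance Definition _ := Choice.copy (rect F) (can_type tuple_of_rectK).
End RectStructures.

Section Rectangulations.
Variable F : realFieldType.

Notation point := (F * F)%type.

Definition nondegenerate (r : rect F) := (xl r < xr r) && (yb r < yt r).

Definition in_rect (v : point) (r : rect F) :=
  (xl r <= v.1 <= xr r) && (yb r <= v.2 <= yt r).

Definition in_interior (v : point) (r : rect F) :=
  (xl r < v.1 < xr r) && (yb r < v.2 < yt r).

Definition predrawing := (rect F * seq (rect F))%type.
Definition box (G : predrawing) : rect F := G.1.
Definition parts (G : predrawing) : seq (rect F) := G.2.

(* The three pointwise clauses say that the parts cover exactly the box, that
   they are interior-disjoint, and that no four of them have a common point. *)
Definition is_partition (G : predrawing) : Prop :=
  [/\ all nondegenerate (box G :: parts G),
      forall v, has (in_rect v) (parts G) = in_rect v (box G),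
      forall v, (count (in_interior v) (parts G) <= 1)%N
    & forall v, (count (in_rect v) (parts G) <= 3)%N].

Record drawing := Drawing {
  predraw :> predrawing;
  drawingP : `[< is_partition predraw >]
}.

HB.instance Definition _ := [isSub for predraw].
HB.instance Definition _ := [Choice of drawing by <:].

Definition left_of (r s : rect F) :=
  (xr r == xl s) && (Num.max (yb r) (yb s) < Num.min (yt r) (yt s)).

Definition below (r s : rect F) :=
  (yt r == yb s) && (Num.max (xl r) (xl s) < Num.min (xr r) (xr s)).

Definition part (G : predrawing) (i : nat) : rect F := nth (box G) (parts G) i.

Definition equivalent (G H : drawing) : bool :=
  `[< exists2 f : 'I_(size (parts G)) -> 'I_(size (parts H)), bijective f &
      forall i j,
        left_of (part H (f i)) (part H (f j)) = left_of (part G i) (part G j) /\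
        below (part H (f i)) (part H (f j)) = below (part G i) (part G j) >].

Lemma equivalent_refl : reflexive equivalent.
Proof. by move=> G; apply/asboolP; exists id => //; exists id. Qed.

Lemma equivalent_imp G H : equivalent G H -> equivalent H G.
Proof.
move/asboolP=> [f [g fK gK] fP]; apply/asboolP; exists g; first by exists f.
by move=> i j; have := fP (g i) (g j); rewrite !gK => -[-> ->].
Qed.

Lemma equivalent_sym : symmetric equivalent.
Proof. by move=> G H; apply/idP/idP; apply: equivalent_imp. Qed.

Lemma equivalent_trans : transitive equivalent.
Proof.
move=> H G K /asboolP[f fb fP] /asboolP[g gb gP]; apply/asboolP.
exists (g \o f); first exact: bij_comp.
by move=> i j /=; have [-> ->] := gP (f i) (f j); apply: fP.
Qed.

Canonical equivalent_equiv :=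
  EquivRel equivalent equivalent_refl equivalent_sym equivalent_trans.

Definition rectangulation := {eq_quot equivalent}.
HB.instance Definition _ := Choice.on rectangulation.
HB.instance Definition _ := EqQuotient.on rectangulation.

Definition class_of (G : drawing) : rectangulation := \pi G.

Implicit Types (G : predrawing) (v q : point) (R P : rectangulation).
Implicit Types C : set rectangulation.

(* Notions that do not depend on the drawing of a rectangulation are read off
   from an arbitrary one, [repr R]. *)
Definition nrects R : nat := size (parts (repr R : drawing)).

Definition rectangulations (n : nat) : set rectangulation :=
  [set R | nrects R = n].

Lemma count_le (T : eqType) (a : pred T) (s t : seq T) :
  uniq s -> (forall x y, a x -> a y -> x \in s -> y \in s -> y \in t) ->
  (count a s <= size t)%N.
Proof.
move=> us H; rewrite -size_filter.
case E: (filter a s) => [//|x s']; rewrite -E.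
have xs : x \in filter a s by rewrite E mem_head.
move: xs; rewrite mem_filter => /andP[ax xs].
apply: uniq_leq_size; first exact: filter_uniq.
by move=> y; rewrite mem_filter => /andP[ay ys]; apply: (H x y).
Qed.

Definition id_predrawing (n : nat) : predrawing :=
  (Rect 0 n%:R 0 1, [seq Rect i%:R i.+1%:R 0 1 | i <- iota 0 n]).

Lemma id_drawing_subproof n : (0 < n)%N ->
  `[< is_partition (id_predrawing n) >].
Proof.
move=> n0; apply/asboolP; split.
- rewrite /= /nondegenerate /= ltr0n n0 ltr01 /=; apply/allP => r.
  by case/mapP => i _ -> /=; rewrite ltr_nat ltnSn ltr01.
- move=> [x y]; rewrite has_map /in_rect /=.
  apply/hasP/idP => [[i]|/andP[/andP[x0 xn] yy]].
    rewrite mem_iota /= add0n => iltn /andP[/andP[ix xi] ->]; rewrite andbT.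
    rewrite (le_trans _ ix) ?ler0n //= (le_trans xi) // ler_nat //.
  have [i iltn xi] : exists2 i, (i < n)%N & i%:R <= x <= i.+1%:R.
    elim: n n0 xn => // -[|n] IH _ xn; first by exists 0%N; rewrite ?x0.
    have [xle|xgt] := lerP x n.+1%:R.
      by have [i ilt xi] := IH isT xle; exists i => //; apply: ltnW.
    by exists n.+1; rewrite // (ltW xgt) xn.
  by exists i; rewrite ?mem_iota //= xi.
- move=> [x y]; rewrite count_map.
  case: (boolP (has (fun i => i%:R < x < i.+1%:R) (iota 0 n))) => [|no].
    move=> /hasP[i _ /andP[ix xi]].
    apply: (@count_le _ _ _ [:: i]); first exact: iota_uniq.
    move=> _ j _ /andP[/andP[/= jx xj] _] _ _; rewrite inE eqn_leq.
    by rewrite -ltnS -[(i <= j)%N]ltnS -!(ltr_nat F)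
       (lt_trans jx xi) (lt_trans ix xj).
  rewrite leqW // leqn0 eqn0Ngt -has_count; apply: contra no => /hasP[i il].
  by move=> /andP[ix _]; apply/hasP; exists i.
- move=> [x y]; rewrite count_map.
  case: (boolP (has (fun i => i%:R <= x <= i.+1%:R) (iota 0 n))) => [|no].
    move=> /hasP[i _ /andP[ix xi]].
    apply: (@count_le _ _ _ [:: i.-1; i; i.+1]); first exact: iota_uniq.
    move=> _ j _ /andP[/andP[/= jx xj] _] _ _; rewrite !inE.
    have := le_trans jx xi; have := le_trans ix xj; rewrite !ler_nat.
    case: (ltngtP j i) => [ji ij _|ij _ ji|->]; rewrite ?eqxx ?orbT //.
      by have -> : i = j.+1 by [apply/eqP; rewrite eqn_leq ij ji]; rewrite eqxx.
    by have -> : j = i.+1 by [apply/eqP; rewrite eqn_leq ij ji];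
       rewrite eqxx !orbT.
  rewrite (@leq_trans 0) // leqn0 eqn0Ngt -has_count; apply: contra no.
  by move=> /hasP[i il] /andP[ix _]; apply/hasP; exists i.
Qed.

Definition id_rect n (n_gt0 : (0 < n)%N) : rectangulation :=
  class_of (Drawing (id_drawing_subproof n_gt0)).

Definition square : rectangulation := id_rect (ltn0Sn 0).

Definition goes_right G v := has (fun t =>
  ((v.2 == yb t) || (v.2 == yt t)) && (xl t <= v.1 < xr t)) (parts G).
Definition goes_left G v := has (fun t =>
  ((v.2 == yb t) || (v.2 == yt t)) && (xl t < v.1 <= xr t)) (parts G).
Definition goes_up G v := has (fun t =>
  ((v.1 == xl t) || (v.1 == xr t)) && (yb t <= v.2 < yt t)) (parts G).
Definition goes_down G v := has (fun t =>
  ((v.1 == xl t) || (v.1 == xr t)) && (yb t < v.2 <= yt t)) (parts G).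

(* Types |- (stem to the right) and T (stem down). *)
Definition stem_right G v :=
  [&& goes_up G v, goes_down G v, goes_right G v & ~~ goes_left G v].
Definition stem_down G v :=
  [&& goes_left G v, goes_right G v, goes_down G v & ~~ goes_up G v].

Definition set_xr (a : F) (t : rect F) := Rect (xl t) a (yb t) (yt t).
Definition set_yb (a : F) (t : rect F) := Rect (xl t) (xr t) a (yt t).

Definition bottom_right G : rect F :=
  part G
    (find (fun t => (xr t == xr (box G)) && (yb t == yb (box G))) (parts G)).

(* Sliding the top (left) side of r away extends the rectangles above
   (to the left of) r over r. *)
Definition delete G : predrawing :=
  let r := bottom_right G in
  let v := (xl r, yt r) in
  if stem_right G v then
    (box G, [seq if below r t then set_yb (yb r) t else t
            | t <- parts G & t != r])
  else if stem_down G v then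
    (box G, [seq if left_of t r then set_xr (xr r) t else t
            | t <- parts G & t != r])
  else G.

(* p(R).  [insubd] only makes the operation total: [delete] yields a partition
   whenever there are at least two parts. *)
Definition parent R : rectangulation :=
  class_of (insubd (repr R : drawing) (delete (repr R : drawing))).

Definition touches_bottom G (t : rect F) := yb t == yb (box G).
Definition touches_right G (t : rect F) := xr t == xr (box G).

Definition corners (t : rect F) : seq point :=
  [:: (xl t, yb t); (xl t, yt t); (xr t, yb t); (xr t, yt t)].
Definition vertices G : seq point := flatten [seq corners t | t <- parts G].

(* Midpoints of the gaps between consecutive elements of s. *)
Definition midpoints (s : seq F) : seq F :=
  let s' := sort <=%R (undup s) in
  [seq (ab.1 + ab.2) / 2 | ab <- zip s' (behead s')].

(* The chosen interior point of an edge is its midpoint. *)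
Definition left_side_points G (t : rect F) : seq point :=
  [seq (xl t, y) | y <- midpoints
    [seq v.2 | v <- vertices G & (v.1 == xl t) && (yb t <= v.2 <= yt t)]].
Definition top_side_points G (t : rect F) : seq point :=
  [seq (x, yt t) | x <- midpoints
    [seq v.1 | v <- vertices G & (v.2 == yt t) && (xl t <= v.1 <= xr t)]].

Definition lex_xy : rel point := fun u v =>
  (u.1 < v.1) || ((u.1 == v.1) && (u.2 <= v.2)).
Definition lex_yx : rel point := fun u v =>
  (u.2 < v.2) || ((u.2 == v.2) && (u.1 <= v.1)).

Definition vertical_points G : seq point := sort lex_xy
  (flatten [seq left_side_points G t | t <- parts G & touches_bottom G t]).
Definition horizontal_points G : seq point := sort lex_yx
  (flatten [seq top_side_points G t | t <- parts G & touches_right G t]).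

Definition insertion_points G : seq point :=
  vertical_points G ++ horizontal_points G.

Definition nu R : nat := size (insertion_points (repr R : drawing)).

(* A new rectangle with top-left corner q is put into the bottom-right corner.
   For vertical q the rectangles on the bottom boundary to the right of q are
   raised to the top of the new rectangle, so that they are exactly the ones
   above it; the ones to its left are those touching from the left the vertical
   segment below q.  Symmetrically for horizontal q. *)
Definition insert_vertical G q : predrawing :=
  (box G, Rect q.1 (xr (box G)) (yb (box G)) q.2 ::
        [seq if touches_bottom G t && (q.1 <= xl t) then set_yb q.2 t else t
        | t <- parts G]).
Definition insert_horizontal G q : predrawing :=
  (box G, Rect q.1 (xr (box G)) (yb (box G)) q.2 ::
        [seq if touches_right G t && (yt t <= q.2) then set_xr q.1 t else t
        | t <- parts G]).

(* Insertion points are numbered from 1. *)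
Definition insert G (i : nat) : predrawing :=
  let q := nth (0, 0) (insertion_points G) i.-1 in
  if (i <= size (vertical_points G))%N then insert_vertical G q
  else insert_horizontal G q.

(* The insertion can be carried out literally only in a drawing with enough
   room: the rectangles being cut must extend beyond q.  Every rectangulation
   has such drawings for each i, and the result does not depend on the choice
   among them. *)
Definition is_insertion (i : nat) R R' : Prop :=
  exists G H : drawing,
    [/\ class_of G = R, class_of H = R',
        (0 < i <= size (insertion_points G))%N
      & predraw H = insert G i].

(* c_i(R), for 1 <= i <= nu(R). *)
Definition child (i : nat) R : rectangulation := xget R (is_insertion i R).

Definition bottom_based R : bool :=
  let G := predraw (repr R) in
  has (fun t =>
    [&& yb t == yb (box G), xl t == xl (box G) & xr t == xr (box G)]) (parts G).
Definition right_based R : bool :=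
  let G := predraw (repr R) in
  has (fun t =>
    [&& xr t == xr (box G), yb t == yb (box G) & yt t == yt (box G)]) (parts G).

(* r_j is the part removed when j parts are left, so that r_j with j < n is
   treated after n - j deletions: deleting r_n, ..., r_(j+1) from R and R',
   with the side condition on bases at each stage, leads to [child k P] and
   [child k' P]. *)
Fixpoint reduces (n j : nat) R R' P (k k' : nat) : Prop :=
  if n is m.+1 then
    if j == n then
      [/\ parent R = P, parent R' = P,
          (0 < k <= nu P)%N /\ (0 < k' <= nu P)%N,
          R = child k P & R' = child k' P]
    else
      ((bottom_based R && bottom_based R') || (right_based R && right_based R'))
      /\ reduces m j (parent R) (parent R') P k k'
  else False.

Definition truncation (n : nat) C (j : nat) : set rectangulation :=
  iter (n - j) parent @` C.

Definition minimal_right_jump (n : nat) C (j d : nat) R R' : Prop :=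
  [/\ (2 <= j <= n)%N, (0 < d)%N
    & exists P k, reduces n j R R' P k (k + d) /\
        forall l, (k < l < k + d)%N -> ~ truncation n C j (child l P)].

Definition minimal_left_jump (n : nat) C (j d : nat) R R' : Prop :=
  [/\ (2 <= j <= n)%N, (0 < d)%N
    & exists P k, [/\ (d < k)%N, reduces n j R R' P k (k - d)
      & forall l, (k - d < l < k)%N -> ~ truncation n C j (child l P)]].

Fixpoint zigzag (n : nat) C : Prop :=
  match n with
  | 0 => False
  | 1 => C = [set square]
  | m.+1 => zigzag m (parent @` C) /\
            forall R, (parent @` C) R -> C (child 1 R) /\ C (child (nu R) R)
  end.

(* Reflection (x, y) |-> (-y, -x), whose axis runs from top left to bottom
   right. *)
Definition reflect_rect (t : rect F) :=
  Rect (- yt t) (- yb t) (- xr t) (- xl t).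
Definition reflect_predrawing G : predrawing :=
  (reflect_rect (box G), [seq reflect_rect t | t <- parts G]).

Lemma reflect_subproof (G : drawing) :
  `[< is_partition (reflect_predrawing G) >].
Proof.
have /asboolP[nd cov int gen] := drawingP G; apply/asboolP.
have inE1 v t : in_rect v (reflect_rect t) = in_rect (- v.2, - v.1) t.
  by rewrite /in_rect /= !(lerNl v.1) !(lerNl v.2) !(lerNr v.1) !(lerNr v.2);
     rewrite [RHS]andbC; congr (_ && _); rewrite andbC.
have inE2 v t :
    in_interior v (reflect_rect t) = in_interior (- v.2, - v.1) t.
  by rewrite /in_interior /= !(ltrNl v.1) !(ltrNl v.2) !(ltrNr v.1)
       !(ltrNr v.2);
     rewrite [RHS]andbC; congr (_ && _); rewrite andbC.
have ndE t : nondegenerate (reflect_rect t) = nondegenerate t.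
  by rewrite /nondegenerate /= !ltrN2 andbC.
split=> [|v|v|v].
- by move: nd; rewrite /= ndE all_map (eq_all ndE).
- by rewrite has_map inE1 -cov; apply: eq_has => t /=; rewrite inE1.
- rewrite count_map (leq_trans _ (int (- v.2, - v.1))) // eq_leq //.
  by apply: eq_count => t /=; rewrite inE2.
- rewrite count_map (leq_trans _ (gen (- v.2, - v.1))) // eq_leq //.
  by apply: eq_count => t /=; rewrite inE1.
Qed.

Definition reflect_drawing (G : drawing) : drawing := Drawing (reflect_subproof G).

Definition symmetric_set C : Prop :=
  forall G : drawing, C (class_of G) -> C (class_of (reflect_drawing G)).

Definition minimal_jump (n : nat) C (j : nat) R R' : Prop :=
  (exists d, minimal_right_jump n C j d R R') \/
  (exists d, minimal_left_jump n C j d R R').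

(* The rectangulations visited so far are [R0 :: s], in this order. *)
Section AlgorithmJ.
Variables (n : nat) (C : set rectangulation) (R0 : rectangulation).
Implicit Type s : seq rectangulation.

Definition unvisited s R : Prop := C R /\ R \notin R0 :: s.

Definition right_move s (j : nat) R : Prop :=
  unvisited s R /\ exists d, minimal_right_jump n C j d (last R0 s) R.

Definition left_move s (j : nat) R : Prop :=
  unvisited s R /\ exists d, minimal_left_jump n C j d (last R0 s) R.

Definition any_move s (j : nat) R : Prop := right_move s j R \/ left_move s j R.

Definition step s R : Prop :=
  exists j, [/\ any_move s j R,
    forall j' R', any_move s j' R' -> (j' <= j)%N
    & ~ ((exists R', right_move s j R') /\ (exists R', left_move s j R'))].

Inductive visited : seq rectangulation -> Prop :=
| J1 : visited [::]
| J2 s R : visited s -> step s R -> visited (rcons s R).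

Definition algorithmJ_output (out : seq rectangulation) : Prop :=
  exists s, [/\ out = R0 :: s, visited s & ~ exists R, step s R].

End AlgorithmJ.

End Rectangulations.

(* Main.v *)
Require Import Defs.
From HB Require Import structures.
From mathcomp Require Import all_boot all_order all_algebra.
From mathcomp Require Import generic_quotient.
From mathcomp Require Import boolp classical_sets.
From mathcomp Require Import lra zify.
Set Implicit Arguments.
Unset Strict Implicit.
Unset Printing Implicit Defensive.
Import Order.TTheory GRing.Theory Num.Theory.
Local Open Scope ring_scope.
Local Open Scope classical_set_scope.

(* Deletion makes the rectangulations into a rooted tree in which the children
   of P are c_1(P), ..., c_nu(P), pairwise distinct; c_1(P) is the only
   bottom-based and c_nu(P) the only right-based one.  Once this is known the
   theorem is combinatorial.  List C_n by running through the children of the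
   elements of C_(n-1), in the order already found for C_(n-1), alternately
   from c_nu down to c_1 and from c_1 up to c_nu.  Within a run the only jump of
   r_n to an unvisited element is the one to the next sibling.  At the end of a
   run r_n cannot jump any more, and the jumps of smaller rectangles are
   exactly those available one level below, transported along c_1 or along c_nu,
   so the algorithm moves on to the next run.  Reflection exchanges bottom-based
   and right-based rectangulations, so a symmetric C_(n-1) has even size; the
   last run then ends with a c_nu, just as the first run begins with one, and the
   minimal jump closing the cycle at level n-1 lifts to level n.

   For the tree structure, a vertical insertion point corresponds to an edge on
   the left side of a part t touching the bottom boundary, hence to a pair
   (t, s) with s a left neighbour of t (or s = t on the left boundary).  The
   order of these pairs, and the adjacencies after an insertion, depend only on
   the adjacencies before it and on the pair; redrawing the part to the right of
   the edge makes room for any of them.  The horizontal case follows by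
   reflection, which reverses the order of the insertion points. *)

(** The recurring obstacle is that [parent], [nu] and [child] are read off arbitrary drawings, and
    that an insertion is literal only in a drawing with room. So every quantity in play has to be
    shown to depend on adjacencies alone. Positions enter only through two orders, left to right
    along the bottom boundary and upwards along the left side of a part; each is generated by
    adjacency steps, hence the same in all drawings. Going back from an insertion, only the contacts
    of [t] with its left neighbours below [s] have been cut. They can be restored because [s] is a
    left neighbour both of [t] and of the new part, which identifies [t] among the parts above the
    new one. When [s = t] nothing has been cut. Genericity decides the type of the corner to delete:
    a vertex that is neither |- nor T would be common to four parts. In general a rectangulation is
    neither bottom-based nor right-based, so the parity argument looks at its ancestor with two
    parts: this ancestor is one or the other, and reflection, commuting with deletion, exchanges the
    two cases. *)

Lemma count_le1 (T : eqType) (a : pred T) (s : seq T) : uniq s ->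
  {in s &, forall x y, a x -> a y -> x = y} -> (count a s <= 1)%N.
Proof.
move=> us aP; case: (boolP (has a s)) => [/hasP[x xs ax]|].
  apply: (@count_le _ _ _ [:: x]) => // _ z _ az _ zs.
  by rewrite inE (aP _ _ zs xs az ax).
by rewrite has_count -leqNgt leqn0 => /eqP->.
Qed.

(** Meant for points on a line: of the parts lying along one side of it, at most one contains the
    germ before the point and at most one the germ after it. *)
Lemma count_le2 (T : eqType) (a a1 a2 : pred T) (s : seq T) : uniq s ->
  {in s, forall x, a x -> a1 x || a2 x} ->
  {in s &, forall x y, a1 x -> a1 y -> x = y} ->
  {in s &, forall x y, a2 x -> a2 y -> x = y} -> (count a s <= 2)%N.
Proof.
move=> us aP a1P a2P.
apply: leq_trans (_ : count a1 s + count a2 s <= 2)%N; last first.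
  by rewrite (leq_add (count_le1 us a1P) (count_le1 us a2P)).
rewrite -count_predUI; apply: leq_trans (leq_addr _ _).
by rewrite -!size_filter; apply: uniq_leq_size; rewrite ?filter_uniq // => x;
   rewrite !mem_filter => /andP[/aP ax xs]; rewrite xs andbT; apply: ax.
Qed.

Lemma count_four (T : eqType) (a : pred T) (s : seq T) (x y z w : T) :
  (count a s <= 3)%N -> uniq [:: x; y; z; w] ->
  {subset [:: x; y; z; w] <= filter a s} -> False.
Proof.
by move=> le3 u /(uniq_leq_size u); rewrite size_filter => /leq_trans/(_ le3).
Qed.

(** * Partitions as covers by separated half-open rectangles *)

Section Good.
Variable F : realFieldType.
Implicit Types (G H : predrawing F) (r s t u : rect F) (x y z : F).

(** A finite substitute for the limit from the right: no value of [S] is passed between [x] and [e].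
    With [S] the coordinates of a drawing, closed membership at [e] becomes half-open membership at
    [x]. *)
Lemma nudge_up (S : seq F) x z : x < z ->
  exists2 e, x < e < z & {in S, forall c, c <= e -> c <= x}.
Proof.
move=> xz; elim: S => [|c S [e exz eP]]; first by exists ((x + z) / 2) => //; lra.
have [cx|xc] := lerP c x.
  by exists e => // d; rewrite inE => /predU1P[->//|/eP].
have [ec|ce] := ltP e c.
  exists e => // d; rewrite inE => /predU1P[->|/eP //]; lra.
exists ((x + c) / 2); first by lra.
move=> d; rewrite inE => /predU1P[->|/eP dP]; first by lra.
by move=> dx; apply: dP; lra.
Qed.

Lemma nudge_down (S : seq F) x z : z < x ->
  exists2 e, z < e < x & {in S, forall c, e <= c -> x <= c}.
Proof.
move=> zx; have [|e exz eP] := @nudge_up [seq - c | c <- S] (- x) (- z).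
  by lra.
exists (- e); first by lra.
move=> c cS ec; have := eP (- c) (map_f _ cS); lra.
Qed.

(** Disjointness of interiors without quantifying over points: a disjunction of linear inequalities
    that [lra] can use. *)
Definition apart s t :=
  [|| xr s <= xl t, xr t <= xl s, yt s <= yb t | yt t <= yb s].

(* Covering is stated for north-east germs, i.e. half-open rectangles, which are
   never shared between two parts. *)
Record good G : Prop := Good {
  good_box : xl (box G) < xr (box G) /\ yb (box G) < yt (box G);
  good_nd : forall t, t \in parts G -> xl t < xr t /\ yb t < yt t;
  good_in : forall t, t \in parts G ->
    [/\ xl (box G) <= xl t, xr t <= xr (box G),
        yb (box G) <= yb t & yt t <= yt (box G)];
  good_uniq : uniq (parts G);
  good_sep : forall s t, s \in parts G -> t \in parts G -> s != t -> apart s t;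
  good_cov : forall x y,
    xl (box G) <= x < xr (box G) -> yb (box G) <= y < yt (box G) ->
    exists2 t, t \in parts G & (xl t <= x < xr t) && (yb t <= y < yt t);
  good_gen : forall v, (count (in_rect v) (parts G) <= 3)%N
}.

Definition xcoords G := [seq xl t | t <- parts G] ++ [seq xr t | t <- parts G].
Definition ycoords G := [seq yb t | t <- parts G] ++ [seq yt t | t <- parts G].

Lemma mem_coords G t : t \in parts G ->
  [/\ xl t \in xcoords G, xr t \in xcoords G, yb t \in ycoords G
    & yt t \in ycoords G].
Proof. by move=> tG; rewrite !mem_cat !map_f ?orbT. Qed.

Lemma midpoint_in_interior t x1 x2 y1 y2 :
  x1 < x2 -> y1 < y2 -> xl t <= x1 -> x2 <= xr t -> yb t <= y1 -> y2 <= yt t ->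
  in_interior ((x1 + x2) / 2, (y1 + y2) / 2) t.
Proof. by rewrite /in_interior /= => *; lra. Qed.

Lemma is_partition_good G : is_partition G -> good G.
Proof.
case=> /andP[/andP[bx by_] /allP nd] cov int gen.
have nd' t : t \in parts G -> xl t < xr t /\ yb t < yt t.
  by move=> /nd /andP.
have inb t v : t \in parts G -> in_rect v t -> in_rect v (box G).
  by move=> tG vt; rewrite -cov; apply/hasP; exists t.
have sepint s t : s \in parts G -> t \in parts G -> ~~ apart s t ->
  in_interior ((Num.max (xl s) (xl t) + Num.min (xr s) (xr t)) / 2,
      (Num.max (yb s) (yb t) + Num.min (yt s) (yt t)) / 2) s.
  move=> sG tG; have := nd' _ sG; have := nd' _ tG; rewrite /apart => ? ? ?.
  by apply: midpoint_in_interior;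
    rewrite ?gt_max ?lt_min ?le_max ?ge_min ?lexx ?orbT //; lra.
split=> //.
- move=> t tG; have := inb t (xl t, yb t) tG; have := inb t (xr t, yt t) tG.
  rewrite /in_rect /=; have := nd' t tG => ? h1 h2.
  by have := h1 _; have := h2 _ => {h1 h2} h1 h2; split;
    have := h1 ltac:(lra); have := h2 ltac:(lra); lra.
(* A repeated part would be counted twice at its centre. *)
- apply/negPn/negP => /(uniqPn (box G))[i [j [ij jlt eq_ij]]].
  have ilt := ltn_trans ij jlt.
  set t := nth _ _ i in eq_ij; have tG : t \in parts G by apply: mem_nth.
  set v := ((xl t + xr t) / 2, (yb t + yt t) / 2).
  have vt : in_interior v t by apply: midpoint_in_interior => //; have := nd' t tG; lra.
  have := int v.
  rewrite -(cat_take_drop j (parts G)) count_cat.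
  have h1 : (0 < count (in_interior v) (take j (parts G)))%N.
    rewrite -has_count; apply/(has_nthP (box G)); exists i.
      by rewrite size_take jlt.
    by rewrite nth_take.
  have h2 : (0 < count (in_interior v) (drop j (parts G)))%N.
    rewrite -has_count; apply/(has_nthP (box G)); exists 0%N.
      by rewrite size_drop subn_gt0.
    by rewrite nth_drop addn0 -eq_ij.
  by move=> h; have := leq_trans (leq_add h1 h2) h.
- move=> s t sG tG ne_st; apply/negPn/negP => nap.
  have i1 := sepint s t sG tG nap.
  have nap' : ~~ apart t s by move: nap; rewrite /apart => ?; lra.
  have := sepint t s tG sG nap'; rewrite maxC minC [Num.max (yb t) _]maxC.
  rewrite [Num.min (yt t) _]minC => i2.
  set v := (_, _) in i1 i2.
  suff : (2 <= count (in_interior v) (parts G))%N.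
    by move=> h; have := leq_trans h (int v).
  rewrite -size_filter; apply: (@uniq_leq_size _ [:: s; t]).
    by rewrite /= inE ne_st.
  by move=> u; rewrite !inE mem_filter => /pred2P[]->; rewrite ?i1 ?i2.
(* A part that contains, in the closed sense, a point slightly to the north-east of [(x, y)]
   contains [(x, y)] in the half-open sense. *)
- move=> x y xb yb'.
  have [|e1 e1P e1c] := @nudge_up (xcoords G) x (xr (box G)); first lra.
  have [|e2 e2P e2c] := @nudge_up (ycoords G) y (yt (box G)); first lra.
  have : in_rect (e1, e2) (box G) by rewrite /in_rect /=; lra.
  rewrite -cov => /hasP[t tG]; rewrite /in_rect /= => tP; exists t => //.
  have [/e1c h1 _ /e2c h2 _] := mem_coords tG.
  have : xl t <= x by apply: h1; lra.
  have : yb t <= y by apply: h2; lra.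
  lra.
Qed.

Lemma good_is_partition G : good G -> is_partition G.
Proof.
move=> gG; have [bx by_] := good_box gG; split.
- apply/allP => t; rewrite inE => /predU1P[->|/(good_nd gG)[tx ty]].
    by apply/andP.
  by apply/andP.
- move=> [x y]; apply/hasP/idP => [[t tG]|].
    by have [] := good_in gG tG; rewrite /in_rect /=; lra.
  rewrite /in_rect /= => vb.
  (* Half-open covering says nothing on the right and top sides of the box; there the point is first
     moved slightly inwards. *)
  have [e1 e1P e1c] : exists2 e, (xl (box G) <= e < xr (box G)) && (e <= x) &
      {in xcoords G, forall c, e < c -> x <= c}.
    have [xx|xx] := ltP x (xr (box G)).
      by exists x; [lra | move=> *; lra].
    have [|e eP ec] := @nudge_down (xcoords G) x (xl (box G)); first lra.
    by exists e; [lra | move=> c cG ltc; apply: ec => //; lra].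
  have [e2 e2P e2c] : exists2 e, (yb (box G) <= e < yt (box G)) && (e <= y) &
      {in ycoords G, forall c, e < c -> y <= c}.
    have [yy|yy] := ltP y (yt (box G)).
      by exists y; [lra | move=> *; lra].
    have [|e eP ec] := @nudge_down (ycoords G) y (yb (box G)); first lra.
    by exists e; [lra | move=> c cG ltc; apply: ec => //; lra].
  have [||t tG tP] := good_cov gG (x := e1) (y := e2); [lra | lra |].
  exists t => //; have [_ /e1c h1 _ /e2c h2] := mem_coords tG.
  have : x <= xr t by apply: h1; lra.
  have : y <= yt t by apply: h2; lra.
  by rewrite /in_rect /=; lra.
- move=> v; apply: count_le1 (good_uniq gG) _ => s t sG tG sv tv.
  apply/eqP/negPn/negP => /(good_sep gG sG tG); move: sv tv.
  by rewrite /in_interior /apart; lra.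
- exact: good_gen.
Qed.

Lemma goodP (G : drawing F) : good G.
Proof. by apply: is_partition_good; apply/asboolP/drawingP. Qed.

Definition drawing_of G (gG : good G) : drawing F :=
  @Drawing F G (asboolT (good_is_partition gG)).

(** The four half-open conventions differ by a small shift only. Looking at the germ just across a
    side of a part is how its neighbours are found later. *)
Lemma cov_nw G x y : good G ->
  xl (box G) < x <= xr (box G) -> yb (box G) <= y < yt (box G) ->
  exists2 t, t \in parts G & (xl t < x <= xr t) && (yb t <= y < yt t).
Proof.
move=> gG xb yb'; have [|e eP ec] := @nudge_down (xcoords G) x (xl (box G)).
  lra.
have [|//|t tG tP] := good_cov gG (x := e) (y := y); first lra.
exists t => //; have [/ec h1 /ec h2 _ _] := mem_coords tG.
by have : x <= xr t by [apply: h2; lra]; have := h1; lra.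
Qed.

Lemma cov_se G x y : good G ->
  xl (box G) <= x < xr (box G) -> yb (box G) < y <= yt (box G) ->
  exists2 t, t \in parts G & (xl t <= x < xr t) && (yb t < y <= yt t).
Proof.
move=> gG xb yb'; have [|e eP ec] := @nudge_down (ycoords G) y (yb (box G)).
  lra.
have [//||t tG tP] := good_cov gG (x := x) (y := e); first lra.
exists t => //; have [_ _ /ec h1 /ec h2] := mem_coords tG.
by have : y <= yt t by [apply: h2; lra]; have := h1; lra.
Qed.

Lemma cov_sw G x y : good G ->
  xl (box G) < x <= xr (box G) -> yb (box G) < y <= yt (box G) ->
  exists2 t, t \in parts G & (xl t < x <= xr t) && (yb t < y <= yt t).
Proof.
move=> gG xb yb'; have [|e eP ec] := @nudge_down (ycoords G) y (yb (box G)).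
  lra.
have [//||t tG tP] := cov_nw gG (x := x) (y := e); first lra.
exists t => //; have [_ _ /ec h1 /ec h2] := mem_coords tG.
by have : y <= yt t by [apply: h2; lra]; have := h1; lra.
Qed.

End Good.

(** * Equivalence through labellings *)

Lemma uniq_map_inj (T T' : eqType) (f : T -> T') (s : seq T) :
  uniq (map f s) -> {in s &, injective f}.
Proof.
elim: s => //= x s IH /andP[/mapP nfx us] y z.
rewrite !inE => /predU1P[->|ys] /predU1P[->|zs] // e; last exact: IH.
  by case: nfx; exists z.
by case: nfx; exists y.
Qed.

Section Labels.
Variable F : realFieldType.
Implicit Types (G H : drawing F) (r s t u : rect F).

Lemma left_ofE s t : left_of s t =
  [&& xr s == xl t, yb s < yt t, yb t < yt s, yb s < yt s & yb t < yt t].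
Proof. by rewrite /left_of gt_max !lt_min; case: eqP => //= _; lra. Qed.

Lemma belowE s t : below s t =
  [&& yt s == yb t, xl s < xr t, xl t < xr s, xl s < xr s & xl t < xr t].
Proof. by rewrite /below gt_max !lt_min; case: eqP => //= _; lra. Qed.

(* [a] and [b] are two drawings with parts labelled by the elements of [ls]. *)
Record labelled (I : eqType) (ls : seq I) (a b : I -> rect F)
    (G H : predrawing F) : Prop := Labelled {
  lab_l : perm_eq (map a ls) (parts G);
  lab_r : perm_eq (map b ls) (parts H);
  lab_left : {in ls &, forall i j, left_of (b i) (b j) = left_of (a i) (a j)};
  lab_below : {in ls &, forall i j, below (b i) (b j) = below (a i) (a j)}
}.

(** The matching goes from an index to its label and on to the index in the other drawing. It is
    injective because the parts of a drawing are distinct, and bijective because both drawings have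
    as many parts as there are labels. *)
Lemma labelled_class (I : eqType) (ls : seq I) a b G H :
  labelled ls a b G H -> class_of G = class_of H.
Proof.
case=> pa pb lP bP; apply/eqmodP/asboolP.
have /choice[li liP] (i : 'I_(size (parts G))) :
    exists l, l \in ls /\ a l = part G i.
  have : part G i \in map a ls by rewrite (perm_mem pa) mem_nth.
  by case/mapP => l lls e; exists l.
have /choice[f fP] (i : 'I_(size (parts G))) :
    exists j : 'I_(size (parts H)), part H j = b (li i).
  have bG : b (li i) \in parts H.
    by rewrite -(perm_mem pb) map_f //; case: (liP i).
  have lt : (index (b (li i)) (parts H) < size (parts H))%N.
    by rewrite index_mem.
  by exists (Ordinal lt); rewrite /part /= nth_index.
exists f; last first.
  by move=> i j; have [li1 <-] := liP i; have [lj1 <-] := liP j; rewrite !fP lP ?bP.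
have uG := good_uniq (goodP G); have uH := good_uniq (goodP H).
apply: inj_card_bij => [i j eqf|]; last first.
  by rewrite !card_ord -(perm_size pa) -(perm_size pb) !size_map.
have [li1 ai] := liP i; have [lj1 aj] := liP j.
have eb : b (li i) = b (li j) by rewrite -!fP eqf.
have {}eb : li i = li j.
  by apply: (@uniq_map_inj _ _ b ls) => //; rewrite (perm_uniq pb) ?uH.
apply: val_inj; apply/eqP; rewrite -(nth_uniq (box G) (ltn_ord i) (ltn_ord j) uG).
by rewrite -/(part G i) -/(part G j) -ai -aj eb.
Qed.

Lemma class_labelled G H : class_of G = class_of H ->
  exists ls : seq (rect F * rect F), labelled ls fst snd G H.
Proof.
move=> /eqmodP/asboolP[f fb fP].
exists [seq (part G i, part H (f i)) | i : 'I_(size (parts G)) <- enum 'I_(size (parts G))].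
have enumE (K : drawing F) :
    [seq part K i | i : 'I_(size (parts K)) <- enum 'I_(size (parts K))] = parts K.
  rewrite -[RHS](mkseq_nth (box K)) /mkseq -val_enum_ord -map_comp.
  exact: eq_map.
split.
- by rewrite -map_comp -[X in perm_eq _ X]enumE; exact: perm_refl.
- rewrite -map_comp -[X in perm_eq _ X]enumE.
  rewrite (map_comp (fun i : 'I_(size (parts H)) => part H i) f).
  apply: perm_map; apply: uniq_perm; rewrite ?enum_uniq //.
    by rewrite map_inj_uniq ?enum_uniq //; apply: bij_inj.
  move=> i; rewrite mem_enum inE; apply/mapP; have [g fK gK] := fb.
  by exists (g i); rewrite ?mem_enum ?gK.
- by move=> _ _ /mapP[i _ ->] /mapP[j _ ->] /=; case: (fP i j).
- by move=> _ _ /mapP[i _ ->] /mapP[j _ ->] /=; case: (fP i j).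
Qed.

Lemma lab_mem (I : eqType) (ls : seq I) a b (G H : predrawing F) i :
  labelled ls a b G H -> i \in ls -> (a i \in parts G) && (b i \in parts H).
Proof. by case=> pa pb _ _ ils; rewrite -(perm_mem pa) -(perm_mem pb) !map_f. Qed.

Lemma lab_sym (I : eqType) (ls : seq I) a b (G H : predrawing F) :
  labelled ls a b G H -> labelled ls b a H G.
Proof. by case=> pa pb lP bP; split=> // i j ils jls; rewrite ?lP ?bP. Qed.

Lemma lab_ex (I : eqType) (ls : seq I) a b (G H : predrawing F) t :
  labelled ls a b G H -> t \in parts G -> exists2 i, i \in ls & a i = t.
Proof.
by case=> pa _ _ _; rewrite -(perm_mem pa) => /mapP[i ils ->]; exists i.
Qed.

End Labels.

(** The order by [lo] is generated by [adj]: from [i] some adjacent step leads upwards without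
    passing [j]. Any [lo'] that increases along [adj] therefore orders the labels in the same way.
    The induction is on the number of labels above [i]. *)
Lemma chain_lt (F : realFieldType) (I : eqType) (ls : seq I) (adj : rel I)
    (lo lo' : I -> F) :
  {in ls &, forall i j, adj i j -> lo' i < lo' j} ->
  {in ls &, forall i j, lo i = lo j -> i = j} ->
  {in ls &, forall i j, lo i < lo j ->
     exists2 k, k \in ls & [/\ adj i k, lo i < lo k & lo k <= lo j]} ->
  {in ls &, forall i j, lo i < lo j -> lo' i < lo' j}.
Proof.
move=> adj_lt lo_inj next i j ils jls.
have [n] := ubnP (count (fun k => lo i < lo k) ls).
elim: n i ils => // n IH i ils ltn ij.
have [k kls [ik lt_ik le_kj]] := next _ _ ils jls ij.
apply: lt_le_trans (adj_lt _ _ ils kls ik) _.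
have [kj|jk] := ltP (lo k) (lo j); last first.
  by rewrite (lo_inj k j) //; apply/eqP; rewrite eq_le le_kj jk.
apply/ltW/IH => //; apply: leq_trans (ltn : _ <= n)%N.
have -> : count (fun k => lo i < lo k)%R ls =
   (count (fun m => lo k < lo m)%R ls +
    count (fun m => (lo i < lo m) && ~~ (lo k < lo m))%R ls)%N.
  rewrite -count_predUI [X in (_ + X)%N](eq_count (a2 := pred0)); last first.
    by move=> m /=; case: (lo k < lo m); rewrite ?andbF.
  rewrite count_pred0 addn0; apply: eq_count => m /=.
  by case: (ltP (lo k) (lo m)) => /=; rewrite ?andbT // => /(lt_trans lt_ik)->.
rewrite -addn1 leq_add2l -has_count; apply/hasP; exists k => //.
by rewrite lt_ik ltxx.
Qed.

(** * Boundary contacts and the orders along a side as adjacency invariants *)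

Section Touching.
Variable F : realFieldType.
Implicit Types (G H : predrawing F) (r s t u : rect F).

Lemma sep_or G s t : good G -> s \in parts G -> t \in parts G ->
  s = t \/ apart s t.
Proof.
move=> gG sG tG; case: (eqVneq s t) => [|ne]; [by left | right].
exact: good_sep gG _ _ _ _ ne.
Qed.

(** The neighbour is taken at the lower right corner of [t]; then [yb u <= yb t] keeps it on the
    bottom boundary when [t] is there. *)
Lemma right_nbr G t : good G -> t \in parts G -> xr t < xr (box G) ->
  exists2 u, u \in parts G & left_of t u && (yb u <= yb t).
Proof.
move=> gG tG tr; have [? ?] := good_nd gG tG; have [? ? ? ?] := good_in gG tG.
have [||u uG uP] := good_cov gG (x := xr t) (y := yb t); [lra|lra|].
exists u => //; rewrite left_ofE; have [? ?] := good_nd gG uG.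
by case: (sep_or gG tG uG) => [e|]; [subst u|rewrite /apart => ?]; lra.
Qed.

Lemma left_nbr G t : good G -> t \in parts G -> xl (box G) < xl t ->
  exists2 u, u \in parts G & left_of u t.
Proof.
move=> gG tG tr; have [? ?] := good_nd gG tG; have [? ? ? ?] := good_in gG tG.
have [||u uG uP] := cov_nw gG (x := xl t) (y := yb t); [lra|lra|].
exists u => //; rewrite left_ofE; have [? ?] := good_nd gG uG.
by case: (sep_or gG tG uG) => [e|]; [subst u|rewrite /apart => ?]; lra.
Qed.

Lemma below_nbr G t : good G -> t \in parts G -> yb (box G) < yb t ->
  exists2 u, u \in parts G & below u t.
Proof.
move=> gG tG tr; have [? ?] := good_nd gG tG; have [? ? ? ?] := good_in gG tG.
have [||u uG uP] := cov_se gG (x := xl t) (y := yb t); [lra|lra|].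
exists u => //; rewrite belowE; have [? ?] := good_nd gG uG.
by case: (sep_or gG tG uG) => [e|]; [subst u|rewrite /apart => ?]; lra.
Qed.

Lemma bottom_eq G s t : good G -> s \in parts G -> t \in parts G ->
  yb s = yb (box G) -> yb t = yb (box G) -> xl s = xl t -> s = t.
Proof.
move=> gG sG tG es et e; have [? ?] := good_nd gG sG.
have [? ?] := good_nd gG tG.
by case: (sep_or gG sG tG) => //; rewrite /apart => ?; exfalso; lra.
Qed.

Lemma bottom_next G s t : good G -> s \in parts G -> t \in parts G ->
  yb s = yb (box G) -> yb t = yb (box G) -> xl s < xl t ->
  exists2 u, u \in parts G &
    [/\ left_of s u, yb u = yb (box G), xl s < xl u & xl u <= xl t].
Proof.
move=> gG sG tG es et lt_st; have [? ?] := good_nd gG sG.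
have [? ?] := good_nd gG tG; have [? ? ? ?] := good_in gG tG.
have le_st : xr s <= xl t.
  by case: (sep_or gG sG tG) => [e|]; [subst t|rewrite /apart => ?]; lra.
have [|u uG /andP[su ule]] := right_nbr gG sG; first by lra.
have [? ? ? ?] := good_in gG uG; exists u => //.
by move: (su); rewrite left_ofE => suE; split=> //; lra.
Qed.

(** The step required by [chain_lt]: the part at the north-west germ of the point where [s] ends on
    the left side of [k] abuts [k] and rests on [s]. *)
Lemma left_next G k s t : good G ->
  k \in parts G -> s \in parts G -> t \in parts G ->
  left_of s k -> left_of t k -> yb s < yb t ->
  exists2 u, u \in parts G &
    [/\ below s u, left_of u k, yb s < yb u & yb u <= yb t].
Proof.
move=> gG kG sG tG; rewrite !left_ofE => sk tk lt_st.
have [? ?] := good_nd gG sG; have [? ?] := good_nd gG tG.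
have [? ?] := good_nd gG kG.
have [? ? ? ?] := good_in gG kG; have [? ? ? ?] := good_in gG sG.
have le_st : yt s <= yb t.
  by case: (sep_or gG sG tG) => [e|]; [subst t|rewrite /apart => ?]; lra.
have [||u uG uP] := cov_nw gG (x := xl k) (y := yt s); [lra|lra|].
exists u => //; have [? ?] := good_nd gG uG.
have uk : xr u = xl k.
  by case: (sep_or gG uG kG) => [e|]; [subst u|rewrite /apart => ?]; lra.
have us : yb u = yt s.
  by case: (sep_or gG uG sG) => [e|]; [subst u|rewrite /apart => ?]; lra.
by split; rewrite ?belowE ?left_ofE; lra.
Qed.

Lemma left_eq G k s t : good G -> s \in parts G -> t \in parts G ->
  left_of s k -> left_of t k -> yb s = yb t -> s = t.
Proof.
move=> gG sG tG; rewrite !left_ofE => sk tk e; have [? ?] := good_nd gG sG.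
have [? ?] := good_nd gG tG.
by case: (sep_or gG sG tG) => //; rewrite /apart => ?; exfalso; lra.
Qed.

Variables (I : eqType) (ls : seq I) (a b : I -> rect F) (G H : predrawing F).
Hypotheses (gG : good G) (gH : good H) (ab : labelled ls a b G H).

Let aG i : i \in ls -> a i \in parts G.
Proof. by move=> /(lab_mem ab)/andP[]. Qed.
Let bH i : i \in ls -> b i \in parts H.
Proof. by move=> /(lab_mem ab)/andP[]. Qed.

(** Touching the bottom boundary amounts to having no neighbour below, which is a statement on
    adjacencies. *)
Lemma bottom_lr i : i \in ls -> yb (a i) = yb (box G) -> yb (b i) = yb (box H).
Proof.
move=> ils ei; have [_ _ le _] := good_in gH (bH ils).
apply/eqP; rewrite eq_le le andbT leNgt; apply/negP => lt.
have [u uH] := below_nbr gH (bH ils) lt.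
have [j jls <-] := lab_ex (lab_sym ab) uH; rewrite (lab_below ab) // belowE.
by have [? ?] := good_nd gG (aG jls); have [? ? ? ?] := good_in gG (aG jls); lra.
Qed.

Lemma left_lr i : i \in ls -> xl (a i) = xl (box G) -> xl (b i) = xl (box H).
Proof.
move=> ils ei; have [le _ _ _] := good_in gH (bH ils).
apply/eqP; rewrite eq_le le andbT leNgt; apply/negP => lt.
have [u uH] := left_nbr gH (bH ils) lt.
have [j jls <-] := lab_ex (lab_sym ab) uH; rewrite (lab_left ab) // left_ofE.
by have [? ?] := good_nd gG (aG jls); have [? ? ? ?] := good_in gG (aG jls); lra.
Qed.

Lemma right_lr i : i \in ls -> xr (a i) = xr (box G) -> xr (b i) = xr (box H).
Proof.
move=> ils ei; have [_ le _ _] := good_in gH (bH ils).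
apply/eqP; rewrite eq_le le /= leNgt; apply/negP => lt.
have [u uH /andP[]] := right_nbr gH (bH ils) lt.
have [j jls <-] := lab_ex (lab_sym ab) uH; rewrite (lab_left ab) // left_ofE.
by have [? ?] := good_nd gG (aG jls); have [? ? ? ?] := good_in gG (aG jls); lra.
Qed.

(** [chain_lt] on the parts touching the bottom boundary: consecutive ones are related by [left_of],
    which every drawing respects. On the left neighbours of a fixed part, [below] has the same
    role. *)
Lemma bottom_lt_lr i j : i \in ls -> j \in ls ->
  yb (a i) = yb (box G) -> yb (a j) = yb (box G) ->
  xl (a i) < xl (a j) -> xl (b i) < xl (b j).
Proof.
have ainj : {in ls &, injective a}.
  by apply: uniq_map_inj; rewrite (perm_uniq (lab_l ab)) (good_uniq gG).
pose K := [seq i <- ls | yb (a i) == yb (box G)].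
have inK k : (k \in K) = (yb (a k) == yb (box G)) && (k \in ls).
  exact: mem_filter.
move=> ils jls ei ej; apply: (@chain_lt _ _ K (fun i j => left_of (a i) (a j)) (fun i => xl (a i)) (fun i => xl (b i))).
- move=> k m; rewrite !inK => /andP[_ kls] /andP[_ mls].
  rewrite -(lab_left ab) // left_ofE; have [? ?] := good_nd gH (bH kls).
  by lra.
- move=> k m; rewrite !inK => /andP[/eqP ek kls] /andP[/eqP em mls] e.
  by apply: ainj => //; exact: bottom_eq gG (aG kls) (aG mls) ek em e.
- move=> k m; rewrite !inK => /andP[/eqP ek kls] /andP[/eqP em mls] lt.
  have [u uG [uP eu]] := bottom_next gG (aG kls) (aG mls) ek em lt.
  have [n nls e] := lab_ex ab uG; subst u => ? ?.
  by exists n; rewrite ?inK ?eu ?eqxx.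
- by rewrite inK ei eqxx.
- by rewrite inK ej eqxx.
Qed.

Lemma left_lt_lr k i j : k \in ls -> i \in ls -> j \in ls ->
  left_of (a i) (a k) -> left_of (a j) (a k) ->
  yb (a i) < yb (a j) -> yb (b i) < yb (b j).
Proof.
have ainj : {in ls &, injective a}.
  by apply: uniq_map_inj; rewrite (perm_uniq (lab_l ab)) (good_uniq gG).
move=> kls; pose K := [seq i <- ls | left_of (a i) (a k)].
have inK n : (n \in K) = left_of (a n) (a k) && (n \in ls).
  exact: mem_filter.
move=> ils jls ei ej; apply: (@chain_lt _ _ K (fun i j => below (a i) (a j)) (fun i => yb (a i)) (fun i => yb (b i))).
- move=> n m; rewrite !inK => /andP[_ nls] /andP[_ mls].
  rewrite -(lab_below ab) // belowE; have [? ?] := good_nd gH (bH nls).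
  by lra.
- move=> n m; rewrite !inK => /andP[en nls] /andP[em mls] e.
  by apply: ainj => //; exact: left_eq gG (aG nls) (aG mls) en em e.
- move=> n m; rewrite !inK => /andP[en nls] /andP[em mls] lt.
  have [u uG [uP eu]] := left_next gG (aG kls) (aG nls) (aG mls) en em lt.
  have [o ols e] := lab_ex ab uG; subst u => ? ?.
  by exists o; rewrite ?inK ?eu.
- by rewrite inK ei.
- by rewrite inK ej.
Qed.

End Touching.

Section TouchingInvariance.
Variable F : realFieldType.
Variables (I : eqType) (ls : seq I) (a b : I -> rect F) (G H : predrawing F).
Hypotheses (gG : good G) (gH : good H) (ab : labelled ls a b G H).

Lemma lab_bottom i : i \in ls ->
  (yb (b i) == yb (box H)) = (yb (a i) == yb (box G)).
Proof.
by move=> ils; apply/eqP/eqP; [apply: (bottom_lr gH gG (lab_sym ab))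
  | apply: (bottom_lr gG gH ab)].
Qed.

Lemma lab_leftmost i : i \in ls ->
  (xl (b i) == xl (box H)) = (xl (a i) == xl (box G)).
Proof.
by move=> ils; apply/eqP/eqP; [apply: (left_lr gH gG (lab_sym ab))
  | apply: (left_lr gG gH ab)].
Qed.

Lemma lab_rightmost i : i \in ls ->
  (xr (b i) == xr (box H)) = (xr (a i) == xr (box G)).
Proof.
by move=> ils; apply/eqP/eqP; [apply: (right_lr gH gG (lab_sym ab))
  | apply: (right_lr gG gH ab)].
Qed.

Lemma lab_bottom_lt i j : i \in ls -> j \in ls ->
  yb (a i) = yb (box G) -> yb (a j) = yb (box G) ->
  (xl (b i) < xl (b j)) = (xl (a i) < xl (a j)).
Proof.
move=> ils jls ei ej; apply/idP/idP; last exact: (bottom_lt_lr gG gH ab).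
by apply: (bottom_lt_lr gH gG (lab_sym ab)) => //; apply/eqP;
  rewrite lab_bottom // ?ei ?ej eqxx.
Qed.

Lemma lab_left_lt k i j : k \in ls -> i \in ls -> j \in ls ->
  left_of (a i) (a k) -> left_of (a j) (a k) ->
  (yb (b i) < yb (b j)) = (yb (a i) < yb (a j)).
Proof.
move=> kls ils jls ik jk; apply/idP/idP; last exact: (left_lt_lr gG gH ab) ik jk.
by apply: (left_lt_lr gH gG (lab_sym ab) kls); rewrite // (lab_left ab).
Qed.

End TouchingInvariance.

(** * Vertical insertion points *)

Section VerticalPoints.
Variable F : realFieldType.
Implicit Types (G H : predrawing F) (r s t u : rect F) (S : seq F).

Let mid (ab : F * F) : F := (ab.1 + ab.2) / 2.

Lemma size_mids S : size (zip S (behead S)) = (size S).-1.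
Proof. by rewrite size_zip size_behead; apply/minn_idPr/leq_pred. Qed.

Lemma nth_mids S i : (i.+1 < size S)%N ->
  nth 0 (map mid (zip S (behead S))) i = (nth 0 S i + nth 0 S i.+1) / 2.
Proof.
move=> lt; have ltp : (i < (size S).-1)%N by case: (size S) lt.
rewrite (nth_map (0, 0)) ?size_mids // nth_zip_cond size_mids ltp /mid /=.
by rewrite nth_behead.
Qed.

Lemma midpoints_uniq S : uniq (midpoints S).
Proof.
have : sorted <%R (sort <=%R (undup S)) by rewrite sort_lt_sorted undup_uniq.
rewrite /midpoints; set s := sort _ _ => ss; apply: lt_sorted_uniq.
apply/(sortedP 0) => i; rewrite -/(map mid _) size_map size_mids => lti.
have lt2 : (i.+2 < size s)%N by case: (size s) lti.
rewrite !nth_mids ?(ltnW lt2) //.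
have := sortedP 0 ss i (ltnW lt2); have := sortedP 0 ss i.+1 lt2.
by lra.
Qed.

Lemma midpointsP S m : reflect
  (exists a b, [/\ a \in S, b \in S, a < b, m = (a + b) / 2
    & {in S, forall c, a < c < b -> False}]) (m \in midpoints S).
Proof.
have : sorted <%R (sort <=%R (undup S)) by rewrite sort_lt_sorted undup_uniq.
rewrite /midpoints; set s := sort _ _ => ss.
have sS : s =i S by move=> x; rewrite mem_sort mem_undup.
have mono := lt_sorted_ltn_nth 0 ss.
apply: (iffP (nthP 0)) => [[i]|[a [b]]].
  rewrite -/(map mid _) size_map size_mids => lti.
  have lt2 : (i.+1 < size s)%N by case: (size s) lti.
  rewrite nth_mids // => <-; exists (nth 0 s i), (nth 0 s i.+1); split=> //.
  - by rewrite -sS mem_nth // ltnW.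
  - by rewrite -sS mem_nth.
  - by rewrite mono ?inE // ltnW.
  - move=> c; rewrite -sS => /(nthP 0)[k kl <-].
    have il := ltnW lt2; rewrite !mono ?inE // => /andP[ik ki].
    by have := leq_trans ik ki; rewrite ltnn.
rewrite -!sS => -[/(nthP 0)[i il <-] /(nthP 0)[k kl <-]].
rewrite mono // => ik -> none.
have ek : k = i.+1.
  apply/eqP; rewrite eqn_leq ik andbT leqNgt; apply/negP => ltk.
  have l : (i.+1 < size s)%N := ltn_trans ltk kl.
  apply: (none (nth 0 s i.+1)); first by rewrite -sS mem_nth.
  by rewrite !mono ?inE ?ltnSn.
subst k; exists i; rewrite -/(map mid _) ?nth_mids // size_map size_mids.
by case: (size s) kl.
Qed.

(* The edge on the left side of [t] (a part on the bottom boundary) shared with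
   its left neighbour [s]; [s = t] stands for the edge on the left boundary. *)
Definition is_key G t s := (yb t == yb (box G)) &&
  (left_of s t || ((s == t) && (xl t == xl (box G)))).

(** The midpoint of the edge. Its lower end is [yb s], never lower than [t] since [t] is on the
    bottom boundary; its upper end is the lower of the two tops. *)
Definition key_point t s : F * F := (xl t, (yb s + Num.min (yt s) (yt t)) / 2).

Lemma is_keyP G t s : good G -> t \in parts G -> s \in parts G ->
  is_key G t s -> [/\ yb t = yb (box G), yb s < Num.min (yt s) (yt t),
    yb t <= yb s, Num.min (yt s) (yt t) <= yt s /\ Num.min (yt s) (yt t) <= yt t
    & (xr s = xl t /\ left_of s t) \/ (s = t /\ xl t = xl (box G))].
Proof.
move=> gG tG sG /andP[/eqP et key]; have [? ?] := good_nd gG sG.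
have [? ?] := good_nd gG tG; have [_ _ ? _] := good_in gG sG.
rewrite ge_min lexx ge_min lexx orbT lt_min et; split=> //.
  case/orP: key => [|/andP[/eqP-> _]]; rewrite ?left_ofE; lra.
case/orP: key => [st|/andP[/eqP-> /eqP ?]]; [left|by right].
by split=> //; move: st; rewrite left_ofE; lra.
Qed.

Definition left_heights G t :=
  [seq v.2 | v <- vertices G & (v.1 == xl t) && (yb t <= v.2 <= yt t)].

Lemma left_heightsP G t y : reflect
  (exists2 u, u \in parts G & [/\ (xl u == xl t) || (xr u == xl t),
     (y == yb u) || (y == yt u) & yb t <= y <= yt t])
  (y \in left_heights G t).
Proof.
apply: (iffP mapP) => [[v]|[u uG [ux uy yP]]].
  rewrite mem_filter => /andP[/andP[vx vy]] /flatten_mapP[u uG uv] ->.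
  exists u => //; move: uv vx vy; rewrite !inE.
  by case/or4P => /eqP-> /= -> ->; rewrite ?eqxx ?orbT.
have [x xP] : exists2 x, (x == xl u) || (x == xr u) & x = xl t.
  by case/orP: ux => /eqP e; [exists (xl u) | exists (xr u)]; rewrite ?eqxx ?orbT.
move=> ex; exists (x, y) => //; rewrite mem_filter /= ex eqxx yP /=.
apply/flatten_mapP; exists u => //; rewrite !inE -ex.
by case/orP: xP => /eqP->; case/orP: uy => /eqP->; rewrite eqxx ?orbT.
Qed.

(** A part with a vertical side on this line and a vertex strictly inside the edge would overlap [t]
    or [s], which occupy both sides of the edge, or leave the box. *)
Lemma key_no_height G t s y : good G -> t \in parts G -> s \in parts G ->
  is_key G t s -> y \in left_heights G t ->
  yb s < y < Num.min (yt s) (yt t) -> False.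
Proof.
move=> gG tG sG key /left_heightsP[u uG [ux uy yP]].
have [et _ le1 _ k] := is_keyP gG tG sG key.
have [? ?] := good_nd gG sG; have [? ?] := good_nd gG tG.
have [? ?] := good_nd gG uG; have [? ? ? ?] := good_in gG uG.
rewrite lt_min => ys.
case/orP: ux => [ux|ux].
  by case: (sep_or gG uG tG) => [e|]; [subst u | rewrite /apart => ?];
    case: k => [[? ?]|[? ?]]; try subst s; lra.
case: k => [[xs _]|[? ?]]; last by subst s; lra.
by case: (sep_or gG uG sG) => [e|]; [subst u | rewrite /apart => ?]; lra.
Qed.

Lemma key_exists G t y : good G -> t \in parts G -> yb t = yb (box G) ->
  yb t <= y < yt t ->
  exists2 s, s \in parts G & is_key G t s && (yb s <= y < Num.min (yt s) (yt t)).
Proof.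
move=> gG tG et yP; have [? ?] := good_nd gG tG.
have [? ? ? ?] := good_in gG tG.
have [xt|xt] := leP (xl t) (xl (box G)).
  have ex : xl t = xl (box G) by lra.
  by exists t => //; rewrite /is_key et ex !eqxx orbT lt_min; lra.
have [||s sG sP] := cov_nw gG (x := xl t) (y := y); [lra|lra|].
exists s => //; rewrite /is_key et eqxx left_ofE lt_min.
have [? ?] := good_nd gG sG.
by case: (sep_or gG sG tG) => [e|]; [subst s|rewrite /apart => ?]; lra.
Qed.

Lemma key_heights G t s : good G -> t \in parts G -> s \in parts G ->
  is_key G t s -> yb s \in left_heights G t /\
    Num.min (yt s) (yt t) \in left_heights G t.
Proof.
move=> gG tG sG key; have [et lt le1 [le2 le3] k] := is_keyP gG tG sG key.
have [? ?] := good_nd gG sG; have [? ?] := good_nd gG tG.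
have ux : (xl s == xl t) || (xr s == xl t).
  by case: k => [[-> _]|[-> _]]; rewrite eqxx ?orbT.
split; apply/left_heightsP.
  by exists s => //; split; rewrite ?eqxx //; lra.
have [le|le] := leP (yt s) (yt t); last first.
  by exists t; rewrite ?eqxx ?orbT //; split=> //; lra.
by exists s => //; split; rewrite ?eqxx ?orbT //; lra.
Qed.

(** Both ends of the edge of a key are heights of vertices and no height lies strictly between them,
    so these edges are exactly the gaps between consecutive heights. *)
Lemma left_side_points_keys G t : good G -> t \in parts G ->
  yb t = yb (box G) ->
  perm_eq (left_side_points G t)
          [seq key_point t s | s <- parts G & is_key G t s].
Proof.
move=> gG tG et; apply: uniq_perm.
- by rewrite map_inj_uniq ?midpoints_uniq // => y y' [].
- rewrite map_inj_in_uniq ?filter_uniq ?(good_uniq gG) // => s u.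
  rewrite !mem_filter => /andP[ks sG] /andP[ku uG] [e].
  have [_ s1 _ [s2 s3] _] := is_keyP gG tG sG ks.
  have [_ u1 _ [u2 u3] _] := is_keyP gG tG uG ku.
  have [hs1 hs2] := key_heights gG tG sG ks.
  have [hu1 hu2] := key_heights gG tG uG ku.
  have A y := @key_no_height _ _ _ y gG tG sG ks.
  have B y := @key_no_height _ _ _ y gG tG uG ku.
  have {A} A1 := A _ hu1; have {B} B1 := B _ hs1.
  have es : yb s = yb u by lra.
  case/andP: (ks) => _ /orP[k1|/andP[/eqP e1 k1]];
    case/andP: (ku) => _ /orP[k2|/andP[/eqP e2 k2]].
  + exact: left_eq gG sG uG k1 k2 es.
  + subst u; have [? ?] := good_nd gG sG; have [? ? ? ?] := good_in gG sG.
    by move: k1; rewrite left_ofE => ?; exfalso; lra.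
  + subst s; have [? ?] := good_nd gG uG; have [? ? ? ?] := good_in gG uG.
    by move: k2; rewrite left_ofE => ?; exfalso; lra.
  + by rewrite e1 e2.
- move=> [x y]; apply/mapP/mapP => [[m /midpointsP[a [b]]]|[s]].
    rewrite -/(left_heights G t) => -[aS bS ab -> none] [-> ->].
    have /left_heightsP[_ _ [_ _ abd]] := aS.
    have /left_heightsP[_ _ [_ _ bbd]] := bS.
    have [|s sG /andP[key sa]] := key_exists gG tG et (y := a); first by lra.
    have [hs1 hs2] := key_heights gG tG sG key.
    exists s; first by rewrite mem_filter key.
    have A y := @key_no_height _ _ _ y gG tG sG key.
    have A1 := A _ aS; have A2 := A _ bS; have B2 := none _ hs2.
    by congr pair; lra.
  rewrite mem_filter => /andP[key sG] [-> ->].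
  have [hs1 hs2] := key_heights gG tG sG key.
  have [_ s1 _ [s2 s3] _] := is_keyP gG tG sG key.
  eexists; last reflexivity; apply/midpointsP; rewrite -/(left_heights G t).
  exists (yb s), (Num.min (yt s) (yt t)); split=> // c cS.
  exact: key_no_height cS.
Qed.

Lemma lex_xy_total : total (@lex_xy F).
Proof.
move=> [a b] [c d]; rewrite /lex_xy /=.
by case: ltgtP => //= _; apply: le_total.
Qed.

Lemma lex_xy_trans : transitive (@lex_xy F).
Proof.
move=> [a b] [c d] [e f]; rewrite /lex_xy /= => h1 h2.
by lra.
Qed.

Lemma lex_xy_anti : antisymmetric (@lex_xy F).
Proof.
move=> [a b] [c d]; rewrite /lex_xy /= => h1.
by congr pair; lra.
Qed.

End VerticalPoints.

Lemma perm_flatten_map (T : Type) (T' : eqType) (f g : T -> seq T') (s : seq T)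
    (P : T -> Prop) :
  (forall x, P x -> perm_eq (f x) (g x)) -> List.Forall P s ->
  perm_eq (flatten (map f s)) (flatten (map g s)).
Proof. by move=> fg; elim=> //= x l Px _ IH; apply: perm_cat => //; apply: fg. Qed.

Lemma flatten_map_filter (T T' : Type) (P : pred T) (f : T -> seq T')
    (s : seq T) : (forall x, ~~ P x -> f x = [::]) ->
  flatten [seq f x | x <- s & P x] = flatten [seq f x | x <- s].
Proof.
by move=> fP; elim: s => //= x s IH; case: ifPn => [_ /=|/fP->]; rewrite ?IH.
Qed.

Section Keys.
Variable F : realFieldType.
Implicit Types (G H : predrawing F) (r s t u : rect F).

(** Edges on one left side do not overlap, so their midpoints are ordered as their lower ends. *)
Lemma key_mid_le G t s u : good G ->
  t \in parts G -> s \in parts G -> u \in parts G ->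
  is_key G t s -> is_key G t u ->
  ((key_point t s).2 <= (key_point t u).2) = (yb s <= yb u).
Proof.
move=> gG tG sG uG ks ku /=.
have [_ s1 _ [s2 s3] _] := is_keyP gG tG sG ks.
have [_ u1 _ [u2 u3] _] := is_keyP gG tG uG ku.
have [hs1 hs2] := key_heights gG tG sG ks.
have [hu1 hu2] := key_heights gG tG uG ku.
have A := @key_no_height _ _ _ _ _ gG tG sG ks hu1.
have B := @key_no_height _ _ _ _ _ gG tG uG ku hs1.
have A' := @key_no_height _ _ _ _ _ gG tG sG ks hu2.
have B' := @key_no_height _ _ _ _ _ gG tG uG ku hs2.
by apply/idP/idP; lra.
Qed.

Lemma key_eq G t s u : good G ->
  t \in parts G -> s \in parts G -> u \in parts G ->
  is_key G t s -> is_key G t u -> yb s = yb u -> s = u.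
Proof.
move=> gG tG sG uG /andP[_ /orP[k1|/andP[/eqP e1 /eqP k1]]]
  /andP[_ /orP[k2|/andP[/eqP e2 /eqP k2]]] es.
+ exact: left_eq gG sG uG k1 k2 es.
+ subst u; have [? ?] := good_nd gG sG; have [? ? ? ?] := good_in gG sG.
  by move: k1; rewrite left_ofE => ?; exfalso; lra.
+ subst s; have [? ?] := good_nd gG uG; have [? ? ? ?] := good_in gG uG.
  by move: k2; rewrite left_ofE => ?; exfalso; lra.
+ by rewrite e1 e2.
Qed.

Lemma key_point_inj G t s t' s' : good G ->
  t \in parts G -> s \in parts G -> t' \in parts G -> s' \in parts G ->
  is_key G t s -> is_key G t' s' -> key_point t s = key_point t' s' ->
  t = t' /\ s = s'.
Proof.
move=> gG tG sG tG' sG' k k' [ex ey].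
have e : t = t'.
  have [/eqP et _] := andP k; have [/eqP et' _] := andP k'.
  exact: bottom_eq et et' ex.
subst t'; split=> //; apply: (key_eq gG tG sG sG' k k').
have := key_mid_le gG tG sG sG' k k'; have := key_mid_le gG tG sG' sG k' k.
rewrite /= ey lexx => /esym h1 /esym h2.
by apply/eqP; rewrite eq_le h1 h2.
Qed.

Variables (I : eqType) (ls : seq I).
Implicit Types (a b : I -> rect F).

Definition key_labels G a : seq (I * I) :=
  [seq p <- [seq (i, j) | i <- ls, j <- ls] | is_key G (a p.1) (a p.2)].

Definition point_at a (p : I * I) : F * F := key_point (a p.1) (a p.2).

Lemma mem_key_labels G a p :
  (p \in key_labels G a) =
  [&& p.1 \in ls, p.2 \in ls & is_key G (a p.1) (a p.2)].
Proof.
rewrite mem_filter andbC andbA; congr (_ && _); apply/allpairsP/andP.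
  by case=> -[i j] [/= ? ? ->].
by case: p => i j [? ?]; exists (i, j).
Qed.

Lemma perm_key_labels G a : good G -> perm_eq (map a ls) (parts G) ->
  perm_eq (flatten [seq left_side_points G t | t <- parts G & touches_bottom G t])
    [seq point_at a p | p <- key_labels G a].
Proof.
move=> gG pa.
have h : perm_eq
    (flatten [seq left_side_points G t | t <- parts G & touches_bottom G t])
    (flatten [seq [seq key_point t s | s <- parts G & is_key G t s]
             | t <- parts G & touches_bottom G t]).
  apply: (@perm_flatten_map _ _ _ _ _
    (fun t => t \in parts G /\ touches_bottom G t)).
    by move=> t [tG /eqP]; apply: left_side_points_keys.
  apply/List.Forall_forall => t tG.
  have : t \in [seq t <- parts G | touches_bottom G t].
    by move: tG; elim: [seq _ <- _ | _] => //= ? l IH [->|/IH];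
      rewrite inE ?eqxx // => ->; rewrite orbT.
  by rewrite mem_filter => /andP[].
apply: (perm_trans h); rewrite flatten_map_filter; last first.
  by move=> t nt; rewrite (eq_filter (a2 := pred0)) ?filter_pred0 // => s;
     rewrite /is_key -/(touches_bottom G t) (negPf nt).
have -> : [seq point_at a p | p <- key_labels G a] =
   flatten [seq [seq key_point (a i) t | t <- map a ls & is_key G (a i) t]
           | i <- ls].
  rewrite /key_labels filter_flatten map_flatten -!map_comp; congr flatten.
  by apply: eq_map => i /=; rewrite !filter_map -!map_comp.
rewrite (map_comp (fun t => [seq key_point t s | s <- map a ls & is_key G t s]) a).
apply: (@perm_trans _ (flatten [seq [seq key_point t s | s <- map a ls & is_key G t s]
     | t <- parts G])).
  apply: (@perm_flatten_map _ _ _ _ _ (fun=> True)); last first.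
    by elim: (parts G) => //= *; constructor.
  by move=> t _; apply/perm_map/perm_filter; rewrite perm_sym.
by apply/perm_flatten/perm_map; rewrite perm_sym.
Qed.

Lemma vertical_points_labels G a : good G -> perm_eq (map a ls) (parts G) ->
  vertical_points G =
  map (point_at a) (sort (relpre (point_at a) (@lex_xy F)) (key_labels G a)).
Proof.
move=> gG pa; rewrite -sort_map; apply/perm_sortP.
- exact: lex_xy_total.
- exact: lex_xy_trans.
- exact: lex_xy_anti.
exact: perm_key_labels.
Qed.

Variables (a b : I -> rect F) (G H : predrawing F).
Hypotheses (gG : good G) (gH : good H) (ab : labelled ls a b G H).

Let aG i : i \in ls -> a i \in parts G.
Proof. by move=> /(lab_mem ab)/andP[]. Qed.
Let bH i : i \in ls -> b i \in parts H.
Proof. by move=> /(lab_mem ab)/andP[]. Qed.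
Let a_inj : {in ls &, injective a}.
Proof. by apply: uniq_map_inj; rewrite (perm_uniq (lab_l ab)) (good_uniq gG). Qed.
Let b_inj : {in ls &, injective b}.
Proof. by apply: uniq_map_inj; rewrite (perm_uniq (lab_r ab)) (good_uniq gH). Qed.

Lemma is_key_labelled : {in ls &, forall i j,
  is_key H (b i) (b j) = is_key G (a i) (a j)}.
Proof.
move=> i j ils jls; rewrite /is_key (lab_bottom gG gH ab) //.
rewrite (lab_left ab) // (lab_leftmost gG gH ab) //; congr (_ && (_ || (_ && _))).
by apply/eqP/eqP => [/b_inj->|/a_inj->].
Qed.

Lemma key_labels_labelled : key_labels H b = key_labels G a.
Proof.
apply: eq_in_filter => -[i j] /allpairsP[[i' j'] [/= ils jls [-> ->]]].
exact: is_key_labelled.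
Qed.

Lemma point_at_inj : {in key_labels G a &, injective (point_at a)}.
Proof.
move=> [i j] [k l]; rewrite !mem_key_labels /= => /and3P[ils jls ij].
move=> /and3P[kls lls kl] e.
have [||||/a_inj-> // /a_inj-> //] := key_point_inj gG _ _ _ _ ij kl e;
  exact: aG.
Qed.

Lemma uniq_key_labels : uniq (key_labels G a).
Proof.
apply/filter_uniq/allpairs_uniq => [||[? ?] [? ?] _ _ [-> ->] //];
  by apply: (map_uniq (f := a)); rewrite (perm_uniq (lab_l ab)) (good_uniq gG).
Qed.

(** Points compare first by [t] along the bottom boundary, then by [s] along the left side of [t];
    both orders are adjacency invariants. *)
Lemma lex_labelled : {in key_labels G a &, forall p q,
  lex_xy (point_at a p) (point_at a q) -> lex_xy (point_at b p) (point_at b q)}.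
Proof.
move=> [i j] [k l]; rewrite !mem_key_labels /= => /and3P[ils jls ij].
move=> /and3P[kls lls kl]; have [/eqP ei _] := andP ij.
have [/eqP ek _] := andP kl; case/orP => [/= lt|/andP[/= /eqP e le]].
  by apply/orP; left; rewrite /= (lab_bottom_lt gG gH ab).
have {}e : i = k by apply: a_inj => //; apply: (bottom_eq gG (aG ils) (aG kls)).
subst k; apply/orP; right; rewrite eqxx /=.
have bij : is_key H (b i) (b j) by rewrite is_key_labelled.
have bil : is_key H (b i) (b l) by rewrite is_key_labelled.
have := key_mid_le gG (aG ils) (aG jls) (aG lls) ij kl; rewrite /= le.
move=> /esym {}le; rewrite (key_mid_le gH (bH ils) (bH jls) (bH lls) bij bil).
move: le; rewrite le_eqVlt => /orP[/eqP e|lt].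
  suff -> : j = l by [].
  by apply: a_inj => //; apply: (key_eq gG (aG ils) (aG jls) (aG lls) ij kl).
(* A key with [s = t] lies on the left boundary and is the only key of its [t], so it is not
   strictly comparable with another one. *)
case/andP: ij => _ /orP[lj|/andP[/eqP ej xe]]; last first.
  have [_ _ h _ _] := is_keyP gG (aG ils) (aG lls) kl.
  case/andP: kl => _ /orP[ll|/andP[/eqP el _]]; last first.
    by move: lt; rewrite ej el ltxx.
  have [? ?] := good_nd gG (aG lls); have [? ? ? ?] := good_in gG (aG lls).
  by move: ll; rewrite left_ofE => ?; lra.
case/andP: kl => _ /orP[ll|/andP[/eqP el xe]]; last first.
  have [? ?] := good_nd gG (aG jls); have [? ? ? ?] := good_in gG (aG jls).
  by move: lj; rewrite left_ofE => ?; lra.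
by apply: ltW; rewrite (lab_left_lt gG gH ab ils jls lls).
Qed.

End Keys.

Section KeysLabelled.
Variable F : realFieldType.
Variables (I : eqType) (ls : seq I) (a b : I -> rect F) (G H : predrawing F).
Hypotheses (gG : good G) (gH : good H) (ab : labelled ls a b G H).

(** One list [ks] serves both drawings, so points with the same index lie on corresponding edges.
    This makes the numbering of the children independent of the drawing. *)
Lemma vertical_points_labelled : exists ks : seq (I * I),
  [/\ vertical_points G = map (point_at a) ks,
      vertical_points H = map (point_at b) ks, uniq ks
    & forall p, (p \in ks) = [&& p.1 \in ls, p.2 \in ls & is_key G (a p.1) (a p.2)]].
Proof.
exists (sort (relpre (point_at a) (@lex_xy F)) (key_labels ls G a)); split.
- exact: vertical_points_labels (lab_l ab).
- rewrite (vertical_points_labels gH (lab_r ab)) -sort_map.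
  rewrite (key_labels_labelled gG gH ab).
  apply: (@homo_sort_map_in _ _ (mem (key_labels ls G a))).
  + move=> p q pK qK /lex_xy_anti e.
    have := point_at_inj gH (lab_sym ab); rewrite (key_labels_labelled gG gH ab).
    by apply.
  + by move=> p q r _ _ _; apply: lex_xy_trans.
  + by move=> p q _ _; apply: lex_xy_total.
  + by move=> p q pK qK; apply: (lex_labelled gG gH ab).
  + exact/allP.
- by rewrite sort_uniq (uniq_key_labels gG ab).
- by move=> p; rewrite mem_sort mem_key_labels.
Qed.

End KeysLabelled.

(** * Vertical insertion *)

Section VerticalInsertion.
Variable F : realFieldType.
Implicit Types (G H : predrawing F) (r s t u : rect F) (q : F * F).

Definition raise G q t :=
  if touches_bottom G t && (q.1 <= xl t) then set_yb q.2 t else t.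

Definition new_part G q := Rect q.1 (xr (box G)) (yb (box G)) q.2.

Lemma insert_verticalE G q :
  insert_vertical G q = (box G, new_part G q :: map (raise G q) (parts G)).
Proof. by []. Qed.

Definition on_key G t0 s0 q :=
  [/\ t0 \in parts G, s0 \in parts G, is_key G t0 s0, q.1 = xl t0
    & yb s0 < q.2 < Num.min (yt s0) (yt t0)].

Section Relations.
Variables (G : predrawing F) (t0 s0 : rect F) (q : F * F).
Hypotheses (gG : good G) (gH : good (insert_vertical G q)).
Hypothesis qP : on_key G t0 s0 q.

Let r := new_part G q.

Lemma on_keyP : [/\ yb t0 = yb (box G), yb (box G) <= yb s0, yb s0 < q.2,
  q.2 < yt s0 /\ q.2 < yt t0
  & (xr s0 = xl t0 /\ left_of s0 t0) \/ (s0 = t0 /\ xl t0 = xl (box G))].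
Proof.
have [t0G s0G k _ qy] := qP; have [et ? le1 [? ?] ?] := is_keyP gG t0G s0G k.
by split=> //; lra.
Qed.

(** All of this is forced by [gH]: a part that is not raised has to be apart from the new one. *)
Lemma raiseP t : t \in parts G ->
  [/\ raise G q t = set_yb q.2 t, yb t = yb (box G), q.1 <= xl t & q.2 < yt t] \/
  [/\ raise G q t = t, yb (box G) < yb t \/ xl t < q.1
    & xr t <= q.1 \/ q.2 < yb t].
Proof.
have [t0G s0G _ q1 _] := qP; have [et0 hs hs1 [_ hs3] _] := on_keyP.
have [box1 box2] := good_box gG.
have rH : r \in parts (insert_vertical G q) by rewrite mem_head.
have inH u : u \in parts G -> raise G q u \in parts (insert_vertical G q).
  by move=> uG; rewrite inE map_f ?orbT.
have neH u : u \in parts G -> raise G q u = r -> False.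
  move=> uG e; have := good_uniq gH; rewrite /= => /andP[/negP nr _].
  by apply: nr; have := map_f (raise G q) uG; rewrite e.
have weak u : u \in parts G ->
    [/\ raise G q u = set_yb q.2 u, yb u = yb (box G), q.1 <= xl u & q.2 < yt u] \/
    [/\ raise G q u = u, yb (box G) < yb u \/ xl u < q.1
      & xr u <= q.1 \/ q.2 <= yb u].
  move=> uG; have [? ?] := good_nd gG uG; have [? ? ? ?] := good_in gG uG.
  have := neH u uG; have := inH u uG; rewrite /raise /touches_bottom.
  case: ifPn => [/andP[/eqP eu lu] uH _|nu uH ne]; [left|right].
    by have [_] := good_nd gH uH.
  have n : yb (box G) < yb u \/ xl u < q.1 by lra.
  split=> //; case: (sep_or gH uH rH) => [/ne//|].
  by rewrite /apart /=; lra.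
move=> tG; case: (weak t tG) => [|[e1 e2 e3]]; [by left|right; split=> //].
have [? ?] := good_nd gG tG; have [? ? ? ?] := good_in gG tG.
case: (e3) => [|le]; first by left.
have [|gt] := leP (xr t) q.1; first by left.
(* Strictness: if [t] stood exactly at the level of [q], the part [u] just below it could not avoid
   the new part, so it would be raised, hence reach above [q] into [t]. *)
right; rewrite lt_neqAle le andbT; apply/eqP => ey.
have [? ? ? ?] := good_in gG t0G.
have [||u uG uP] := cov_se gG (x := Num.max (xl t) q.1) (y := q.2).
- by rewrite gt_max le_max; lra.
- lra.
have [? ?] := good_nd gG uG; move: uP; rewrite le_max gt_max => uP.
have ux : xl t < xr u by lra.
have xu : xl u < xr t by lra.
case: (weak u uG) => [[_ _ _ ?]|[_ _ ?]]; last by lra.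
by case: (sep_or gG tG uG) => [e|]; [subst u|rewrite /apart => ?]; lra.
Qed.

Lemma below_raise : {in parts G &, forall s t,
  below (raise G q s) (raise G q t) = below s t}.
Proof.
move=> s t sG tG; have [? ?] := good_nd gG sG; have [? ?] := good_nd gG tG.
have [? ? ? ?] := good_in gG sG; have [? ? ? ?] := good_in gG tG.
have [? ? ? [? ?] _] := on_keyP.
rewrite !belowE.
by case: (raiseP tG) => [[-> ? ? ?]|[-> ? ?]];
  case: (raiseP sG) => [[-> ? ? ?]|[-> ? ?]] /=; apply/idP/idP => ?; lra.
Qed.

(** The new part takes over the left side of [t0] below [q]. The left neighbours of [t0] lower than
    [s0] end below [q] and lose contact; [s0] keeps it, as its edge goes on above [q]. *)
Lemma left_of_raise : {in parts G &, forall s t,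
  left_of (raise G q s) (raise G q t) =
  left_of s t && ~~ ((t == t0) && (yb s < yb s0))}.
Proof.
move=> s t sG tG; have [? ?] := good_nd gG sG; have [? ?] := good_nd gG tG.
have [t0G s0G _ q1 _] := qP.
have [? ? ? ?] := good_in gG sG; have [? ? ? ?] := good_in gG tG.
have [? ?] := good_nd gG t0G; have [? ?] := good_nd gG s0G.
have [e1 ? ? [? ?] k] := on_keyP.
have [et|ne] := eqVneq t t0; last first.
  clear k; rewrite andbT !left_ofE.
  have tne : yb t = yb (box G) -> xl t = q.1 -> False.
    move=> e2 e3; case/eqP: ne; apply: (bottom_eq gG tG t0G e2 e1).
    by rewrite e3.
  by case: (raiseP tG) => [[-> e ? ?]|[-> ? ?]]; [have {}tne := tne e|];
    case: (raiseP sG) => [[-> ? ? ?]|[-> ? ?]] /=; apply/idP/idP => ?; lra.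
subst t; have := sep_or gG sG s0G; rewrite /apart => sep; rewrite !left_ofE.
have es : s = s0 -> yb s = yb s0 /\ yt s = yt s0 by move=> ->.
have et : s0 = t0 -> xl t0 = xl (box G) -> xr s = xl t0 -> False.
  by move=> _ ? ?; lra.
case: (raiseP tG) => [[-> ? ? ?]|[-> ? ?]]; last by lra.
case: (raiseP sG) => [[-> ? ? ?]|[-> ? ?]] /=.
  by apply/idP/idP => ?; lra.
case: k => [[k _]|[k1 k2]]; last by have := et k1 k2 => ?; apply/idP/idP => ?; lra.
case: sep => [/es[? ?]|?]; first by apply/idP/idP => ?; lra.
by apply/idP/idP => ?; lra.
Qed.

Lemma left_of_new s : s \in parts G ->
  left_of (raise G q s) r = left_of s t0 && (yb s <= yb s0).
Proof.
move=> sG; have [? ?] := good_nd gG sG.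
have [t0G s0G _ q1 _] := qP.
have [? ? ? ?] := good_in gG sG; have [? ? ? ?] := good_in gG t0G.
have [? ?] := good_nd gG t0G; have [? ?] := good_nd gG s0G.
have [e1 ? ? [? ?] k] := on_keyP.
have := sep_or gG sG s0G; rewrite /apart => sep; rewrite !left_ofE.
have es : s = s0 -> yb s = yb s0 /\ yt s = yt s0 by move=> ->.
case: (raiseP sG) => [[-> ? ? ?]|[-> ? ?]] /=.
  by apply/idP/idP => ?; lra.
case: k => [[k _]|[k1 k2]]; last by apply/idP/idP => ?; lra.
case: sep => [/es[? ?]|?]; first by apply/idP/idP => ?; lra.
by apply/idP/idP => ?; lra.
Qed.

Lemma below_new t : t \in parts G ->
  below r (raise G q t) = (yb t == yb (box G)) && (xl t0 <= xl t).
Proof.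
move=> tG; have [? ?] := good_nd gG tG; have [t0G s0G _ q1 _] := qP.
have [? ? ? ?] := good_in gG tG; have [? ? ? ?] := good_in gG t0G.
have [? ?] := good_nd gG t0G.
have [e1 ? ? [? ?] _] := on_keyP; rewrite belowE.
by case: (raiseP tG) => [[-> ? ? ?]|[-> ? ?]] /=; apply/idP/idP => ?; lra.
Qed.

Lemma new_left_of t : t \in parts G -> left_of r (raise G q t) = false.
Proof.
move=> tG; have [? ?] := good_nd gG tG; have [? ? ? ?] := good_in gG tG.
apply/negP; rewrite left_ofE.
by case: (raiseP tG) => [[-> ? ? ?]|[-> ? ?]] /= ?; lra.
Qed.

Lemma below_new_false t : t \in parts G -> below (raise G q t) r = false.
Proof.
move=> tG; have [? ?] := good_nd gG tG; have [? ? ? ?] := good_in gG tG.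
apply/negP; rewrite belowE.
by case: (raiseP tG) => [[-> ? ? ?]|[-> ? ?]] /= ?; lra.
Qed.

Lemma new_irreflexive : (left_of r r = false) * (below r r = false).
Proof.
have [_ ? ? _ _] := on_keyP; have [t0G _ _ q1 _] := qP.
have [? ?] := good_nd gG t0G; have [? ? ? ?] := good_in gG t0G.
by rewrite left_ofE belowE /=; split; apply/negP; lra.
Qed.

(* Recovers the relations before the insertion from those after it. *)
Lemma left_of_delete : {in parts G &, forall s t, left_of s t =
  left_of (raise G q s) (raise G q t) ||
  [&& left_of (raise G q s) r, below r (raise G q t) &
    has (fun u => left_of (raise G q u) r && left_of (raise G q u) (raise G q t))
        (parts G)]}.
Proof.
move=> s t sG tG; have [t0G s0G _ q1 _] := qP; have [e1 _ _ _ k] := on_keyP.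
rewrite left_of_raise // left_of_new // below_new //.
apply/idP/orP => [st|[/andP[]//|/and3P[/andP[st0 _] /andP[/eqP et xt] /hasP[u uG]]]].
  rewrite st; case: (boolP ((t == t0) && (yb s < yb s0))) => [/andP[/eqP e lt]|_];
    [right|by left].
  (* A cut contact is detected by [s0], which touches both the new part and the raised [t0]. *)
  subst t; rewrite st (ltW lt) e1 eqxx lexx /=; apply/hasP; exists s0 => //.
  suff st0 : left_of s0 t0.
    by rewrite left_of_new // left_of_raise // st0 lexx ltxx andbF.
  case: k => [[_ ->//]|[e e2]]; have [? ? ? ?] := good_in gG sG.
  by have [? ?] := good_nd gG sG; move: st; rewrite left_ofE => ?; lra.
(* Conversely, a common left neighbour puts [t] and [t0] on one vertical line, and both touch the
   bottom boundary. *)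
rewrite left_of_new // left_of_raise // => /andP[/andP[ut0 _] /andP[ut _]].
suff -> : t = t0 by [].
apply: (bottom_eq gG tG t0G et e1).
by move: ut0 ut; rewrite !left_ofE => ? ?; lra.
Qed.

End Relations.
End VerticalInsertion.

(** * Making room for an insertion *)

Section Room.
Variable F : realFieldType.
Implicit Types (G H : predrawing F) (r s t u : rect F) (q : F * F).

Lemma apart_irr t : xl t < xr t /\ yb t < yt t -> apart t t = false.
Proof. by rewrite /apart => ?; apply/negP => ?; lra. Qed.

Lemma uniq_map_apart (T : eqType) (f : T -> rect F) (ts : seq T) : uniq ts ->
  {in ts, forall i, xl (f i) < xr (f i) /\ yb (f i) < yt (f i)} ->
  {in ts &, forall i j, i != j -> apart (f i) (f j)} -> uniq (map f ts).
Proof.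
move=> uts nd ap; rewrite map_inj_in_uniq // => i j iT jT e.
apply/eqP/negPn/negP => /(ap _ _ iT jT); rewrite e apart_irr //.
exact: nd.
Qed.

(* The only parts reaching into the new rectangle are those it will cut. *)
Definition room G q := {in parts G, forall t, q.1 < xr t -> yb t <= q.2 ->
  [/\ yb t = yb (box G), q.1 <= xl t & q.2 < yt t]}.

Lemma insert_good G t0 s0 q : good G -> on_key G t0 s0 q -> room G q ->
  good (insert_vertical G q).
Proof.
move=> gG qP rm; have [t0G s0G _ q1 _] := qP.
have [e1 hb hq [hs0 ht0] _] := on_keyP gG qP.
have [? ?] := good_nd gG t0G; have [? ? ? ?] := good_in gG t0G.
have rP t : t \in parts G ->
  [/\ raise G q t = set_yb q.2 t, yb t = yb (box G), q.1 <= xl t & q.2 < yt t] \/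
  [/\ raise G q t = t, yb (box G) < yb t \/ xl t < q.1
    & xr t <= q.1 \/ q.2 < yb t].
  move=> tG; have := rm t tG; rewrite /raise /touches_bottom.
  have [? ?] := good_nd gG tG; have [? ? ? ?] := good_in gG tG.
  case: ifPn => [/andP[/eqP et lt] h|nu h]; [left|right].
    by have [||? ? ?] := h; first lra; first lra.
  split=> //; first by lra.
  have [|lt] := leP (xr t) q.1; first by left.
  have [le|] := leP (yb t) q.2; last by right.
  by have [eb ? ?] := h lt le; move: nu; rewrite eb eqxx /=; lra.
have ndH : {in parts G, forall t, xl (raise G q t) < xr (raise G q t) /\
    yb (raise G q t) < yt (raise G q t)}.
  by move=> t tG; have [? ?] := good_nd gG tG; case: (rP t tG) => [[-> *]|[-> *]].
have apH : {in parts G &, forall s t, s != t -> apart (raise G q s) (raise G q t)}.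
  move=> s t sG tG /(good_sep gG sG tG); rewrite /apart => ?.
  have [? ?] := good_nd gG tG; have [? ?] := good_nd gG sG.
  by case: (rP s sG) => [[-> ? ? ?]|[-> _ _]];
     case: (rP t tG) => [[-> ? ? ?]|[-> _ _]] /=; lra.
have apN : {in parts G, forall t, apart (new_part G q) (raise G q t)}.
  move=> t tG; rewrite /apart /new_part /=.
  by case: (rP t tG) => [[-> ? ? ?]|[-> _ [?|?]]] /=; lra.
rewrite insert_verticalE; split.
- exact: good_box gG.
- move=> t; rewrite inE => /predU1P[->|/mapP[u uG ->]]; last exact: ndH.
  by rewrite /=; lra.
- move=> t; rewrite inE => /predU1P[->|/mapP[u uG ->]].
    by rewrite /=; split; lra.
  have [? ? ? ?] := good_in gG uG.
  by case: (rP u uG) => [[-> ? ? ?]|[-> _ _]] //=; split; lra.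
- rewrite /= uniq_map_apart ?(good_uniq gG) // andbT.
  apply/mapP => -[t tG e]; have := apN t tG; rewrite -e apart_irr //=; lra.
- move=> s t; rewrite !inE => /predU1P[->|/mapP[s' sG ->]].
    by case/predU1P => [->|/mapP[t' tG ->] _]; [rewrite eqxx | apply: apN].
  case/predU1P => [->|/mapP[t' tG ->]] ne.
    by have := apN s' sG; rewrite /apart; lra.
  by apply: apH => //; apply: contraNneq ne => ->.
- move=> x y xP yP; have [t tG tP] := good_cov gG xP yP.
  have [yq|yq] := ltP y q.2; last first.
    exists (raise G q t); first by rewrite inE map_f ?orbT.
    by case: (rP t tG) => [[-> ? ? ?]|[-> _ _]] //=; lra.
  have [xq|xq] := ltP x q.1.
    exists (raise G q t); first by rewrite inE map_f ?orbT.
    by case: (rP t tG) => [[-> ? ? ?]|[-> _ _]] //=; lra.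
  by exists (new_part G q); rewrite ?mem_head //=; lra.
move=> [x y]; rewrite /= count_map; set inr := in_rect _ _.
(* Away from the new part raising only shrinks parts. At a point of the new part, at most two others
   can meet it along its top side or along its left side. *)
have [vr|nvr] := boolP inr; last first.
  rewrite add0n; apply: leq_trans (good_gen gG (x, y)).
  rewrite -!size_filter; apply: uniq_leq_size; rewrite ?filter_uniq ?(good_uniq gG) //.
  move=> t; rewrite !mem_filter => /andP[/= vt tG]; rewrite tG andbT.
  by move: vt; rewrite /in_rect; case: (rP t tG) => [[-> ? ? ?]|[-> _ _]] //=; lra.
rewrite add1n ltnS; move: vr; rewrite /inr /in_rect /= => vr.
have [xq|xq] := ltP q.1 x.
  apply: (@count_le2 _ _
    (fun t => [&& yb t == yb (box G), xl t <= x & x < xr t])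
    (fun t => [&& yb t == yb (box G), xl t < x & x <= xr t])) (good_uniq gG) _ _ _.
  - move=> t tG; have [? ?] := good_nd gG tG.
    by rewrite /preim /=; case: (rP t tG) => [[-> ? ? ?]|[-> ? ?]] /= ?; lra.
  - move=> s t sG tG ? ?; have [? ?] := good_nd gG tG; have [? ?] := good_nd gG sG.
    by case: (sep_or gG sG tG); rewrite // /apart => ?; exfalso; lra.
  - move=> s t sG tG ? ?; have [? ?] := good_nd gG tG; have [? ?] := good_nd gG sG.
    by case: (sep_or gG sG tG); rewrite // /apart => ?; exfalso; lra.
have [yq|yq] := ltP y q.2.
  apply: (@count_le2 _ _
    (fun t => [&& xr t == q.1, yb t <= y & y < yt t])
    (fun t => [&& xr t == q.1, yb t < y & y <= yt t])) (good_uniq gG) _ _ _.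
  - move=> t tG; have [? ?] := good_nd gG tG.
    by rewrite /preim /=; case: (rP t tG) => [[-> ? ? ?]|[-> ? ?]] /= ?; lra.
  - move=> s t sG tG ? ?; have [? ?] := good_nd gG tG; have [? ?] := good_nd gG sG.
    by case: (sep_or gG sG tG); rewrite // /apart => ?; exfalso; lra.
  - move=> s t sG tG ? ?; have [? ?] := good_nd gG tG; have [? ?] := good_nd gG sG.
    by case: (sep_or gG sG tG); rewrite // /apart => ?; exfalso; lra.
(* At the corner [q] there remain only [t0], raised onto it, and [s0], running alongside. *)
apply: (@count_le2 _ _
    (fun t => [&& yb t == yb (box G), xl t == q.1 & true])
    (fun t => t == s0)) (good_uniq gG) _ _ _.
- move=> t tG; have [? ?] := good_nd gG tG; have [? ? ? ?] := good_in gG tG.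
  rewrite /preim /=; case: (rP t tG) => [[-> ? ? ?]|[-> ? ?]] /= ?; first by lra.
  case: (sep_or gG tG s0G) => [->|]; first by rewrite eqxx orbT.
  rewrite /apart => ?; have [? ?] := good_nd gG s0G.
  have [_ _ _ _ k] := on_keyP gG qP; by case: k => [[? _]|[? ?]]; exfalso; lra.
- move=> s t sG tG /and3P[/eqP es /eqP xs _] /and3P[/eqP et /eqP xt _].
  by apply: bottom_eq gG sG tG es et _; rewrite xs xt.
- by move=> s t _ _ /eqP-> /eqP->.
Qed.

End Room.

Section Stretch.
Variable F : realFieldType.
Implicit Types (G H : predrawing F) (r s t u : rect F) (q : F * F).

(* [phi] jumps from [B] to [y0] just above [B], which makes room below [y0];
   [psi] is its generalized inverse. *)
Lemma stretch (B y0 Y : F) : B < y0 < Y ->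
  exists phi psi : F -> F,
   [/\ {mono phi : h k / h < k}, forall h y, (phi h <= y) = (h <= psi y),
     forall h, h <= B \/ Y <= h -> phi h = h & forall h, B < h -> y0 < phi h].
Proof.
(* [lin] maps the interval from [B] to [Y] affinely onto the one from [y0] to [Y]; [phi] applies it
   strictly between [B] and [Y] only, whence the jump at [B]. *)
move=> BY; pose c := (Y - y0) / (Y - B).
have c0 : 0 < c by apply: divr_gt0; lra.
have cY : c * (Y - B) = Y - y0 by apply: divfK; rewrite gt_eqF //; lra.
pose lin h := Y - c * (Y - h).
pose ilin y := Y - c^-1 * (Y - y).
have lin_lt h k : (lin h < lin k) = (h < k).
  by rewrite /lin ltrD2l ltrN2 ltr_pM2l // ltrD2l ltrN2.
have linK h y : (lin h <= y) = (h <= ilin y).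
  rewrite -[LHS]negbK -ltNge -[RHS]negbK -ltNge; congr (~~ _).
  rewrite -(lin_lt (ilin y)); congr (_ < _).
  by rewrite /lin /ilin !subKr mulVKf ?gt_eqF // subKr.
have linB : lin B = y0 by rewrite /lin cY; lra.
have linY : lin Y = Y by rewrite /lin subrr mulr0 subr0.
pose phi h := if h <= B then h else if h < Y then lin h else h.
pose psi y := if y <= B then y else if y <= y0 then B else if y < Y then ilin y else y.
have phi_lt h k : h < k -> phi h < phi k.
  move=> hk; rewrite /phi; have [hB|Bh] := leP h B; have [kB|Bk] := leP k B => //.
  - have [kY|Yk] := ltP k Y; last exact: hk.
    have : y0 < lin k by rewrite -linB lin_lt.
    by lra.
  - by have := lt_trans Bh hk; rewrite ltNge kB.
  - have [hY|Yh] := ltP h Y; have [kY|Yk] := ltP k Y; rewrite ?lin_lt //.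
      by apply: lt_le_trans Yk; rewrite -linY lin_lt.
    by have := lt_trans hk kY; rewrite ltNge Yh.
exists phi, psi; split.
- move=> h k; case: (ltgtP h k) => [/phi_lt-> //|/phi_lt lt|->]; last by rewrite ltxx.
  by apply/negbTE; rewrite -leNgt ltW.
- move=> h y; have [hB|Bh] := leP h B; last have [hY|Yh] := ltP h Y.
  + rewrite /phi hB /psi; case: (leP y B) => // yB; rewrite (le_trans hB (ltW yB)).
    case: (leP y y0) => // y0y; case: (ltP y Y) => yY; apply/esym; last by lra.
    by apply: le_trans hB _; rewrite -linK linB ltW.
  + have : y0 < lin h by rewrite -linB lin_lt.
    have : lin h < Y by rewrite -linY lin_lt.
    rewrite /phi (leNgt h B) Bh /= hY /psi => hY' y0h.
    case: (leP y B) => yB; first by apply/idP/idP => ?; lra.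
    case: (leP y y0) => y0y; first by apply/idP/idP => ?; lra.
    by case: (ltP y Y) => yY; [exact: linK | apply/idP/idP => ?; lra].
  + rewrite /phi (leNgt h B) Bh /= (ltNge h Y) Yh /= /psi.
    case: (leP y B) => // yB; case: (leP y y0) => y0y; first by apply/idP/idP => ?; lra.
    case: (ltP y Y) => // yY; rewrite leNgt (lt_le_trans yY Yh); apply/esym/negbTE.
    rewrite -ltNge; apply: lt_le_trans Yh; rewrite ltNge -linK linY.
    by rewrite -ltNge.
- move=> h hP; rewrite /phi; case: (leP h B) => // ?; case: (ltP h Y) => // ?.
  by exfalso; lra.
- move=> h hB; rewrite /phi; case: (leP h B) => [?|_]; first lra.
  by case: (ltP h Y) => [_|?]; [rewrite -linB lin_lt|lra].
Qed.

End Stretch.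

Section Redraw.
Variable F : realFieldType.
Implicit Types (G H : predrawing F) (r s t u : rect F) (q : F * F).

(** The parts strictly to the right of [q] are stretched vertically by [phi]. No seam arises: a part
    other than [t0] that starts on the vertical line through [q] or to its left, and reaches beyond
    it, lies above [t0], where [phi] is the identity, and [phi] fixes the bottom and the top of
    [t0]. This is why the stretch ends at [yt t0]. *)
Lemma redraw G t0 s0 q : good G -> on_key G t0 s0 q ->
  exists (G' : predrawing F) (f : rect F -> rect F),
    [/\ good G', labelled (parts G) id f G G', f t0 = t0 /\ f s0 = s0,
        on_key G' t0 s0 q & room G' q].
Proof.
move=> gG qP; have [t0G s0G kts q1 qy] := qP.
have [e1 hb hq [hs0 ht0] k] := on_keyP gG qP.
have [? ?] := good_nd gG t0G; have [? ? ? ?] := good_in gG t0G.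
have [|phi [psi [phi_lt phiK phi_id phi_gt]]] := @stretch F (yb (box G)) q.2 (yt t0).
  by lra.
have phi_le h h' : (phi h <= phi h') = (h <= h').
  by rewrite !leNgt phi_lt.
have phi_eq h h' : (phi h == phi h') = (h == h').
  by rewrite !eq_le !phi_le.
pose f t := if q.1 < xl t then Rect (xl t) (xr t) (phi (yb t)) (phi (yt t)) else t.
have fx t : (xl (f t) = xl t) * (xr (f t) = xr t) by rewrite /f; case: ifP.
have f_id t : xl t <= q.1 -> f t = t by rewrite /f ltNge => ->.
have f0 : f t0 = t0 /\ f s0 = s0.
  have [? ?] := good_nd gG s0G.
  rewrite !f_id //; first by case: k => [[? _]|[-> ?]]; lra.
  by lra.
clear k; have pB : phi (yb (box G)) = yb (box G) by apply: phi_id; left.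
have pT : phi (yt (box G)) = yt (box G) by apply: phi_id; right.
have f_phi t : t \in parts G -> q.1 < xr t ->
    (yb (f t) = phi (yb t)) * (yt (f t) = phi (yt t)) * (xl t < q.1 -> yt t0 <= yb t).
  move=> tG lt; have [? ?] := good_nd gG tG; have [? ? ? ?] := good_in gG tG.
  rewrite /f; case: ltP => [?|le]; first by split=> // ?; lra.
  case: (sep_or gG tG t0G) => [e|]; last first.
    rewrite /apart => ?; have le' : yt t0 <= yb t by lra.
    by rewrite !phi_id; [split|right; lra|right; lra].
  by rewrite e; rewrite !phi_id; [split=> // ?; lra|right; lra|left; lra].
(* Two parts that can be adjacent are either both kept or both transformed by the strictly
   increasing [phi], which settles every relation between them. *)
have fcase s t : s \in parts G -> t \in parts G ->
    (xl s < xr t) && (xl t < xr s) || (xr s == xl t) ->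
    (f s = s /\ f t = t) \/ [/\ yb (f s) = phi (yb s), yt (f s) = phi (yt s),
      yb (f t) = phi (yb t) & yt (f t) = phi (yt t)].
  move=> sG tG ov; have [? ?] := good_nd gG tG; have [? ?] := good_nd gG sG.
  have [a1|a1] := ltP q.1 (xl t).
    by right; rewrite !f_phi //; lra.
  have [a2|a2] := ltP q.1 (xl s); last by left; rewrite !f_id.
  by right; rewrite !f_phi //; lra.
have apf : {in parts G &, forall s t, s != t -> apart (f s) (f t)}.
  move=> s t sG tG /(good_sep gG sG tG).
  have [ov|nov] := boolP ((xl s < xr t) && (xl t < xr s)); last first.
    by move=> _; rewrite /apart !fx; lra.
  have := fcase s t sG tG; rewrite ov => /(_ isT)[[-> ->] //|[a b c d]].
  by rewrite /apart !fx a b c d !phi_le.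
have ndf : {in parts G, forall t, xl (f t) < xr (f t) /\ yb (f t) < yt (f t)}.
  move=> t tG; have [? ?] := good_nd gG tG; rewrite !fx; split=> //.
  have [a1|a1] := ltP q.1 (xl t); last by rewrite f_id.
  by rewrite !f_phi ?phi_lt //; lra.
clearbody f; exists (box G, map f (parts G)), f; split=> //.
- split=> /=.
  + exact: good_box gG.
  + by move=> _ /mapP[t tG ->]; apply: ndf.
  + move=> _ /mapP[t tG ->]; have [? ? ? ?] := good_in gG tG; rewrite !fx.
    have [? ?] := good_nd gG tG.
    have [a1|a1] := ltP q.1 (xl t); last by rewrite f_id.
    have xt : q.1 < xr t by lra.
    rewrite !(f_phi t tG xt); split=> //.
      by rewrite -pB phi_le.
    by rewrite -pT phi_le.
  + by apply: uniq_map_apart => //; apply: good_uniq.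
  + move=> _ _ /mapP[s sG ->] /mapP[t tG ->] ne; apply: apf => //.
    by apply: contraNneq ne => ->.
  + move=> x y xP yP; have [xq|xq] := ltP x q.1.
      have [t tG tP] := good_cov gG xP yP; exists (f t); first exact: map_f.
      by rewrite f_id //; lra.
    (* [phi] is not onto; [psi] brings [y] back to a height in [G], and [phiK] matches the half-open
       intervals. *)
    have [|t tG tP] := good_cov gG xP (y := psi y).
      rewrite -phiK pB ltNge -phiK pT -ltNge; lra.
    exists (f t); first exact: map_f.
    have xt : q.1 < xr t by lra.
    by rewrite !fx !(f_phi t tG xt) phiK (ltNge y) phiK -ltNge.
  + move=> [x y]; have [xq|xq] := ltP q.1 x.
      apply: leq_trans (good_gen gG (x, psi y)).
      rewrite count_map -!size_filter; apply: uniq_leq_size.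
        by rewrite filter_uniq ?(good_uniq gG).
      move=> t; rewrite !mem_filter => /andP[/= vt tG]; rewrite tG andbT.
      move: vt; rewrite /in_rect /= !fx => vt.
      have xt : q.1 < xr t by lra.
      move: vt; rewrite !(f_phi t tG xt) phiK => vt.
      have : psi y <= yt t by rewrite -phi_le (le_trans _ (proj2 (andP (proj2 (andP vt))))) // phiK.
      by lra.
    apply: leq_trans (good_gen gG (x, y)).
    rewrite count_map -!size_filter; apply: uniq_leq_size.
      by rewrite filter_uniq ?(good_uniq gG).
    move=> t; rewrite !mem_filter => /andP[/= vt tG]; rewrite tG andbT.
    by move: vt; rewrite /in_rect /= !fx => vt; rewrite -(f_id t) ?fx //; lra.
- split=> /=; rewrite ?map_id //.
  + move=> s t sG tG; rewrite !left_ofE !fx; case: eqVneq => //= e.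
    have := fcase s t sG tG; rewrite e eqxx orbT => /(_ isT)[[-> ->] //|[a b c d]].
    by rewrite a b c d !phi_lt.
  + move=> s t sG tG; rewrite !belowE !fx.
    have [ov|nov] := boolP ((xl s < xr t) && (xl t < xr s)); last first.
      by apply/idP/idP => ?; lra.
    have := fcase s t sG tG; rewrite ov => /(_ isT)[[-> ->] //|[a b c d]].
    by rewrite b c phi_eq.
- have [e0 e0'] := f0; split=> //=.
    by rewrite -[X in X \in _]e0 map_f.
  by rewrite -[X in X \in _]e0' map_f.
(* Since [phi] exceeds [q.2] above the bottom boundary, a new bottom at or below [q.2] can only be
   on that boundary. *)
- move=> _ /mapP[t tG ->]; rewrite !fx => lt; rewrite !f_phi // => le.
  have [? ?] := good_nd gG tG; have [? ? ? ?] := good_in gG tG.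
  have eb : yb t = yb (box G).
    have := phi_gt (yb t); lra.
  have hp := (f_phi t tG lt).2.
  rewrite /= eb phi_id; last by left.
  by split=> //; [rewrite leNgt; apply/negP => /hp; lra | apply: phi_gt; lra].
Qed.

End Redraw.

(** * Deletion *)

Section Corner.
Variable F : realFieldType.
Implicit Types (G H : predrawing F) (r s t u : rect F) (q : F * F).

Lemma reflect_rectK : involutive (@reflect_rect F).
Proof. by case=> a b c d; rewrite /reflect_rect /= !opprK. Qed.

Lemma reflect_predrawingK : involutive (@reflect_predrawing F).
Proof.
case=> b ps; rewrite /reflect_predrawing /= reflect_rectK -map_comp; congr pair.
by rewrite -[RHS]map_id; apply: eq_map => t; apply: reflect_rectK.
Qed.

Lemma good_reflect G : good G -> good (reflect_predrawing G).
Proof.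
move=> gG; apply: is_partition_good; apply/asboolP.
exact: (reflect_subproof (drawing_of gG)).
Qed.

Lemma mem_reflect G t :
  (reflect_rect t \in parts (reflect_predrawing G)) = (t \in parts G).
Proof. by rewrite mem_map //; apply: inv_inj reflect_rectK. Qed.

Lemma bottom_rightP G : good G ->
  [/\ bottom_right G \in parts G, xr (bottom_right G) = xr (box G)
    & yb (bottom_right G) = yb (box G)].
Proof.
move=> gG; have [? ?] := good_box gG.
set a := fun t : rect F => (xr t == xr (box G)) && (yb t == yb (box G)).
suff ha : has a (parts G).
  by have /andP[/eqP-> /eqP->] := nth_find (box G) ha; rewrite mem_nth -?has_find.
have [||t tG tP] := cov_nw gG (x := xr (box G)) (y := yb (box G)).
- lra.
- lra.
by have [? ? ? ?] := good_in gG tG; apply/hasP; exists t => //; rewrite /a; lra.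
Qed.

Lemma bottom_right_uniq G t : good G -> t \in parts G ->
  xr t = xr (box G) -> yb t = yb (box G) -> t = bottom_right G.
Proof.
move=> gG tG e1 e2; have [rG e3 e4] := bottom_rightP gG.
have [? ?] := good_nd gG tG; have [? ?] := good_nd gG rG.
by case: (sep_or gG tG rG) => //; rewrite /apart => ?; exfalso; lra.
Qed.

Lemma bottom_right_reflect G : good G ->
  bottom_right (reflect_predrawing G) = reflect_rect (bottom_right G).
Proof.
move=> gG; have [rG e1 e2] := bottom_rightP gG; apply/esym.
apply: bottom_right_uniq; rewrite ?mem_reflect //=; first exact: good_reflect.
  by rewrite e2.
by rewrite e1.
Qed.

(* The top-left vertex of the bottom-right part has type |-. *)
Definition vertical_corner G :=
  let r := bottom_right G in
  (exists2 t0, t0 \in parts G & below r t0 && (xl t0 == xl r)) /\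
  {in parts G, forall t, below r t -> xl r <= xl t} /\
  (xl r = xl (box G) \/
   exists2 s0, s0 \in parts G & (xr s0 == xl r) && (yb s0 < yt r < yt s0)).

Lemma vertical_corner_left G : good G -> (1 < size (parts G))%N ->
  xl (bottom_right G) = xl (box G) -> vertical_corner G.
Proof.
move=> gG gt1 er; have [rG e1 e2] := bottom_rightP gG.
have [? ?] := good_nd gG rG; have [? ? ? ?] := good_in gG rG.
have [t tG tr] : exists2 t, t \in parts G & t != bottom_right G.
  apply/hasP; rewrite -[has _ _]negbK -all_predC; apply: contraL gt1 => /allP al.
  rewrite -leqNgt; apply: (@uniq_leq_size _ _ [:: bottom_right G]).
    exact: good_uniq.
  by move=> t /al /=; rewrite negbK inE.
have lt : yt (bottom_right G) < yt (box G).
  have := good_sep gG tG rG tr; have [? ? ? ?] := good_in gG tG.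
  by have [? ?] := good_nd gG tG; rewrite /apart => ?; lra.
have [||t0 t0G t0P] := good_cov gG (x := xl (bottom_right G))
  (y := yt (bottom_right G)); [lra|lra|].
have [? ? ? ?] := good_in gG t0G.
split; last by split; [move=> u uG _; rewrite er; have [] := good_in gG uG|left].
exists t0 => //; rewrite belowE; have [? ?] := good_nd gG t0G.
case: (sep_or gG t0G rG) => [e|]; first by move: t0P; rewrite e; lra.
by rewrite /apart => ?; lra.
Qed.

(** [s0] runs along the left side of the corner part and past its top, so it blocks everything above
    from extending to the left. *)
Lemma vertical_corner_inner G s0 : good G -> s0 \in parts G ->
  xr s0 = xl (bottom_right G) ->
  yb s0 < yt (bottom_right G) < yt s0 -> vertical_corner G.
Proof.
move=> gG s0G es ys; have [rG e1 e2] := bottom_rightP gG.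
have [? ?] := good_nd gG rG; have [? ? ? ?] := good_in gG rG.
have [? ?] := good_nd gG s0G; have [? ? ? ?] := good_in gG s0G.
have [||t0 t0G t0P] := good_cov gG (x := xl (bottom_right G))
  (y := yt (bottom_right G)); [lra|lra|].
split; last split; last by right; exists s0; rewrite // es eqxx.
  exists t0 => //; rewrite belowE; have [? ?] := good_nd gG t0G.
  have ap0 : apart t0 s0.
    case: (sep_or gG t0G s0G) => // e; exfalso.
    by move: t0P; rewrite e; lra.
  case: (sep_or gG t0G rG) => [e|]; first by move: t0P; rewrite e; lra.
  by move: ap0; rewrite /apart => ? ?; lra.
move=> t tG; rewrite belowE => ?; have [? ?] := good_nd gG tG.
case: (sep_or gG tG s0G) => [e|]; first by subst t; lra.
by rewrite /apart => ?; lra.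
Qed.

(** On the left or top boundary [vertical_corner_left] decides. Otherwise let [a] be the part at the
    north-west germ of the top-left vertex of [r]. If [a] reaches below the vertex the type is |-;
    if it reaches to the right of it the type is T, which reflection turns into |-. Failing both,
    [a], [r] and the parts at the other two germs are four parts at one point, against
    genericity. *)
Lemma corner_cases G : good G -> (1 < size (parts G))%N ->
  vertical_corner G \/ vertical_corner (reflect_predrawing G).
Proof.
move=> gG gt1; have [rG e1 e2] := bottom_rightP gG.
have gR := good_reflect gG; have er := bottom_right_reflect gG.
set r := bottom_right G in rG e1 e2 er *.
have [? ?] := good_nd gG rG; have [? ? ? ?] := good_in gG rG.
have [xe|xne] := eqVneq (xl r) (xl (box G)).
  by left; apply: vertical_corner_left.
have [ye|yne] := eqVneq (yt r) (yt (box G)).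
  by right; apply: vertical_corner_left; rewrite ?size_map // er /= ye.
have {}xne : xl (box G) < xl r by rewrite lt_neqAle eq_sym xne; lra.
have {}yne : yt r < yt (box G) by rewrite lt_neqAle yne; lra.
have [||a aG aP] := cov_nw gG (x := xl r) (y := yt r); [lra|lra|].
have [? ?] := good_nd gG aG.
have ar : apart a r.
  case: (sep_or gG aG rG) => // e; exfalso.
  by move: aP; rewrite e; lra.
have [lt|ge] := ltP (yb a) (yt r).
  left; apply: (@vertical_corner_inner _ a) => //; last by lra.
  by move: ar; rewrite /apart -/r => ?; lra.
have [lt'|ge'] := ltP (xl r) (xr a).
  right; apply: (@vertical_corner_inner _ (reflect_rect a)) => //.
  - by rewrite mem_reflect.
  - by rewrite er /=; move: ar; rewrite /apart => ?; lra.
  - by rewrite er /=; lra.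
exfalso.
have [||b bG bP] := good_cov gG (x := xl r) (y := yt r); [lra|lra|].
have [||c cG cP] := cov_sw gG (x := xl r) (y := yt r); [lra|lra|].
have ne (u v : rect F) : (xl u < xr u /\ yb u < yt u -> u = v -> False) ->
    u \in parts G -> u != v.
  by move=> h uG; apply/eqP => e; exact: h (good_nd gG uG) e.
have br : apart b r.
  case: (sep_or gG bG rG) => // e; exfalso.
  by move: bP; rewrite e; lra.
have cr : apart c r.
  case: (sep_or gG cG rG) => // e; exfalso.
  by move: cP; rewrite e; lra.
apply: (@count_four _ (in_rect (xl r, yt r)) (parts G) a b c r (good_gen gG _)).
  rewrite /= !inE !negb_or !andbT; apply/and3P; split.
  - apply/and3P; split; apply: ne => // ? e; move: aP ge ge'; rewrite e; lra.
  - apply/andP; split; apply: ne => // ? e; move: bP cr; rewrite e /apart => ? ?.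
      by lra.
    by lra.
  - apply: ne => // ? e; move: cP; rewrite e; lra.
move=> u; rewrite !inE mem_filter /in_rect => /or4P[]/eqP-> /=.
- by rewrite aG andbT; lra.
- by rewrite bG andbT; lra.
- by rewrite cG andbT; lra.
- by rewrite rG andbT; lra.
Qed.

End Corner.

Section Deletion.
Variable F : realFieldType.
Implicit Types (G H : predrawing F) (r s t u : rect F) (q : F * F).

Lemma left_of_reflect s t : left_of (reflect_rect s) (reflect_rect t) = below t s.
Proof. by rewrite left_ofE belowE /= !ltrN2 eqr_opp eq_sym; apply/idP/idP => ?; lra. Qed.

Lemma below_reflect s t : below (reflect_rect s) (reflect_rect t) = left_of t s.
Proof. by rewrite left_ofE belowE /= !ltrN2 eqr_opp eq_sym; apply/idP/idP => ?; lra. Qed.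

Definition reflect_point q : F * F := (- q.2, - q.1).

Lemma goes_reflect G q :
  [/\ goes_up (reflect_predrawing G) (reflect_point q) = goes_left G q,
      goes_down (reflect_predrawing G) (reflect_point q) = goes_right G q,
      goes_right (reflect_predrawing G) (reflect_point q) = goes_down G q
    & goes_left (reflect_predrawing G) (reflect_point q) = goes_up G q].
Proof.
by split; rewrite /goes_up /goes_down /goes_right /goes_left has_map;
  apply: eq_has => t /=; rewrite !eqr_oppLR !opprK; apply/idP/idP => ?; lra.
Qed.

Lemma stem_reflect G q :
  (stem_right (reflect_predrawing G) (reflect_point q) = stem_down G q) *
  (stem_down (reflect_predrawing G) (reflect_point q) = stem_right G q).
Proof. by rewrite /stem_right /stem_down; have [-> -> -> ->] := goes_reflect G q. Qed.

(** Reflection turns |- into T and exchanges [left_of] with [below], hence swaps the two branches of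
    [delete]. Results on corners of type |- thus carry over to type T. *)
Lemma delete_reflect G : good G ->
  delete (reflect_predrawing G) = reflect_predrawing (delete G).
Proof.
move=> gG; rewrite /delete (bottom_right_reflect gG).
set r := bottom_right G.
have -> : (xl (reflect_rect r), yt (reflect_rect r)) = reflect_point (xl r, yt r).
  by [].
rewrite !stem_reflect.
have inj := inv_inj (@reflect_rectK F).
have sE : [seq t <- parts (reflect_predrawing G) | t != reflect_rect r] =
    map (@reflect_rect F) [seq t <- parts G | t != r].
  by rewrite filter_map; congr map; apply: eq_filter => t /=; rewrite (inj_eq inj).
have [sr|nsr] := boolP (stem_right G _).
  have /negbTE-> : ~~ stem_down G (xl r, yt r).
    by move: sr; rewrite /stem_right /stem_down => /and4P[-> _ _ _]; rewrite !andbF.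
  rewrite /reflect_predrawing sE /= -!map_comp; congr pair; apply: eq_map => t /=.
  by rewrite left_of_reflect; case: ifP.
have [sd|nsd] := boolP (stem_down G _) => //.
rewrite /reflect_predrawing sE /= -!map_comp; congr pair; apply: eq_map => t /=.
by rewrite below_reflect; case: ifP.
Qed.

Definition lower G t :=
  if below (bottom_right G) t then set_yb (yb (bottom_right G)) t else t.

Section Vertical.
Variable H : predrawing F.
Hypotheses (gH : good H) (vH : vertical_corner H).

Let r := bottom_right H.
Let q := (xl r, yt r).
Let ps := [seq t <- parts H | t != r].

Lemma stem_right_corner : stem_right H q.
Proof.
have [[t0 t0H t0P] [_ left]] := vH; rewrite -/r in t0P left.
have [rH e1 e2] := bottom_rightP gH; rewrite -/r in rH e1 e2.
have [? ?] := good_nd gH rH; have [? ? ? ?] := good_in gH rH.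
have [? ?] := good_nd gH t0H; move: t0P; rewrite belowE => ?.
rewrite /q; apply/and4P; split.
- by apply/hasP; exists t0; rewrite //=; lra.
- by apply/hasP; exists r; rewrite //=; lra.
- by apply/hasP; exists r; rewrite //=; lra.
apply/hasPn => t tH /=; apply/negP => tP.
have [? ?] := good_nd gH tH; have [? ? ? ?] := good_in gH tH.
case: left => [?|[s0 s0H ?]]; first by lra.
have [? ?] := good_nd gH s0H.
case: (sep_or gH tH s0H) => [e|]; first by subst t; lra.
by rewrite /apart => ?; lra.
Qed.

Lemma delete_vertical : delete H = (box H, map (lower H) ps).
Proof. by rewrite /delete stem_right_corner. Qed.

Let psP t : (t \in ps) = (t \in parts H) && (t != r).
Proof. by rewrite mem_filter andbC. Qed.

Lemma lowerP t : t \in ps ->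
  [/\ lower H t = set_yb (yb (box H)) t, yb t = yt r, xl r <= xl t & below r t] \/
  [/\ lower H t = t, xr t <= xl r \/ yt r < yb t & below r t = false].
Proof.
rewrite psP => /andP[tH ne]; have [_ [ge _]] := vH; rewrite -/r in ge.
have [rH e1 e2] := bottom_rightP gH; rewrite -/r in rH e1 e2.
rewrite /lower -/r; case: ifPn => [tr|ntr]; [left|right].
  by rewrite e2; split; rewrite ?ge //; move: tr; rewrite belowE => ?; lra.
split=> //; have := good_sep gH tH rH ne; move: ntr; rewrite belowE /apart => ?.
have [? ?] := good_nd gH tH; have [? ? ? ?] := good_in gH tH.
have [? ?] := good_nd gH rH; move=> ?.
have [|lt] := leP (xr t) (xl r); [by left|right]; lra.
Qed.

Let eps : perm_eq (parts H) (r :: ps).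
Proof.
have [rH _ _] := bottom_rightP gH.
by rewrite /ps -(rem_filter _ (good_uniq gH)); apply: perm_to_rem.
Qed.

Lemma good_delete : good (delete H).
Proof.
rewrite delete_vertical.
have [[t0 t0H t0P] _] := vH; rewrite -/r in t0P.
have [rH e1 e2] := bottom_rightP gH; rewrite -/r in rH e1 e2.
have [rx ry] := good_nd gH rH; have [? ? ? ?] := good_in gH rH.
have [? ?] := good_nd gH t0H; have [? ? ? ?] := good_in gH t0H.
have {}t0P : yb t0 = yt r /\ xl t0 = xl r by move: t0P; rewrite belowE => ?; lra.
have psH t : t \in ps -> t \in parts H by rewrite psP => /andP[].
have nd t : t \in ps -> xl (lower H t) < xr (lower H t) /\
    yb (lower H t) < yt (lower H t).
  move=> tps; have tH := psH t tps; have [? ?] := good_nd gH tH.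
  by case: (lowerP tps) => [[-> *]|[-> *]] //=; lra.
have ap : {in ps &, forall s t, s != t -> apart (lower H s) (lower H t)}.
  move=> s t sps tps /(good_sep gH (psH s sps) (psH t tps)).
  have [? ?] := good_nd gH (psH s sps); have [? ?] := good_nd gH (psH t tps).
  have [? ? ? ?] := good_in gH (psH s sps); have [? ? ? ?] := good_in gH (psH t tps).
  rewrite /apart; case: (lowerP sps) => [[-> ? ? _]|[-> ? _]];
  by case: (lowerP tps) => [[-> ? ? _]|[-> ? _]] /= ?; lra.
split=> /=.
- exact: good_box gH.
- by move=> _ /mapP[t tps ->]; apply: nd.
- move=> _ /mapP[t tps ->]; have [? ? ? ?] := good_in gH (psH t tps).
  by case: (lowerP tps) => [[-> ? ? _]|[-> _ _]] //=; split; lra.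
- by rewrite uniq_map_apart ?filter_uniq ?(good_uniq gH).
- move=> _ _ /mapP[s sps ->] /mapP[t tps ->] ne; apply: ap => //.
  by apply: contraNneq ne => ->.
- move=> x y xP yP; have [t tH tP] := good_cov gH xP yP.
  have [et|ne] := eqVneq t r; last first.
    have tps : t \in ps by rewrite psP tH.
    exists (lower H t); first exact: map_f.
    by case: (lowerP tps) => [[-> ? ? _]|[-> _ _]] //=; lra.
  (* A point of the deleted part is taken over by the part that lies above it at the level of the
     top of [r]. *)
  subst t; have [|u uH uP] := good_cov gH xP (y := yt r); first lra.
  have ner : u != r by apply/eqP => e; move: uP; rewrite e; lra.
  have ups : u \in ps by rewrite psP uH.
  exists (lower H u); first exact: map_f.
  by case: (lowerP ups) => [[-> ? ? _]|[_ [?|?] _]] /=; lra.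
move=> [x y]; rewrite count_map.
have [c1|] := boolP [|| y < yb r, yt r <= y | x < xl r].
  apply: leq_trans (good_gen gH (x, y)); rewrite -!size_filter.
  apply: uniq_leq_size; rewrite ?filter_uniq ?(good_uniq gH) //.
  move=> t; rewrite !mem_filter => /and3P[/= vt ne tH].
  have tps : t \in ps by rewrite psP tH.
  rewrite tH andbT; move: vt; rewrite /in_rect.
  have [? ? ? ?] := good_in gH tH.
  by case: (lowerP tps) => [[-> ? ? _]|[-> _ _]] //=; lra.
(* Right of the left side of [r], every part now at the point met the line of the top of [r] at the
   same abscissa before. On the left side itself there are only [t0] and at most two parts abutting
   from the left. *)
have [c2 nc1|nc2 nc1] := ltP (xl r) x.
  apply: leq_trans (good_gen gH (x, yt r)); rewrite -!size_filter.
  apply: uniq_leq_size; rewrite ?filter_uniq ?(good_uniq gH) //.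
  move=> t; rewrite !mem_filter => /and3P[/= vt ne tH].
  have tps : t \in ps by rewrite psP tH.
  rewrite tH andbT; move: vt; rewrite /in_rect.
  have [? ?] := good_nd gH tH.
  by case: (lowerP tps) => [[-> ? ? _]|[-> [?|?] _]] /=; lra.
apply: leq_trans (_ : count (pred1 t0) ps +
    count (fun t => (xr t == xl r) && (yb t <= y <= yt t)%R) ps <= 3)%N.
  rewrite -count_predUI; apply: leq_trans (leq_addr _ _).
  rewrite -!size_filter; apply: uniq_leq_size.
    by rewrite !filter_uniq ?(good_uniq gH).
  move=> t; rewrite !mem_filter => /and3P[/= vt ne tH].
  rewrite ne tH !andbT; have [//|nt0] := eqVneq t t0.
  have := good_sep gH tH t0H nt0; rewrite /apart.
  have tps : t \in ps by rewrite psP tH.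
  have [? ?] := good_nd gH tH; move: vt; rewrite /in_rect.
  by case: (lowerP tps) => [[-> ? ? _]|[-> ? _]] /= ? ?; lra.
apply: (@leq_add _ _ 1 2).
  by rewrite count_uniq_mem ?leq_b1 // filter_uniq // (good_uniq gH).
apply: (@count_le2 _ _
  (fun t => [&& xr t == xl r, yb t <= y & y < yt t])
  (fun t => [&& xr t == xl r, yb t < y & y <= yt t])).
- by rewrite filter_uniq // (good_uniq gH).
- by move=> t tps; have [? ?] := good_nd gH (psH t tps); lra.
- move=> s t /psH sH /psH tH ? ?.
  have [? ?] := good_nd gH sH; have [? ?] := good_nd gH tH.
  by case: (sep_or gH sH tH); rewrite // /apart => ?; exfalso; lra.
- move=> s t /psH sH /psH tH ? ?.
  have [? ?] := good_nd gH sH; have [? ?] := good_nd gH tH.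
  by case: (sep_or gH sH tH); rewrite // /apart => ?; exfalso; lra.
Qed.

(** The former top-left corner [q] of [r] is interior to an edge on the left side of the lowered
    [t0], so the deletion can be undone by inserting there. *)
Lemma delete_key : exists t0 s0, on_key (delete H) t0 s0 q.
Proof.
rewrite delete_vertical.
have [[t0 t0H /andP[rt0 /eqP xt0]] [_ left]] := vH; rewrite -/r in rt0 xt0 left.
have [rH e1 e2] := bottom_rightP gH; rewrite -/r in rH e1 e2.
have [rx ry] := good_nd gH rH; have [? ? ? ?] := good_in gH rH.
have [? ?] := good_nd gH t0H; have [? ? ? ?] := good_in gH t0H.
have yt0 : yb t0 = yt r by move: rt0; rewrite belowE => ?; lra.
have t0ps : t0 \in ps.
  by rewrite psP t0H /=; apply/eqP => e; move: yt0; rewrite e; lra.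
have lt0 : lower H t0 = set_yb (yb (box H)) t0 by rewrite /lower -/r rt0 e2.
have [s0 [s0G ks0 ys0]] : exists s0, [/\ s0 \in map (lower H) ps,
    is_key (box H, map (lower H) ps) (lower H t0) s0
    & yb s0 < q.2 < Num.min (yt s0) (yt (lower H t0))].
  case: left => [xe|[s0 s0H /andP[/eqP xs0 ys0]]].
    exists (lower H t0); rewrite map_f // /is_key lt0 /= !eqxx xt0 xe eqxx orbT.
    by split=> //; rewrite lt_min; lra.
  have [? ?] := good_nd gH s0H; have [? ? ? ?] := good_in gH s0H.
  have s0ps : s0 \in ps.
    by rewrite psP s0H /=; apply/eqP => e; move: ys0; rewrite e; lra.
  have ls0 : lower H s0 = s0.
    by case: (lowerP s0ps) => [[_ ? ? _]|[]] //; exfalso; lra.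
  exists s0; split; first by rewrite -ls0 map_f.
    by rewrite /is_key lt0 /= eqxx left_ofE /=; lra.
  by rewrite lt0 /= lt_min; lra.
by exists (lower H t0), s0; split=> //; rewrite ?map_f ?lt0.
Qed.

Lemma new_part_delete : new_part (delete H) q = r.
Proof.
have [_ e1 e2] := bottom_rightP gH; rewrite delete_vertical /new_part /q /=.
by rewrite -e1 -e2 -/r; case: (r).
Qed.

Lemma lowerK t : t \in ps -> raise (delete H) q (lower H t) = t.
Proof.
move=> tps; rewrite delete_vertical; have [tH ner] := andP (etrans (esym (psP t)) tps).
have [rH e1 e2] := bottom_rightP gH; rewrite -/r in rH e1 e2.
have [rx ry] := good_nd gH rH; have [? ? ? ?] := good_in gH rH.
have [? ?] := good_nd gH tH; have [? ? ? ?] := good_in gH tH.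
rewrite /raise /touches_bottom; case: (lowerP tps) => [[-> yt' xt' _]|[-> tP _]] /=.
  by rewrite eqxx xt' /=; rewrite -yt'; case: (t).
case: ifP => //; rewrite /q /= => tb; have := good_sep gH tH rH ner.
by rewrite /apart => ?; exfalso; lra.
Qed.

(** Only up to order, since an insertion puts the new part at the head of the list. *)
Lemma insert_delete : perm_eq (parts H) (parts (insert_vertical (delete H) q)).
Proof.
apply: (perm_trans eps); rewrite insert_verticalE /= new_part_delete perm_cons.
have {1}-> : ps = map id ps by rewrite map_id.
suff -> : map id ps = map (raise (delete H) q) (parts (delete H)) by [].
rewrite delete_vertical /= -map_comp; apply/eq_in_map => t tps /=.
by rewrite -delete_vertical lowerK.
Qed.

End Vertical.
End Deletion.

(** * Insertion and deletion act on adjacencies *)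

Section Invariance.
Variable F : realFieldType.
Implicit Types (G H : predrawing F) (r s t u : rect F) (q : F * F).

Lemma good_perm G H : good G -> box G = box H -> perm_eq (parts G) (parts H) ->
  good H.
Proof.
move=> gG eb pG; have m := perm_mem pG; split.
- by rewrite -eb; apply: good_box gG.
- by move=> t; rewrite -m; apply: good_nd.
- by move=> t; rewrite -m -eb; apply: good_in.
- by rewrite -(perm_uniq pG); apply: good_uniq gG.
- by move=> s t; rewrite -!m; apply: good_sep.
- by move=> x y; rewrite -eb => /(good_cov gG) h /h[t]; rewrite m; exists t.
- by move=> v; rewrite -(permP pG); apply: good_gen.
Qed.

Lemma class_perm (G H : drawing F) : perm_eq (parts G) (parts H) ->
  class_of G = class_of H.
Proof.
move=> pG; apply: (@labelled_class _ _ (parts G) id id); split; rewrite ?map_id //.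
Qed.

Lemma labelled_reflect (I : eqType) (ls : seq I) a b G H : labelled ls a b G H ->
  labelled ls (fun i => reflect_rect (a i)) (fun i => reflect_rect (b i))
    (reflect_predrawing G) (reflect_predrawing H).
Proof.
case=> pa pb lP bP; split.
- by rewrite (map_comp (@reflect_rect F) a); apply: perm_map.
- by rewrite (map_comp (@reflect_rect F) b); apply: perm_map.
- by move=> i j ils jls; rewrite !left_of_reflect bP.
- by move=> i j ils jls; rewrite !below_reflect lP.
Qed.

Section Insert.
Variables (I : eqType) (ls : seq I) (a b : I -> rect F) (G H : predrawing F).
Hypotheses (gG : good G) (gH : good H) (ab : labelled ls a b G H).
Variables (i0 j0 : I) (q q' : F * F).
Hypotheses (i0ls : i0 \in ls) (j0ls : j0 \in ls).
Hypothesis qG : on_key G (a i0) (a j0) q.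
Hypothesis qH : on_key H (b i0) (b j0) q'.

Let aG i : i \in ls -> a i \in parts G.
Proof. by move=> /(lab_mem ab)/andP[]. Qed.
Let bH i : i \in ls -> b i \in parts H.
Proof. by move=> /(lab_mem ab)/andP[]. Qed.
Let a_inj : {in ls &, injective a}.
Proof. by apply: uniq_map_inj; rewrite (perm_uniq (lab_l ab)) (good_uniq gG). Qed.
Let b_inj : {in ls &, injective b}.
Proof. by apply: uniq_map_inj; rewrite (perm_uniq (lab_r ab)) (good_uniq gH). Qed.

Lemma key_left_lt i : i \in ls -> left_of (a i) (a i0) ->
  ((yb (b i) < yb (b j0)) = (yb (a i) < yb (a j0))) *
  ((yb (b i) <= yb (b j0)) = (yb (a i) <= yb (a j0))).
Proof.
move=> ils li; have [_ _ _ _ k] := on_keyP gG qG.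
case: k => [[_ lj]|[_ xe]].
  by rewrite (leNgt (yb (b i))) (leNgt (yb (a i))) !(lab_left_lt gG gH ab i0ls).
have [? ? ? ?] := good_in gG (aG ils); have [? ?] := good_nd gG (aG ils).
by exfalso; move: li; rewrite left_ofE => ?; lra.
Qed.

(** [None] labels the new part. Each adjacency of the result was computed from the old adjacencies,
    contact with the bottom boundary and the two orders relative to the key, and all of these agree
    in [G] and [H]. *)
Lemma insert_labelled :
  good (insert_vertical G q) -> good (insert_vertical H q') ->
  labelled (None :: map Some ls)
    (oapp (fun i => raise G q (a i)) (new_part G q))
    (oapp (fun i => raise H q' (b i)) (new_part H q'))
    (insert_vertical G q) (insert_vertical H q').
Proof.
move=> gG' gH'.
have ea : {in ls, forall i, (a i == a i0) = (b i == b i0)}.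
  by move=> i ils; apply/eqP/eqP => [/a_inj->|/b_inj->].
split.
- rewrite insert_verticalE /= perm_cons -map_comp /comp /=.
  by rewrite (map_comp (raise G q) a); apply/perm_map/(lab_l ab).
- rewrite insert_verticalE /= perm_cons -map_comp /comp /=.
  by rewrite (map_comp (raise H q') b); apply/perm_map/(lab_r ab).
- move=> [i|] [j|]; rewrite !inE /= ?(mem_map Some_inj) // => ils jls.
  + rewrite (left_of_raise gH gH' qH) ?bH // (left_of_raise gG gG' qG) ?aG //.
    rewrite (lab_left ab) //; have [l|] := boolP (left_of _ _) => //=.
    rewrite -ea //; have [e|] := eqVneq => //=.
    by rewrite key_left_lt // -e.
  + rewrite (left_of_new gH gH' qH) ?bH // (left_of_new gG gG' qG) ?aG //.
    rewrite (lab_left ab) //; have [l|] := boolP (left_of _ _) => //=.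
    by rewrite key_left_lt.
  + by rewrite (new_left_of gH gH' qH) ?bH // (new_left_of gG gG' qG) ?aG.
  + by rewrite (new_irreflexive gH qH) (new_irreflexive gG qG).
- have [e1 _ _ _ _] := on_keyP gG qG.
  move=> [i|] [j|]; rewrite !inE /= ?(mem_map Some_inj) // => ils jls.
  + rewrite (below_raise gH gH' qH) ?bH // (below_raise gG gG' qG) ?aG //.
    exact: (lab_below ab).
  + by rewrite (below_new_false gH gH' qH) ?bH // (below_new_false gG gG' qG) ?aG.
  + rewrite (below_new gH gH' qH) ?bH // (below_new gG gG' qG) ?aG //.
    rewrite (lab_bottom gG gH ab) //; case: eqP => //= e.
    by rewrite !leNgt (lab_bottom_lt gG gH ab).
  + by rewrite (new_irreflexive gH qH) (new_irreflexive gG qG).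
Qed.

End Insert.

Section Delete.
Variables (I : eqType) (ls : seq I) (a b : I -> rect F) (G H : predrawing F).
Hypotheses (gG : good G) (gH : good H) (ab : labelled ls a b G H).

Let aG i : i \in ls -> a i \in parts G.
Proof. by move=> /(lab_mem ab)/andP[]. Qed.
Let bH i : i \in ls -> b i \in parts H.
Proof. by move=> /(lab_mem ab)/andP[]. Qed.

Lemma lab_bottom_right i : i \in ls ->
  (b i == bottom_right H) = (a i == bottom_right G).
Proof.
move=> ils; have [_ r1 r2] := bottom_rightP gG; have [_ r3 r4] := bottom_rightP gH.
apply/eqP/eqP => e; apply: bottom_right_uniq; rewrite ?aG ?bH //; apply/eqP.
- by rewrite -(lab_rightmost gG gH ab) // e r3.
- by rewrite -(lab_bottom gG gH ab) // e r4.
- by rewrite (lab_rightmost gG gH ab) // e r1.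
- by rewrite (lab_bottom gG gH ab) // e r2.
Qed.

Lemma lab_bottom_right_ex : exists i,
  [/\ i \in ls, a i = bottom_right G & b i = bottom_right H].
Proof.
have [rG _ _] := bottom_rightP gG; have [i ils e] := lab_ex ab rG.
by exists i; split=> //; apply/eqP; rewrite lab_bottom_right // e.
Qed.

(** [vertical_corner] in terms of adjacencies alone: a left neighbour of the corner part that also
    touches a part above it must pass its top. The second case is that of the left boundary. *)
Definition left_corner G :=
  (exists s t, [/\ s \in parts G, t \in parts G, left_of s (bottom_right G),
      below (bottom_right G) t & left_of s t]) \/
  {in parts G, forall s, left_of s (bottom_right G) = false}.

Lemma left_corner_lab : left_corner G -> left_corner H.
Proof.
have [k [kls ak bk]] := lab_bottom_right_ex.
case=> [[s [t [sG tG]]]|none]; last first.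
  right=> s sH; have [i ils <-] := lab_ex (lab_sym ab) sH.
  by rewrite -bk (lab_left ab) // ak none // aG.
have [i ils <-] := lab_ex ab sG; have [j jls <-] := lab_ex ab tG => h1 h2 h3.
left; exists (b i), (b j).
by rewrite !bH // -bk !(lab_left ab) ?(lab_below ab) // ak; split.
Qed.

End Delete.

(** The bound on the size matters: a single part satisfies [left_corner], but nothing lies above
    it. *)
Lemma vertical_cornerP G : good G -> (1 < size (parts G))%N ->
  vertical_corner G <-> left_corner G.
Proof.
move=> gG gt1; have [rG e1 e2] := bottom_rightP gG.
have [? ?] := good_nd gG rG; have [? ? ? ?] := good_in gG rG.
split=> [[[t0 t0G /andP[bt0 /eqP xt0]] [_ [xe|[s0 s0G s0P]]]]|].
- right=> s sG; apply/negP; rewrite left_ofE => ?.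
  by have [? ? ? ?] := good_in gG sG; have [? ?] := good_nd gG sG; lra.
- left; exists s0, t0; split=> //; move: bt0; rewrite belowE ?left_ofE;
    have [? ?] := good_nd gG s0G; have [? ? ? ?] := good_in gG s0G;
    have [? ?] := good_nd gG t0G => ?; lra.
case=> [[s [t [sG tG sr rt st]]]|none].
  have [? ?] := good_nd gG tG; move: sr rt st; rewrite !left_ofE belowE => ? ? ?.
  by apply: (vertical_corner_inner gG sG); lra.
apply: vertical_corner_left => //; apply/eqP; rewrite eq_le andbC.
apply/andP; split; first by lra.
rewrite leNgt; apply/negP => /(left_nbr gG rG)[u uG].
by rewrite none.
Qed.

Lemma vertical_corner_lab (I : eqType) (ls : seq I) a b G H :
  good G -> good H -> labelled ls a b G H -> (1 < size (parts G))%N ->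
  vertical_corner G -> vertical_corner H.
Proof.
move=> gG gH ab gt1 /(vertical_cornerP gG gt1)/(left_corner_lab gG gH ab).
apply: (vertical_cornerP gH _).2.
by rewrite -(perm_size (lab_r ab)) size_map -(size_map a) (perm_size (lab_l ab)).
Qed.

Section DeleteVertical.
Variables (I : eqType) (ls : seq I) (a b : I -> rect F) (G H : predrawing F).
Hypotheses (gG : good G) (gH : good H) (ab : labelled ls a b G H).
Hypotheses (vG : vertical_corner G) (vH : vertical_corner H).

(** Inserting the corner part back into [delete K] restores [K], so [left_of_delete] expresses the
    adjacencies after the deletion by those of [K]. *)
Lemma delete_left_of (K : predrawing F) (c : I -> rect F) :
  good K -> vertical_corner K -> perm_eq (map c ls) (parts K) ->
  {in ls &, forall i j, c i != bottom_right K -> c j != bottom_right K ->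
    left_of (lower K (c i)) (lower K (c j)) = left_of (c i) (c j) ||
     [&& left_of (c i) (bottom_right K), below (bottom_right K) (c j)
       & has (fun k => left_of (c k) (bottom_right K) && left_of (c k) (c j)) ls]}.
Proof.
move=> gK vK pc i j ils jls ni nj.
have cK k : k \in ls -> c k \in parts K.
  by move=> kls; rewrite -(perm_mem pc) map_f.
have gD := good_delete gK vK; have [t0 [s0 qP]] := delete_key gK vK.
have gI := good_perm gK _ (insert_delete gK vK).
have {gI}gI : good (insert_vertical (delete K) (xl (bottom_right K), yt (bottom_right K))).
  by apply: gI; rewrite (delete_vertical gK vK).
have inps k : k \in ls -> c k != bottom_right K ->
    c k \in [seq t <- parts K | t != bottom_right K].
  by move=> kls nk; rewrite mem_filter nk cK.
have inD k : k \in ls -> c k != bottom_right K -> lower K (c k) \in parts (delete K).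
  by move=> kls nk; rewrite (delete_vertical gK vK) map_f // inps.
rewrite (left_of_delete gD gI qP) ?inD // (new_part_delete gK vK).
rewrite !(lowerK gK vK) ?inps //; congr (_ || [&& _, _ & _]).
rewrite [in parts _](delete_vertical gK vK) /= has_map; apply/hasP/hasP => [[t]|[k kls]].
  move=> tps; have := tps; rewrite mem_filter -(perm_mem pc) => /andP[_ /mapP[k kls e]].
  by rewrite /= (lowerK gK vK) // e; exists k.
(* The witness is not the corner part, which is not to the left of itself. *)
move=> /andP[h1 h2]; have kps : c k \in [seq t <- parts K | t != bottom_right K].
  apply: inps => //; apply: contraTneq h1 => ->; rewrite left_ofE; apply/negP => ?.
  by have [rK _ _] := bottom_rightP gK; have [? ?] := good_nd gK rK; lra.
by exists (c k) => //; rewrite /= (lowerK gK vK) // h1.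
Qed.

Lemma delete_below (K : predrawing F) (c : I -> rect F) :
  good K -> vertical_corner K -> perm_eq (map c ls) (parts K) ->
  {in ls &, forall i j, c i != bottom_right K -> c j != bottom_right K ->
    below (lower K (c i)) (lower K (c j)) = below (c i) (c j)}.
Proof.
move=> gK vK pc i j ils jls ni nj.
have cK k : k \in ls -> c k \in parts K.
  by move=> kls; rewrite -(perm_mem pc) map_f.
have gD := good_delete gK vK; have [t0 [s0 qP]] := delete_key gK vK.
have gI := good_perm gK _ (insert_delete gK vK).
have {gI}gI : good (insert_vertical (delete K) (xl (bottom_right K), yt (bottom_right K))).
  by apply: gI; rewrite (delete_vertical gK vK).
have inps k : k \in ls -> c k != bottom_right K ->
    c k \in [seq t <- parts K | t != bottom_right K].
  by move=> kls nk; rewrite mem_filter nk cK.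
have inD k : k \in ls -> c k != bottom_right K -> lower K (c k) \in parts (delete K).
  by move=> kls nk; rewrite (delete_vertical gK vK) map_f // inps.
by rewrite -(below_raise gD gI qP) ?inD // !(lowerK gK vK) ?inps.
Qed.

Lemma delete_labelled :
  labelled [seq i <- ls | a i != bottom_right G]
    (fun i => lower G (a i)) (fun i => lower H (b i)) (delete G) (delete H).
Proof.
have [k [kls ak bk]] := lab_bottom_right_ex gG gH ab.
have er := lab_bottom_right gG gH ab.
have lsE : [seq i <- ls | a i != bottom_right G] = [seq i <- ls | b i != bottom_right H].
  by apply: eq_in_filter => i ils; rewrite er.
split.
- rewrite (delete_vertical gG vG) (map_comp (lower G) a); apply: perm_map.
  by rewrite -(filter_map a (fun t => t != bottom_right G)); apply/perm_filter/(lab_l ab).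
- rewrite lsE (delete_vertical gH vH) (map_comp (lower H) b); apply: perm_map.
  by rewrite -(filter_map b (fun t => t != bottom_right H)); apply/perm_filter/(lab_r ab).
- move=> i j; rewrite !mem_filter => /andP[ni ils] /andP[nj jls].
  rewrite (delete_left_of gG vG (lab_l ab)) //.
  rewrite (delete_left_of gH vH (lab_r ab)) ?er //.
  rewrite -ak -bk !(lab_left ab) // (lab_below ab) //.
  congr (_ || [&& _, _ & _]); apply: eq_in_has => m mls.
  by rewrite !(lab_left ab).
- move=> i j; rewrite !mem_filter => /andP[ni ils] /andP[nj jls].
  rewrite (delete_below gG vG (lab_l ab)) //.
  by rewrite (delete_below gH vH (lab_r ab)) ?er // (lab_below ab).
Qed.

End DeleteVertical.

Lemma size_labelled (I : eqType) (ls : seq I) a b G H : labelled ls a b G H ->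
  size (parts G) = size (parts H).
Proof.
by case=> pa pb _ _; rewrite -(perm_size pa) -(perm_size pb) !size_map.
Qed.

Lemma good_delete_any G : good G -> (1 < size (parts G))%N -> good (delete G).
Proof.
move=> gG gt1; case: (corner_cases gG gt1) => [|v]; first exact: good_delete.
rewrite -(reflect_predrawingK (delete G)) -delete_reflect //.
by apply: good_reflect; apply: good_delete => //; apply: good_reflect.
Qed.

Lemma delete_labelled_any (I : eqType) (ls : seq I) a b G H :
  good G -> good H -> labelled ls a b G H -> (1 < size (parts G))%N ->
  exists (J : eqType) (ms : seq J) a' b', labelled ms a' b' (delete G) (delete H).
Proof.
move=> gG gH ab gt1; case: (corner_cases gG gt1) => v.
  do 4 eexists; apply: (delete_labelled gG gH ab v).
  exact: vertical_corner_lab gG gH ab gt1 v.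
have gG' := good_reflect gG; have gH' := good_reflect gH.
have ab' := labelled_reflect ab.
have v' : vertical_corner (reflect_predrawing H).
  by apply: (vertical_corner_lab gG' gH' ab'); rewrite // size_map.
have := labelled_reflect (delete_labelled gG' gH' ab' v v').
rewrite !delete_reflect // !reflect_predrawingK => lab.
by do 4 eexists; apply: lab.
Qed.

(** Frees [parent] from the choice of [repr]. The default of [insubd] never shows up, as the
    deletion is again a partition. *)
Lemma parent_class (G D : drawing F) : (1 < size (parts G))%N ->
  predraw D = delete G -> parent (class_of G) = class_of D.
Proof.
move=> gt1 eD; rewrite /parent; set R : drawing F := repr (class_of G).
have [ls ab] : exists ls : seq (rect F * rect F), labelled ls fst snd G R.
  by apply: class_labelled; rewrite /R /class_of reprK.
have gtR : (1 < size (parts R))%N by rewrite -(size_labelled ab).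
have [J [ms [a' [b' ab']]]] := delete_labelled_any (goodP G) (goodP R) ab gt1.
have vR : `[< is_partition (delete R) >].
  by apply/asboolP/good_is_partition/good_delete_any => //; apply: goodP.
apply/esym/(@labelled_class _ _ ms a' b').
by rewrite -[predraw D]/(predraw D) eD -[predraw (insubd _ _)]/(val _) insubdK.
Qed.

End Invariance.

(** * Children of a rectangulation *)

Section VerticalChild.
Variable F : realFieldType.
Implicit Types (G H D : drawing F) (r s t u : rect F) (q : F * F).

Lemma left_of_leftmost (G : predrawing F) s t : good G -> s \in parts G ->
  left_of s t -> xl t = xl (box G) -> False.
Proof.
move=> gG sG; rewrite left_ofE => st e; have [? ? ? ?] := good_in gG sG.
by have [? ?] := good_nd gG sG; lra.
Qed.

Lemma key_point_on_key (G : predrawing F) t s : good G ->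
  t \in parts G -> s \in parts G -> is_key G t s -> on_key G t s (key_point t s).
Proof.
move=> gG tG sG ts; split=> //.
by have [_ ? _ [? ?] _] := is_keyP gG tG sG ts; rewrite /=; lra.
Qed.

Lemma on_key_uniq (G : predrawing F) t s t' s' q : good G ->
  on_key G t s q -> on_key G t' s' q -> t = t' /\ s = s'.
Proof.
move=> gG [tG sG k q1 q2] [tG' sG' k' q1' q2'].
have e : t = t'.
  have [/eqP e1 _] := andP k; have [/eqP e2 _] := andP k'.
  by apply: (bottom_eq gG tG tG' e1 e2); rewrite -q1.
subst t'; split=> //; apply: (key_eq gG tG sG sG' k k').
have := @key_no_height _ _ _ _ (yb s') gG tG sG k (key_heights gG tG sG' k').1.
have := @key_no_height _ _ _ _ (yb s) gG tG sG' k' (key_heights gG tG sG k).1.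
by have [_ ? _ _ _] := is_keyP gG tG sG k; lra.
Qed.

Lemma nth_key (I : eqType) (ls : seq I) a b (G H : predrawing F)
    (gG : good G) (gH : good H) (ab : labelled ls a b G H) k :
  (k < size (vertical_points G))%N -> exists i j,
    [/\ i \in ls, j \in ls,
        on_key G (a i) (a j) (nth (0, 0) (vertical_points G) k)
      & on_key H (b i) (b j) (nth (0, 0) (vertical_points H) k)].
Proof.
move=> klt; have [ks [eG eH _ ksP]] := vertical_points_labelled gG gH ab.
have klt' : (k < size ks)%N by rewrite eG size_map in klt.
have [l0 _] : exists p, p \in ks by case: ks klt' {eG eH ksP} => // p ks; exists p; rewrite mem_head.
have := mem_nth l0 klt'; rewrite ksP; set p := nth _ _ _ => /and3P[p1 p2 kp].
exists p.1, p.2; split=> //.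
- have /andP[p1G _] := lab_mem ab p1; have /andP[p2G _] := lab_mem ab p2.
  by rewrite eG (nth_map l0) // -/p; apply: key_point_on_key.
- have /andP[_ p1G] := lab_mem ab p1; have /andP[_ p2G] := lab_mem ab p2.
  have kp' : is_key H (b p.1) (b p.2) by rewrite (is_key_labelled gG gH ab).
  by rewrite eH (nth_map l0) // -/p; apply: key_point_on_key.
Qed.

Lemma lab_refl (G : predrawing F) : labelled (parts G) id id G G.
Proof. by split; rewrite ?map_id. Qed.

(** Here [k] counts from 0, whereas [insert] counts from 1. [H] is the literal result, so [G] must
    have enough room. *)
Definition inserts (k : nat) G H :=
  (k < size (vertical_points G))%N /\
  predraw H = insert_vertical G (nth (0, 0) (vertical_points G) k).

Lemma inserts_key k G H : inserts k G H -> exists t0 s0,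
  on_key G t0 s0 (nth (0, 0) (vertical_points G) k) /\
  good (insert_vertical G (nth (0, 0) (vertical_points G) k)).
Proof.
case=> klt eH; have [t0 [s0 [_ _ qP _]]] := nth_key (goodP G) (goodP G) (lab_refl G) klt.
by exists t0, s0; split=> //; rewrite -eH; apply: goodP.
Qed.

Lemma vertical_size_class G H : class_of G = class_of H ->
  size (vertical_points G) = size (vertical_points H).
Proof.
move=> /class_labelled[ls ab].
have [ks [-> -> _ _]] := vertical_points_labelled (goodP G) (goodP H) ab.
by rewrite !size_map.
Qed.

Lemma inserts_ex k G : (k < size (vertical_points G))%N ->
  exists G' H, class_of G' = class_of G /\ inserts k G' H.
Proof.
move=> klt; have gG := goodP G.
have [ks [eG _ _ ksP]] := vertical_points_labelled gG gG (lab_refl G).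
have klt' : (k < size ks)%N by rewrite eG size_map in klt.
have [l0 _] : exists p, p \in ks by case: ks klt' {eG ksP} => // p ks; exists p; rewrite mem_head.
have [t0 [s0 [t0G s0G qP _]]] := nth_key gG gG (lab_refl G) klt.
set q := nth _ _ _ in qP.
have [G' [f [gG' ab [f1 f2] qP' rm]]] := redraw gG qP.
have gI := insert_good gG' qP' rm.
exists (drawing_of gG'), (drawing_of gI); split.
  exact/esym/(@labelled_class _ _ _ _ _ G (drawing_of gG') ab).
have [ls' [eG1 eG' _ ls'P]] := vertical_points_labelled gG gG' ab.
(* The redrawing moves neither [t0] nor [s0], so the point with index [k] is still [q] and the room
   was made for the right insertion. *)
have eq' : nth (0, 0) (vertical_points G') k = q.
  have klt2 : (k < size ls')%N by rewrite eG1 size_map in klt.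
  have := mem_nth l0 klt2; rewrite ls'P eG' (nth_map l0) //.
  have := nth_map l0 (0, 0) (point_at id) klt2; rewrite -eG1 -/q.
  case: (nth l0 ls' k) => [t s] /= eqq /and3P[tG sG ts].
  have := key_point_on_key gG tG sG ts; rewrite -[key_point t s]eqq.
  move=> /(on_key_uniq gG qP)[et es]; subst t s.
  by rewrite eqq /point_at /= f1 f2.
split; last by rewrite /= eq'.
by rewrite /= eG' size_map; rewrite eG1 size_map in klt.
Qed.

Lemma inserts_class k G H G' H' : class_of G = class_of G' ->
  inserts k G H -> inserts k G' H' -> class_of H = class_of H'.
Proof.
move=> /class_labelled[ls ab] [klt eH] [klt' eH'].
have [i [j [ils jls qP qP']]] := nth_key (goodP G) (goodP G') ab klt.
have gH := goodP H; have gH' := goodP H'.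
have := insert_labelled (goodP G) (goodP G') ab ils jls qP qP'.
by rewrite -eH -eH' => /(_ gH gH'); apply: labelled_class.
Qed.

Lemma bottom_right_insert k G H : inserts k G H ->
  bottom_right H = new_part G (nth (0, 0) (vertical_points G) k).
Proof. by case=> _; rewrite /bottom_right => ->; rewrite /part /= !eqxx. Qed.

Lemma inserts_vertical k G H : inserts k G H -> vertical_corner H.
Proof.
move=> iGH; have gG := goodP G; have [t0 [s0 [qP gI]]] := inserts_key iGH.
have [t0G s0G _ q1 _] := qP; have [e1 _ ? [? _] ks] := on_keyP gG qP.
have rE := bottom_right_insert iGH; have [_ eH] := iGH.
set q := nth _ _ _ in qP q1 gI rE eH *.
have inH t : t \in parts G -> raise G q t \in parts H.
  by move=> tG; rewrite eH inE map_f ?orbT.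
have rx t : xl (raise G q t) = xl t by rewrite /raise; case: ifP.
rewrite /vertical_corner rE; split; last split.
- exists (raise G q t0); first exact: inH.
  by rewrite (below_new gG gI qP) // e1 eqxx lexx rx -q1 eqxx.
- move=> t; rewrite eH insert_verticalE inE => /predU1P[->|/mapP[u uG ->]].
    by rewrite lexx.
  by rewrite (below_new gG gI qP) // rx /= q1 => /andP[].
- case: ks => [[xs0 st]|[_ xe]]; [right|left]; last by rewrite /= q1 eH.
  exists (raise G q s0); rewrite ?inH //.
  have [? ?] := good_nd gG s0G.
  by case: (raiseP gG gI qP s0G) => [[_ _ ? _]|[-> _ _]] /=; lra.
Qed.

Lemma delete_insert k G H : inserts k G H -> delete H = G.
Proof.
move=> iGH; have vH := inserts_vertical iGH; have gH := goodP H.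
have rE := bottom_right_insert iGH; have gG := goodP G.
have [t0 [s0 [qP gI]]] := inserts_key iGH; have [_ eH] := iGH.
rewrite (delete_vertical gH vH) rE.
set q := nth _ _ _ in qP gI rE eH *.
have uH := good_uniq gH; rewrite eH insert_verticalE /= in uH.
have -> : [seq t <- parts H | t != new_part G q] = map (raise G q) (parts G).
  rewrite eH insert_verticalE /= eqxx /=; apply/all_filterP/allP => t tI.
  by have /andP[nt _] := uH; apply: contraNneq nt => <-.
have eb : box H = box G by rewrite eH.
rewrite eb -map_comp [RHS]surjective_pairing; congr pair.
rewrite -[RHS]map_id; apply/eq_in_map => t tG /=.
rewrite /lower rE (below_new gG gI qP) //.
have [t0G _ _ q1 _] := qP.
case: (raiseP gG gI qP tG) => [[-> e1 e2 e3]|[-> e1 e2]].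
  by rewrite e1 eqxx -q1 e2 /= -e1; case: (t).
case: eqP => [e|//]; rewrite -q1 => /=; case: leP => //= le; exfalso.
by clear -e1 e le; lra.
Qed.

Lemma inserts_size k G H : inserts k G H -> size (parts H) = (size (parts G)).+1.
Proof. by case=> _ ->; rewrite insert_verticalE /= size_map. Qed.

Lemma drawing_size_gt0 G : (0 < size (parts G))%N.
Proof.
have [rG _ _] := bottom_rightP (goodP G).
by case: (parts G) rG.
Qed.

Lemma inserts_parent k G H : inserts k G H -> parent (class_of H) = class_of G.
Proof.
move=> iGH; apply: parent_class; last by rewrite (delete_insert iGH).
by rewrite (inserts_size iGH) ltnS drawing_size_gt0.
Qed.

Lemma inserts_onto H : vertical_corner H -> (1 < size (parts H))%N ->
  exists k G H', [/\ inserts k G H', class_of G = parent (class_of H)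
    & class_of H' = class_of H].
Proof.
move=> vH gt1; have gH := goodP H; have gD := good_delete gH vH.
have [t0 [s0 qP]] := delete_key gH vH; set q := (_, _) in qP.
set D := drawing_of gD.
have pI := insert_delete gH vH.
have gI : good (insert_vertical (delete H) q).
  by apply: (good_perm gH _ pI); rewrite (delete_vertical gH vH).
have [ks [eD _ _ ksP]] := vertical_points_labelled gD gD (lab_refl _).
have [t0D s0D kts q1 q2] := qP.
have tsk : (t0, s0) \in ks by rewrite ksP /= t0D s0D.
pose k := index (t0, s0) ks.
have klt : (k < size (vertical_points D))%N by rewrite eD size_map index_mem.
have [G [H' [eG iGH']]] := @inserts_ex k D klt.
exists k, G, H'; split=> //; first by rewrite eG; apply/esym/parent_class.
have -> : class_of H = class_of (drawing_of gI) by apply: class_perm.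
have /class_labelled[ls ab] := esym eG.
have gG := goodP G.
have [i [j [ils jls qD qG]]] := nth_key gD gG ab klt.
have qk : nth (0, 0) (vertical_points (delete H)) k = key_point t0 s0.
  by rewrite eD (nth_map (t0, s0)) ?index_mem // /k nth_index.
rewrite qk in qD.
have [ei ej] := on_key_uniq gD qD (key_point_on_key gD t0D s0D kts).
have qP' : on_key (delete H) i.1 j.1 q by rewrite ei ej.
have [_ eH'] := iGH'; have gH' := goodP H'.
have := insert_labelled gD gG ab ils jls qP' qG gI.
rewrite -eH' => /(_ gH') lab; apply/esym.
exact: (@labelled_class _ _ _ _ _ (drawing_of gI) H' lab).
Qed.

(** The key can be read off the adjacencies of the new part: [t0] is the leftmost bottom part among
    those above it, and [s0] the highest part to its left, or [t0] when there is none. Hence equal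
    classes have corresponding keys, and equal keys have equal indices. *)
Lemma inserts_inj k k' G H G' H' : inserts k G H -> inserts k' G' H' ->
  class_of H = class_of H' -> k = k'.
Proof.
move=> iGH iGH' /class_labelled[ls ab]; have gH := goodP H; have gH' := goodP H'.
have gG := goodP G; have gG' := goodP G'.
have vH := inserts_vertical iGH; have vH' := inserts_vertical iGH'.
pose a (i : rect F * rect F) := lower H i.1.
pose b (i : rect F * rect F) := lower H' i.2.
pose ms := [seq i <- ls | i.1 != bottom_right H].
have ab' : labelled ms a b G G'.
  have := delete_labelled gH gH' ab vH vH'.
  by rewrite (delete_insert iGH) (delete_insert iGH').
have [t0 [s0 [qP gI]]] := inserts_key iGH.
have [t0' [s0' [qP' gI']]] := inserts_key iGH'.
have rE := bottom_right_insert iGH; have rE' := bottom_right_insert iGH'.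
have [klt eH] := iGH; have [klt' eH'] := iGH'.
set q := nth _ _ _ in qP gI rE eH; set q' := nth _ _ _ in qP' gI' rE' eH'.
have [ks [eG eG' uks ksP]] := vertical_points_labelled gG gG' ab'.
have [t0G s0G kts q1 q2] := qP; have [t0G' s0G' kts' q1' q2'] := qP'.
have [e0 _ _ _ k0] := on_keyP gG qP; have [e0' _ _ _ k0'] := on_keyP gG' qP'.
have msP i : i \in ms -> [/\ i \in ls, i.1 \in [seq t <- parts H | t != bottom_right H]
    & i.2 \in [seq t <- parts H' | t != bottom_right H']].
  move=> ims; have /andP[ne ils] : (i.1 != bottom_right H) && (i \in ls).
    by move: ims; rewrite mem_filter.
  have /andP[m1 m2] := lab_mem ab ils.
  by rewrite !mem_filter m1 m2 (lab_bottom_right gH gH' ab) // ne.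
have raiseE i : i \in ms -> raise G q (a i) = i.1 /\ raise G' q' (b i) = i.2.
  move=> /msP[_ m1 m2]; rewrite -(lowerK gH vH m1) -(lowerK gH' vH' m2).
  rewrite (delete_insert iGH) (delete_insert iGH') /a /b.
  by rewrite rE rE'.
have [rl [rls r1 r2]] := lab_bottom_right_ex gH gH' ab.
have aG i : i \in ms -> a i \in parts G by move=> /(lab_mem ab')/andP[].
have bG i : i \in ms -> b i \in parts G' by move=> /(lab_mem ab')/andP[].
have belowE' i : i \in ms ->
    (yb (a i) == yb (box G)) && (xl t0 <= xl (a i)) =
    (yb (b i) == yb (box G')) && (xl t0' <= xl (b i)).
  move=> ims; have [w1 w2] := raiseE i ims; have [ils _ _] := msP i ims.
  rewrite -(below_new gG gI qP) ?aG // -(below_new gG' gI' qP') ?bG //.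
  by rewrite w1 w2 -rE -rE' -r1 -r2 (lab_below ab).
have leftE i : i \in ms ->
    left_of (a i) t0 && (yb (a i) <= yb s0) =
    left_of (b i) t0' && (yb (b i) <= yb s0').
  move=> ims; have [w1 w2] := raiseE i ims; have [ils _ _] := msP i ims.
  rewrite -(left_of_new gG gI qP) ?aG // -(left_of_new gG' gI' qP') ?bG //.
  by rewrite w1 w2 -rE -rE' -r1 -r2 (lab_left ab).
have [i ims ei] := lab_ex ab' t0G; have [m mms em] := lab_ex (lab_sym ab') t0G'.
(* [t0] and [t0'] are the leftmost elements of corresponding sets, by [belowE']. *)
have bi : b i = t0'.
  have h1 := belowE' i ims; rewrite ei e0 eqxx lexx /= in h1.
  have h2 := belowE' m mms; rewrite em e0' eqxx lexx /= in h2.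
  case/esym/andP: h1 => /eqP h1 h1'; case/andP: h2 => /eqP h2 h2'.
  have h3 := lab_bottom_lt gG gG' ab' mms ims h2.
  rewrite ei em in h3; have {}h3 := h3 e0.
  apply: (bottom_eq gG' (bG i ims) t0G' h1 e0').
  by apply/eqP; rewrite eq_le h1' andbT leNgt h3 -leNgt.
(* [s0] and [s0'] are the highest elements of corresponding sets, by [leftE]; on the left boundary
   both coincide with the first component. *)
have [j jms [aj bj]] : exists2 j, j \in ms & a j = s0 /\ b j = s0'.
  case: k0 => [[_ l0]|[e xe]]; last first.
    exists i; rewrite // ei bi e; split=> //.
    case: k0' => [[_ l0']|[-> //]].
    have := lab_leftmost gG gG' ab' ims; rewrite ei bi xe eqxx => /eqP xe'.
    by case: (left_of_leftmost gG' s0G' l0' xe').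
  have [j jms ej] := lab_ex ab' s0G; exists j => //; split=> //.
  have h1 := leftE j jms; rewrite ej l0 lexx /= in h1.
  case/esym/andP: h1 => h1 h1'.
  have l0' : left_of s0' t0'.
    case: k0' => [[_ //]|[_ xe]].
    by case: (left_of_leftmost gG' (bG j jms) h1 xe).
  have [l lms el] := lab_ex (lab_sym ab') s0G'.
  have h2 := leftE l lms; rewrite el l0' lexx /= in h2; case/andP: h2 => h2 h2'.
  have := lab_left_lt gG gG' ab' ims jms lms; rewrite ei ej el.
  move=> /(_ l0 h2) h3; apply: (left_eq gG' (bG j jms) s0G' h1 l0').
  by apply/eqP; rewrite eq_le h1' /= leNgt h3 -leNgt.
have ijk : (i, j) \in ks by rewrite ksP /= ims jms ei aj.
have iP (K : predrawing F) (gK : good K) c t s n :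
    vertical_points K = map (point_at c) ks -> (n < size ks)%N ->
    on_key K t s (nth (0, 0) (vertical_points K) n) ->
    (forall p, p \in ks ->
      [/\ c p.1 \in parts K, c p.2 \in parts K & is_key K (c p.1) (c p.2)]) ->
    c (nth (i, j) ks n).1 = t /\ c (nth (i, j) ks n).2 = s.
  move=> eK nlt kk ckP; have [c1 c2 ck] := ckP _ (mem_nth (i, j) nlt).
  apply: (on_key_uniq gK _ kk); rewrite eK (nth_map (i, j)) //.
  exact: key_point_on_key.
have inj_a : {in ms &, injective a}.
  by apply: uniq_map_inj; rewrite (perm_uniq (lab_l ab')) (good_uniq gG).
have inj_b : {in ms &, injective b}.
  by apply: uniq_map_inj; rewrite (perm_uniq (lab_r ab')) (good_uniq gG').
have kl : (k < size ks)%N by rewrite eG size_map in klt.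
have kl' : (k' < size ks)%N by rewrite eG' size_map in klt'.
have [||u1 u2] := iP _ gG a t0 s0 k eG kl; first exact: qP.
  by move=> p; rewrite ksP => /and3P[p1 p2 kp]; rewrite !aG.
have [||v1 v2] := iP _ gG' b t0' s0' k' eG' kl'; first exact: qP'.
  by move=> p; rewrite ksP => /and3P[p1 p2 kp]; rewrite !bG // (is_key_labelled gG gG' ab').
have := mem_nth (i, j) kl; rewrite ksP => /and3P[m1 m2 _].
have := mem_nth (i, j) kl'; rewrite ksP => /and3P[m3 m4 _].
apply/eqP; rewrite -(nth_uniq (i, j) kl kl' uks); apply/eqP.
rewrite -ei in u1; rewrite -aj in u2; rewrite -bi in v1; rewrite -bj in v2.
rewrite [LHS]surjective_pairing [RHS]surjective_pairing.
by rewrite (inj_a _ _ m1 ims u1) (inj_a _ _ m2 jms u2) (inj_b _ _ m3 ims v1) (inj_b _ _ m4 jms v2).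
Qed.

End VerticalChild.

(** * Bottom-based and right-based insertions *)

Section Based.
Variable F : realFieldType.
Implicit Types (G H D : drawing F) (r s t u : rect F) (q : F * F).

Lemma reprK_class G : class_of (repr (class_of G) : drawing F) = class_of G.
Proof. by rewrite /class_of reprK. Qed.

Lemma reflect_class G H : class_of G = class_of H ->
  class_of (reflect_drawing G) = class_of (reflect_drawing H).
Proof.
move=> /class_labelled[ls ab].
exact: (@labelled_class _ _ _ _ _ (reflect_drawing G) (reflect_drawing H)
  (labelled_reflect ab)).
Qed.

Lemma reflect_drawingK : involutive (@reflect_drawing F).
Proof. by move=> G; apply: val_inj; apply: reflect_predrawingK. Qed.

Lemma bottom_based_class G :
  bottom_based (class_of G) = (xl (bottom_right G) == xl (box G)).
Proof.
have [ls ab] := class_labelled (reprK_class G); rewrite /bottom_based.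
set R : drawing F := repr _ in ab *; have gR := goodP R; have gG := goodP G.
have [rG e1 e2] := bottom_rightP gG.
apply/hasP/eqP => [[t tR /and3P[yt' lt' rt']]|e].
  have [i ils ei] := lab_ex ab tR; have /andP[_ iG] := lab_mem ab ils.
  rewrite -(bottom_right_uniq gG iG); apply/eqP.
  - by rewrite (lab_leftmost gR gG ab) // ei.
  - by rewrite (lab_rightmost gR gG ab) // ei.
  - by rewrite (lab_bottom gR gG ab) // ei.
have [i ils ei] := lab_ex (lab_sym ab) rG; exists i.1.
  by have /andP[] := lab_mem ab ils.
rewrite -(lab_bottom gR gG ab) // -(lab_leftmost gR gG ab) //.
by rewrite -(lab_rightmost gR gG ab) // ei e e1 e2 !eqxx.
Qed.

Lemma right_based_class G :
  right_based (class_of G) = bottom_based (class_of (reflect_drawing G)).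
Proof.
rewrite -(reflect_class (reprK_class G)) bottom_based_class /right_based.
set R : drawing F := repr _; have gR := goodP R.
rewrite [in RHS](_ : predraw (reflect_drawing R) = reflect_predrawing R) //.
rewrite (bottom_right_reflect gR) /= eqr_opp; have [rR e1 e2] := bottom_rightP gR.
apply/hasP/eqP => [[t tR /and3P[/eqP xt /eqP bt /eqP yt']]|e].
  by rewrite -(bottom_right_uniq gR tR xt bt).
by exists (bottom_right R) => //; rewrite e1 e2 e !eqxx.
Qed.

Lemma uniq_vertical_points G : uniq (vertical_points G).
Proof.
have gG := goodP G.
have [ks [-> _ uks ksP]] := vertical_points_labelled gG gG (lab_refl G).
rewrite map_inj_in_uniq // => -[t s] [t' s']; rewrite !ksP.
move=> /and3P[/= tG sG ts] /and3P[/= tG' sG' ts'] e.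
by have [-> ->] := key_point_inj gG tG sG tG' sG' ts ts' e.
Qed.

(** The part in the bottom-left corner contributes the single edge on the left boundary, which is
    smallest in the order; this is why only the first insertion spans the whole bottom. *)
Lemma vertical_point0 G : exists p0 vs, [/\ vertical_points G = p0 :: vs,
  p0.1 = xl (box G) & {in vs, forall v, v.1 != xl (box G)}].
Proof.
have gG := goodP G; have [bx by_] := good_box gG.
have [||t tG tP] := good_cov gG (x := xl (box G)) (y := yb (box G)); [lra|lra|].
have [? ? ? ?] := good_in gG tG.
have ex : xl t = xl (box G) by lra.
have ey : yb t = yb (box G) by lra.
have tt : is_key G t t by rewrite /is_key ex ey !eqxx orbT.
have [ks [eV _ _ ksP]] := vertical_points_labelled gG gG (lab_refl G).
have pV : key_point t t \in vertical_points G.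
  by rewrite eV; apply/mapP; exists (t, t); rewrite // ksP tG.
have geV v : v \in vertical_points G ->
    xl (box G) <= v.1 /\ (v.1 = xl (box G) -> v = key_point t t).
  rewrite eV => /mapP[[t' s']]; rewrite ksP => /and3P[/= tG' sG' ts] ->.
  have [? ? ? ?] := good_in gG tG'; rewrite /point_at /=; split=> // xe.
  have et : t' = t.
    by have [/eqP e1 _] := andP ts; apply: (bottom_eq gG tG' tG); rewrite ?ex.
  subst t'; case/andP: ts => _ /orP[st|/andP[/eqP-> _]] //.
  by case: (left_of_leftmost gG sG' st).
have uV := uniq_vertical_points G.
have := sort_sorted (@lex_xy_total F)
  (flatten [seq left_side_points G t | t <- parts G & touches_bottom G t]).
rewrite -/(vertical_points G); case: (vertical_points G) pV geV uV => // p0 vs pV geV uV.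
move=> /(order_path_min (@lex_xy_trans F))/allP le_p0.
have e0 : p0 = key_point t t.
  have [h1 h2] := geV p0 (mem_head _ _).
  move: pV; rewrite inE => /predU1P[->//|/le_p0]; rewrite /lex_xy /= ex => ?.
  by apply: h2; lra.
exists p0, vs; split; rewrite // ?e0 //= => v vvs; apply/eqP => e.
have [_ /(_ e) ev] := geV v (mem_behead (s := p0 :: vs) vvs).
by move: uV; rewrite /= e0 -ev vvs.
Qed.

Lemma vertical_size_gt0 G : (0 < size (vertical_points G))%N.
Proof. by have [p0 [vs [-> _ _]]] := vertical_point0 G. Qed.

Lemma inserts_bottom_based k G H : inserts k G H ->
  bottom_based (class_of H) = (k == 0).
Proof.
move=> iGH; rewrite bottom_based_class (bottom_right_insert iGH) /=.
have [klt ->] := iGH; have [p0 [vs [eV e0 ne]]] := vertical_point0 G.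
rewrite [box _]/=; move: klt; rewrite eV.
case: k {iGH} => [|k] /=; first by rewrite e0 eqxx.
by rewrite ltnS => klt; apply/negbTE/ne/mem_nth.
Qed.

(** The new top [q.2] is strictly below the top of [t0], so the new part cannot fill the right
    boundary. *)
Lemma inserts_right_based k G H : inserts k G H -> right_based (class_of H) = false.
Proof.
move=> iGH; rewrite right_based_class bottom_based_class.
rewrite [predraw (reflect_drawing H)]/(reflect_predrawing H).
rewrite (bottom_right_reflect (goodP H)) (bottom_right_insert iGH) /= eqr_opp.
have [_ ->] := iGH; rewrite [box _]/=; apply/negbTE.
have [t0 [s0 [qP _]]] := inserts_key iGH.
have [_ _ _ [_ lt] _] := on_keyP (goodP G) qP; have [t0G _ _ _ _] := qP.
have [_ _ _ le] := good_in (goodP G) t0G.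
by rewrite lt_eqF // (lt_le_trans lt le).
Qed.

End Based.

(** * Horizontal insertion by reflection *)

Section ReflectedPoints.
Variable F : realFieldType.
Implicit Types (G H : predrawing F) (r s t u : rect F) (q : F * F).

Lemma reflect_pointK : involutive (@reflect_point F).
Proof. by case=> x y; rewrite /reflect_point /= !opprK. Qed.

Lemma mem_midpoints_opp (S S' : seq F) m : (forall x, (x \in S') = (- x \in S)) ->
  (m \in midpoints S') = (- m \in midpoints S).
Proof.
move=> SS'; apply/midpointsP/midpointsP => -[a [b [aS bS ab em none]]];
  exists (- b), (- a); split; rewrite ?SS' ?opprK -?SS' //; try by lra.
- by move=> c cS ac; apply: (none (- c)); rewrite ?SS' ?opprK //; lra.
- by move=> c cS ac; apply: (none (- c)); rewrite -?SS' //; lra.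
Qed.

Lemma top_side_reflect G t :
  perm_eq (top_side_points (reflect_predrawing G) (reflect_rect t))
    (map (@reflect_point F) (left_side_points G t)).
Proof.
apply: uniq_perm.
- by rewrite map_inj_uniq ?midpoints_uniq // => y y' [].
- rewrite map_inj_uniq; last exact: inv_inj reflect_pointK.
  by rewrite map_inj_uniq ?midpoints_uniq // => y y' [].
move=> [x y]; pose S' := [seq v.1 | v <- vertices (reflect_predrawing G) &
  (v.2 == yt (reflect_rect t)) && (xl (reflect_rect t) <= v.1 <= xr (reflect_rect t))].
pose S := left_heights G t.
have SS' z : (z \in S') = (- z \in S).
  apply/mapP/mapP => -[v]; rewrite mem_filter.
    move=> /andP[/andP[/= v2 v1] /flatten_mapP[u]].
    move=> /mapP[w wG ->] vu ez; exists (reflect_point v).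
      rewrite mem_filter /= eqr_oppLR v2 /=; apply/andP; split; first by lra.
      apply/flatten_mapP; exists w => //; move: vu; rewrite !inE.
      by case/or4P => /eqP-> /=; rewrite /reflect_point /= !opprK ?eqxx ?orbT.
    by rewrite ez.
  move=> /andP[/andP[/= v1 v2] /flatten_mapP[u uG vu]] ez.
  exists (reflect_point v); last by rewrite /= -ez opprK.
  rewrite mem_filter /= eqr_opp v1 /=; apply/andP; split; first by lra.
  apply/flatten_mapP; exists (reflect_rect u); first exact: map_f.
  move: vu; rewrite !inE.
  by case/or4P => /eqP-> /=; rewrite /reflect_point /= ?eqxx ?orbT.
rewrite /top_side_points -/S' /left_side_points -/(left_heights G t) -/S.
apply/mapP/mapP => [[m mS [-> ->]]|[v /mapP[m mS ->] [-> ->]]].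
  exists (xl t, - m); last by rewrite /reflect_point /= opprK.
  by apply: map_f; rewrite -(mem_midpoints_opp _ SS').
exists (- m) => //; rewrite (mem_midpoints_opp _ SS') opprK.
by [].
Qed.

(** Under (x, y) |-> (-y, -x) the order [lex_xy] becomes the converse of [lex_yx], whence the
    reversal. On the full list of insertion points, position [i] thus becomes [nu + 1 - i]. *)
Lemma horizontal_reflect G : horizontal_points (reflect_predrawing G) =
  rev (map (@reflect_point F) (vertical_points G)).
Proof.
have lexE (u v : F * F) : lex_yx (reflect_point u) (reflect_point v) = lex_xy v u.
  by rewrite /lex_yx /lex_xy /= ltrN2 lerN2 eqr_opp (eq_sym u.1).
apply: (sorted_eq (leT := @lex_yx F)).
- move=> u v w; rewrite -(reflect_pointK u) -(reflect_pointK v) -(reflect_pointK w).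
  by rewrite !lexE => h1 h2; apply: lex_xy_trans h1.
- move=> u v; rewrite -(reflect_pointK u) -(reflect_pointK v) !lexE andbC.
  by move=> /lex_xy_anti ->.
- apply: sort_sorted => u v; rewrite -(reflect_pointK u) -(reflect_pointK v) !lexE.
  exact: lex_xy_total.
- rewrite rev_sorted sorted_map.
  apply: sub_sorted (sort_sorted (@lex_xy_total F) _) => u v /= uv.
  by rewrite lexE.
rewrite perm_sym perm_rev perm_sym /horizontal_points perm_sort.
apply: perm_trans (_ : perm_eq _ (map (@reflect_point F) (flatten
   [seq left_side_points G t | t <- parts G & touches_bottom G t]))) _.
  rewrite [parts (reflect_predrawing G)]/= filter_map -map_comp map_flatten -map_comp.
  rewrite (eq_filter (a2 := touches_bottom G)); last first.
    by move=> t; rewrite /= /touches_right /touches_bottom /= eqr_opp.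
  elim: [seq t <- parts G | _] => //= t ts IH; apply: perm_cat => //.
  exact: top_side_reflect.
by apply: perm_map; rewrite perm_sym perm_sort.
Qed.

Lemma insertion_reflect G : insertion_points (reflect_predrawing G) =
  rev (map (@reflect_point F) (insertion_points G)).
Proof.
rewrite /insertion_points horizontal_reflect map_cat rev_cat; congr (_ ++ _).
rewrite -[in RHS](reflect_predrawingK G) horizontal_reflect map_rev revK.
by rewrite -map_comp (eq_map (g := id)) ?map_id // => v; apply: reflect_pointK.
Qed.

Lemma insert_horizontal_reflect G q :
  insert_horizontal (reflect_predrawing G) (reflect_point q) =
  reflect_predrawing (insert_vertical G q).
Proof.
rewrite /insert_horizontal /insert_vertical /reflect_predrawing /=; congr (_, _ :: _).
rewrite -!map_comp; apply: eq_map => t /=.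
by rewrite /touches_right /touches_bottom /= eqr_opp lerN2; case: ifP.
Qed.

Lemma insert_vertical_reflect G q :
  insert_vertical (reflect_predrawing G) (reflect_point q) =
  reflect_predrawing (insert_horizontal G q).
Proof.
rewrite -[RHS]/(reflect_predrawing _) -{2}[G]reflect_predrawingK.
by rewrite -{2}[q]reflect_pointK insert_horizontal_reflect reflect_predrawingK.
Qed.

Lemma size_insertion_points G : size (insertion_points G) =
  (size (vertical_points G) + size (vertical_points (reflect_predrawing G)))%N.
Proof.
rewrite size_cat -{2}[G]reflect_predrawingK horizontal_reflect size_rev size_map.
by [].
Qed.

End ReflectedPoints.

(** * The tree of rectangulations *)

Section Classes.
Variable F : realFieldType.
Implicit Types (G H D : drawing F) (P R : rectangulation F).

Lemma class_ind (p : rectangulation F -> Prop) :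
  (forall G, p (class_of G)) -> forall R, p R.
Proof. by move=> pG R; rewrite -[R]reprK; apply: pG. Qed.

Definition nvert (G : predrawing F) := size (vertical_points G).
Definition nins (G : predrawing F) := size (insertion_points G).

Lemma ninsE (G : predrawing F) : nins G = (nvert G + nvert (reflect_predrawing G))%N.
Proof. exact: size_insertion_points. Qed.

Lemma nins_reflect (G : predrawing F) : nins (reflect_predrawing G) = nins G.
Proof. by rewrite /nins insertion_reflect size_rev size_map. Qed.

Lemma nvert_class G H : class_of G = class_of H -> nvert G = nvert H.
Proof. exact: vertical_size_class. Qed.

Lemma nvert_gt0 G : (0 < nvert G)%N.
Proof. exact: vertical_size_gt0. Qed.

Lemma nu_class G : nu (class_of G) = nins G.
Proof.
have e := reprK_class G; rewrite /nu -/(nins _) !ninsE (nvert_class e).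
by congr (_ + _)%N; apply: nvert_class (reflect_class e).
Qed.

Lemma nrects_class G : nrects (class_of G) = size (parts G).
Proof. by have [ls ab] := class_labelled (reprK_class G); apply: size_labelled ab. Qed.

Definition insertion i G H := (0 < i <= nins G)%N /\ predraw H = insert G i.

Lemma insert_leq (G : predrawing F) i : (0 < i <= nvert G)%N ->
  insert G i = insert_vertical G (nth (0, 0) (vertical_points G) i.-1).
Proof.
rewrite /insert -/(nvert G) => /andP[i0 le]; rewrite le /insertion_points nth_cat.
by rewrite -/(nvert G) ifT // prednK.
Qed.

Lemma insert_gt (G : predrawing F) i : (nvert G < i)%N ->
  insert G i = insert_horizontal G (nth (0, 0) (insertion_points G) i.-1).
Proof. by rewrite /insert -/(nvert G) ltnNge => /negbTE->. Qed.

Lemma insertion_vertical k G H : inserts k G H -> insertion k.+1 G H.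
Proof.
case; rewrite -/(nvert G) => klt eH; split; first by rewrite ninsE; lia.
by rewrite eH insert_leq.
Qed.

Lemma nth_insertion_reflect (G : predrawing F) i : (0 < i <= nins G)%N ->
  nth (0, 0) (insertion_points (reflect_predrawing G)) (nins G - i) =
  reflect_point (nth (0, 0) (insertion_points G) i.-1).
Proof.
move=> iP; have h N : (0 < i <= N)%N ->
    [/\ (N - i < N)%N, (N - (N - i).+1)%N = i.-1 & (i.-1 < N)%N].
  by move=> ?; split; lia.
have [h1 h2 h3] := h _ iP; rewrite insertion_reflect nth_rev size_map //.
by rewrite h2 (nth_map (0, 0)).
Qed.

Lemma insert_reflect (G : predrawing F) i : (0 < i <= nins G)%N ->
  insert (reflect_predrawing G) ((nins G).+1 - i) = reflect_predrawing (insert G i).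
Proof.
move=> iP; have eN := ninsE G; have [le|gt] := leqP i (nvert G).
  rewrite (@insert_leq G i); last by lia.
  rewrite insert_gt; last by lia.
  rewrite (_ : (_ - i).-1 = nins G - i)%N; last by lia.
  rewrite nth_insertion_reflect // insert_horizontal_reflect.
  by rewrite /insertion_points nth_cat ifT // -/(nvert G); lia.
rewrite (@insert_gt G i) // insert_leq; last by lia.
rewrite -insert_vertical_reflect -nth_insertion_reflect //.
rewrite (_ : (_ - i).-1 = nins G - i)%N; last by lia.
by rewrite /insertion_points nth_cat ifT // -/(nvert _); lia.
Qed.

Lemma insertion_flip i G H : insertion i G H ->
  insertion ((nins G).+1 - i) (reflect_drawing G) (reflect_drawing H).
Proof.
case=> iP eH; split; last by rewrite (insert_reflect iP) -eH.
by rewrite [nins (reflect_drawing G)]nins_reflect; lia.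
Qed.

(** Every insertion is vertical either in the drawing or in its reflection. The index [nins G - i],
    counted from 0, is the reflected position [(nins G).+1 - i] counted from 1. *)
Lemma insertion_cases i G H : insertion i G H ->
  inserts i.-1 G H /\ (i <= nvert G)%N \/
  inserts (nins G - i) (reflect_drawing G) (reflect_drawing H) /\ (nvert G < i)%N.
Proof.
move=> iGH; have [iP eH] := iGH; have eN := ninsE G.
have [le|gt] := leqP i (nvert G); [left|right]; split=> //.
  by split; [rewrite -/(nvert G); lia | rewrite eH insert_leq //; lia].
have [_ eR] := insertion_flip iGH; split.
  by rewrite -/(nvert (reflect_predrawing G)); lia.
have eW : nvert (reflect_drawing G) = nvert (reflect_predrawing G) by [].
rewrite eR insert_leq; last by rewrite eW; lia.
by congr (insert_vertical _ (nth _ _ _)); lia.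
Qed.

Lemma insertion_ex i G : (0 < i <= nins G)%N ->
  exists G' H, class_of G' = class_of G /\ insertion i G' H.
Proof.
move=> iP; have eN := ninsE G.
have [le|gt] := leqP i (nvert G).
  have [|G' [H [e iGH]]] := @inserts_ex _ i.-1 G; first by rewrite -/(nvert G); lia.
  exists G', H; split=> //; have := insertion_vertical iGH.
  by rewrite prednK //; lia.
have [|G' [H [e iGH]]] := @inserts_ex _ (nins G - i) (reflect_drawing G).
  by rewrite -/(nvert (reflect_predrawing G)); lia.
have e' := reflect_class e; rewrite reflect_drawingK in e'.
exists (reflect_drawing G'), (reflect_drawing H); split=> //.
have := insertion_flip (insertion_vertical iGH).
have := nu_class (reflect_drawing G'); rewrite e' nu_class.
rewrite [nins (reflect_drawing G')]nins_reflect => <-.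
by rewrite (_ : (_ - (_ - i).+1)%N = i) //; lia.
Qed.

Lemma insertion_class i G H G' H' : class_of G = class_of G' ->
  insertion i G H -> insertion i G' H' -> class_of H = class_of H'.
Proof.
move=> e iGH iGH'; have eN := nu_class G; rewrite e nu_class in eN.
have eV := nvert_class e.
case: (insertion_cases iGH) => -[j l]; case: (insertion_cases iGH') => -[j' l'].
- exact: inserts_class e j j'.
- by exfalso; lia.
- by exfalso; lia.
have := inserts_class (reflect_class e) j; rewrite -eN => /(_ _ j') h.
by have := reflect_class h; rewrite !reflect_drawingK.
Qed.

Lemma insertion_vertical_corner i G H : insertion i G H ->
  vertical_corner H <-> (i <= nvert G)%N.
Proof.
move=> iGH; case: (insertion_cases iGH) => -[j l].
  by split=> // _; apply: inserts_vertical j.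
split=> [vH|]; last by lia.
(* A horizontal insertion leaves a vertex of type T, with nothing going up, while
   [vertical_corner H] gives one of type |-. *)
have := stem_right_corner (goodP (reflect_drawing H)) (inserts_vertical j).
rewrite [predraw (reflect_drawing H)]/(reflect_predrawing H).
rewrite (bottom_right_reflect (goodP H)).
rewrite -[(xl _, yt _)]/(reflect_point (xl (bottom_right H), yt (bottom_right H))).
rewrite (stem_reflect H _).1 => /and4P[_ _ _ nup].
by have /and4P[up _ _ _] := stem_right_corner (goodP H) vH; rewrite up in nup.
Qed.

(** The type of the corner depends only on the class, so both insertions are vertical or both
    horizontal, and [inserts_inj] applies to the drawings or to their reflections. *)
Lemma insertion_inj i i' G H G' H' : class_of G = class_of G' ->
  insertion i G H -> insertion i' G' H' -> class_of H = class_of H' -> i = i'.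
Proof.
move=> eG iGH iGH' eH; have eN := nu_class G; rewrite eG nu_class in eN.
have eV := nvert_class eG; have [/andP[? ?] _] := iGH; have [/andP[? ?] _] := iGH'.
have vv : vertical_corner H <-> vertical_corner H'.
  have h K K' L : class_of K = class_of K' -> insertion L G K \/ insertion L G' K ->
      vertical_corner K -> vertical_corner K'.
    move=> /class_labelled[ls ab] iL; apply: (vertical_corner_lab (goodP K) (goodP K') ab).
    have [n] : exists D, (size (parts K) = (size (parts (D : drawing F))).+1)%N.
      by case: iL => /insertion_cases[[j _]|[j _]]; have := inserts_size j;
        rewrite ?size_map => ->; [exists G|exists G|exists G'|exists G'].
    by move=> ->; rewrite ltnS drawing_size_gt0.
  by split; [apply: (h _ _ i eH); left | apply: (h _ _ i' (esym eH)); right].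
have := insertion_vertical_corner iGH; have := insertion_vertical_corner iGH'.
case: (insertion_cases iGH) => -[j l]; case: (insertion_cases iGH') => -[j' l'].
- by move=> _ _; have := inserts_inj j j' eH; lia.
- by move=> [h1 _] [_ h2]; have := h1 (vv.1 (h2 l)); lia.
- by move=> [_ h1] [h2 _]; have := h2 (vv.2 (h1 l')); lia.
- by move=> _ _; have := inserts_inj j j' (reflect_class eH); lia.
Qed.

(** An insertion with index [i] exists in some drawing, so [xget] never falls back on its
    default. *)
Lemma childP i P : (0 < i <= nu P)%N ->
  exists G H, [/\ class_of G = P, class_of H = child i P & insertion i G H].
Proof.
elim/class_ind: P => G; rewrite nu_class => iP.
have [G0 [H0 [e [i1 i2]]]] := insertion_ex iP.
have : is_insertion i (class_of G) (child i (class_of G)).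
  by rewrite /child; apply: (@xgetI _ _ _ (class_of H0)); exists G0, H0; split.
by case=> G' [H' [? ? ? ?]]; exists G', H'; split=> //.
Qed.

Lemma child_eq i G H : insertion i G H -> class_of H = child i (class_of G).
Proof.
move=> iGH; have [iP _] := iGH.
have [|G' [H' [eG <- iGH']]] := @childP i (class_of G); first by rewrite nu_class.
exact: insertion_class (esym eG) iGH iGH'.
Qed.

Definition reflectR R : rectangulation F :=
  class_of (reflect_drawing (repr R)).

Lemma reflectR_class G : reflectR (class_of G) = class_of (reflect_drawing G).
Proof. exact/reflect_class/reprK_class. Qed.

Lemma reflectRK : involutive reflectR.
Proof. by elim/class_ind => G; rewrite !reflectR_class reflect_drawingK. Qed.

Lemma nrects_reflectR R : nrects (reflectR R) = nrects R.
Proof. by elim/class_ind: R => G; rewrite reflectR_class !nrects_class size_map. Qed.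

Lemma parent_reflectR R : (1 < nrects R)%N -> parent (reflectR R) = reflectR (parent R).
Proof.
elim/class_ind: R => G; rewrite nrects_class => gt1.
have gD := good_delete_any (goodP G) gt1.
rewrite reflectR_class (@parent_class _ G (drawing_of gD)) // reflectR_class.
apply: parent_class; first by rewrite size_map.
by rewrite /= (delete_reflect (goodP G)).
Qed.

Lemma bottom_based_reflectR R : bottom_based (reflectR R) = right_based R.
Proof. by elim/class_ind: R => G; rewrite reflectR_class right_based_class. Qed.

Lemma nu_ge2 R : (1 < nu R)%N.
Proof.
elim/class_ind: R => G; rewrite nu_class ninsE.
by have := nvert_gt0 G; have : (0 < nvert (reflect_predrawing G))%N := nvert_gt0 (reflect_drawing G); lia.
Qed.

Lemma parent_child i P : (0 < i <= nu P)%N -> parent (child i P) = P.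
Proof.
move=> /childP[G [H [<- <- iGH]]]; case: (insertion_cases iGH) => -[j _].
  exact: inserts_parent j.
have := congr1 reflectR (inserts_parent j); rewrite -parent_reflectR.
  by rewrite !reflectR_class !reflect_drawingK.
by rewrite nrects_class (inserts_size j) ltnS drawing_size_gt0.
Qed.

Lemma nrects_child i P : (0 < i <= nu P)%N -> nrects (child i P) = (nrects P).+1.
Proof.
move=> /childP[G [H [<- <- iGH]]]; rewrite !nrects_class.
case: (insertion_cases iGH) => -[j _]; first exact: inserts_size j.
by have := inserts_size j; rewrite !size_map.
Qed.

Lemma child_inj i j P : (0 < i <= nu P)%N -> (0 < j <= nu P)%N ->
  child i P = child j P -> i = j.
Proof.
move=> /childP[G [H [<- <- iGH]]] /childP[G' [H' [eG <- iGH']]].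
exact: insertion_inj (esym eG) iGH iGH'.
Qed.

Lemma child_onto R : (1 < nrects R)%N ->
  exists2 i, (0 < i <= nu (parent R))%N & R = child i (parent R).
Proof.
elim/class_ind: R => H; rewrite nrects_class => gt1.
have [] := corner_cases (goodP H) gt1 => v.
  have [k [G [H' [iGH <- <-]]]] := inserts_onto v gt1.
  have iG := insertion_vertical iGH; exists k.+1; last exact: child_eq.
  by rewrite nu_class; case: iG.
have [|k [G [H' [iGH eG eH]]]] := @inserts_onto _ (reflect_drawing H) v.
  by rewrite size_map.
have iG := insertion_flip (insertion_vertical iGH).
have eG' : class_of (reflect_drawing G) = parent (class_of H).
  have := congr1 reflectR eG; rewrite -reflectR_class -parent_reflectR.
    by rewrite reflectRK reflectR_class.
  by rewrite nrects_reflectR nrects_class.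
have eH' : class_of (reflect_drawing H') = class_of H.
  by rewrite (reflect_class eH) reflect_drawingK.
eexists; last by rewrite -eG' -eH'; apply: child_eq iG.
by rewrite -eG' nu_class; case: iG.
Qed.

Lemma bottom_based_child i P : (0 < i <= nu P)%N ->
  bottom_based (child i P) = (i == 1).
Proof.
move=> iP; have [G [H [eG <- iGH]]] := childP iP.
case: (insertion_cases iGH) => -[j l].
  by rewrite (inserts_bottom_based j); lia.
have := inserts_right_based j.
rewrite right_based_class reflect_drawingK => ->.
by have := nvert_gt0 G; lia.
Qed.

Lemma right_based_child i P : (0 < i <= nu P)%N ->
  right_based (child i P) = (i == nu P).
Proof.
move=> iP; have [G [H [eG <- iGH]]] := childP iP; rewrite -eG nu_class.
rewrite -eG nu_class in iP; have eN := ninsE G.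
case: (insertion_cases iGH) => -[j l].
  rewrite (inserts_right_based j).
  by have : (0 < nvert (reflect_predrawing G))%N := nvert_gt0 (reflect_drawing G); lia.
by rewrite right_based_class (inserts_bottom_based j); lia.
Qed.

(** Supplies the level with two parts, where both the parity argument and the cyclic closure start.
    A single part has one edge on its left side and one on its top side. *)
Lemma nu_single R : nrects R = 1%N -> nu R = 2.
Proof.
elim/class_ind: R => G; rewrite nrects_class nu_class ninsE => s1.
have vs (K : drawing F) : size (parts K) = 1%N -> nvert K = 1%N.
  move=> s1'; have gK := goodP K.
  have [p0 [vs [eV e0 ne]]] := vertical_point0 K; rewrite /nvert eV /=.
  have [ks [eK _ _ ksP]] := vertical_points_labelled gK gK (lab_refl K).
  case: vs eV ne => // v vs eV ne; exfalso.
  have : v \in vertical_points K by rewrite eV !inE eqxx orbT.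
  have := ne v (mem_head _ _) => /eqP nv.
  rewrite eK => /mapP[[t s]]; rewrite ksP => /and3P[/= tK sK ts] ev.
  apply: nv; rewrite ev /point_at /=.
  have : p0 \in vertical_points K by rewrite eV mem_head.
  rewrite eK => /mapP[[t' s']]; rewrite ksP => /and3P[/= tK' _ _] ep.
  rewrite -e0 ep /point_at /=.
  by case: (parts K) s1' tK tK' => // u [] // _; rewrite !inE => /eqP-> /eqP->.
by rewrite (vs G) // [nvert _](vs (reflect_drawing G)) // size_map.
Qed.

Lemma symmetric_reflectR C R : symmetric_set C -> C R -> C (reflectR R).
Proof. by move=> sC; elim/class_ind: R => G CG; rewrite reflectR_class; apply: sC. Qed.

End Classes.

(** * The initial rectangulation *)

Section Columns.
Variable F : realFieldType.
Implicit Types (G H D : drawing F) (P R : rectangulation F).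

(** All that is used of [id_rect] is that it and its ancestors are right-based; this property is
    inherited by parents without computing the deletion of [id_rect] explicitly. *)
Definition columns R := exists2 G, class_of G = R &
  {in parts G, forall t, yb t = yb (box G) /\ yt t = yt (box G)}.

Lemma columns_id n (n_gt0 : (0 < n)%N) : columns (id_rect F n_gt0).
Proof. by exists (Drawing (id_drawing_subproof F n_gt0)) => // _ /mapP[i _ ->]. Qed.

Lemma columns_right_based R : columns R -> right_based R.
Proof.
case=> G <- colG; have [rG _ _] := bottom_rightP (goodP G).
rewrite right_based_class bottom_based_class.
have := bottom_right_reflect (goodP G).
by rewrite /= => ->; rewrite /= (colG _ rG).2.
Qed.

(** Nothing lies above the corner part, so its corner is of type T and the deletion, done in the
    reflection, changes no height of a column. *)
Lemma columns_parent R : (1 < nrects R)%N -> columns R -> columns (parent R).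
Proof.
move=> gt1 [G eR colG]; subst R; rewrite nrects_class in gt1.
have gG := goodP G; have gR := good_reflect gG.
have gD := good_delete_any gG gt1.
exists (drawing_of gD); first by rewrite (@parent_class _ G (drawing_of gD)).
case: (corner_cases gG gt1) => [[[t0 t0G /andP[bt0 _]] _]|v].
  have [rG _ _] := bottom_rightP gG; have [e0 _] := colG _ t0G.
  have [_ er] := colG _ rG; have [? ?] := good_box gG.
  by exfalso; move: bt0; rewrite belowE e0 er => ?; lra.
rewrite [predraw (drawing_of gD)]/= -(reflect_predrawingK (delete G)).
rewrite -(delete_reflect gG) (delete_vertical gR v) /= => _ /mapP[_ /mapP[t tps ->] ->].
have tR : t \in parts (reflect_predrawing G) by move: tps; rewrite mem_filter => /andP[].
case/mapP: tR => u uG eu; have [e1 e2] := colG _ uG.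
rewrite /lower; case: ifP => _; rewrite /= eu /= !opprK; by rewrite e1 e2.
Qed.

End Columns.

(** * The order of generation *)

Section Sweeps.
Variable F : realFieldType.
Implicit Types (P R x : rectangulation F) (C : set (rectangulation F)).
Implicit Types (V Ps : seq (rectangulation F)) (b c : bool).

(* The direction [b = true] is that of left jumps. *)
Definition before b (k l : nat) := if b then (l < k)%N else (k < l)%N.

Definition jump b n C j R R' := exists d,
  if b then minimal_left_jump n C j d R R' else minimal_right_jump n C j d R R'.

(** At the top level the truncation is [C] itself, and injectivity of [child] forces the parent and
    the index in the definition of a jump to be [P] and [k]. *)
Lemma jump_child b n C k P R : (0 < n)%N -> (0 < k <= nu P)%N ->
  jump b n.+1 C n.+1 (child k P) R <->
  exists k', [/\ (0 < k' <= nu P)%N, before b k k', R = child k' P &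
    forall l, before b k l -> before b l k' -> ~ C (child l P)].
Proof.
move=> n0 kP; have trunc : truncation n.+1 C n.+1 = C.
  by rewrite /truncation subnn image_id.
have eP j P' : parent (child k P) = P' -> child k P = child j P' ->
    (0 < j <= nu P')%N -> P' = P /\ j = k.
  rewrite parent_child // => <- e jP; split=> //.
  by apply/esym/(child_inj kP jP).
split.
  case: b => -[d]; rewrite /jump.
    case=> _ d0 [P' [k1 [dk]]]; rewrite /= eqxx => -[p1 p2 [r1 r2] e1 e2].
    have [eP' ?] := eP _ _ p1 e1 r1; subst k1; rewrite trunc eP' => none.
    rewrite eP' in r2 e2.
    exists (k - d)%N; split=> //; rewrite /before; try lia.
    by move=> l l1 l2; apply: none; lia.
  case=> _ d0 [P' [k1]]; rewrite /= eqxx => -[[p1 p2 [r1 r2] e1 e2]].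
  have [eP' ?] := eP _ _ p1 e1 r1; subst k1; rewrite trunc eP' => none.
    rewrite eP' in r2 e2.
  exists (k + d)%N; split=> //; rewrite /before; try lia.
  by move=> l l1 l2; apply: none; lia.
case=> k' [kP' kk' -> none]; case: b kk' none => /= kk' none.
  exists (k - k')%N; split; [lia|lia|exists P, k].
  have -> : (k - (k - k') = k')%N by lia.
  rewrite /= eqxx trunc; split=> //; first by lia.
    by split=> //; apply: parent_child.
  by move=> l lP; apply: none; lia.
exists (k' - k)%N; split; [lia|lia|exists P, k].
have -> : (k + (k' - k) = k')%N by lia.
rewrite /= eqxx trunc; split=> //.
  by split=> //; apply: parent_child.
by move=> l lP; apply: none; lia.
Qed.

Definition same_side R R' :=
  (bottom_based R && bottom_based R') || (right_based R && right_based R').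

Lemma jump_parent b n C j R R' : (j <= n)%N ->
  jump b n.+1 C j R R' <->
  same_side R R' /\ jump b n (@parent F @` C) j (parent R) (parent R').
Proof.
move=> jn; have trunc : truncation n.+1 C j = truncation n (@parent F @` C) j.
  by rewrite /truncation subSn // image_comp; congr image; apply/funext => x; rewrite iterSr.
have ne : (j == n.+1) = false by apply/negP; lia.
split.
  case: b => -[d] [/andP[j2 _] d0 [P [k]]]; rewrite /= ne trunc.
    case=> dk [ss red] none; split=> //; exists d; split=> //; first by rewrite j2.
    by exists P, k; split.
  case=> -[ss red] none; split=> //; exists d; split=> //; first by rewrite j2.
  by exists P, k; split.
case=> ss; case: b => -[d] [/andP[j2 _] d0 [P [k]]].
  case=> dk red none; exists d; split=> //; first by rewrite j2 leqW.
  by exists P, k; rewrite /= ne trunc; split.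
case=> red none; exists d; split=> //; first by rewrite j2 leqW.
by exists P, k; rewrite /= ne trunc; split.
Qed.

Lemma jump_range b n C j R R' : jump b n C j R R' -> (2 <= j <= n)%N.
Proof. by case: b => -[d] []. Qed.

Definition move b n C V x j R := (C R /\ R \notin V) /\ jump b n C j x R.

(** [step] with the visited elements and the last one as separate arguments, so that states of
    different levels can be compared. *)
Definition next_visit n C V x R := exists j,
  [/\ move false n C V x j R \/ move true n C V x j R,
      forall j' R', move false n C V x j' R' \/ move true n C V x j' R' -> (j' <= j)%N
    & ~ ((exists R', move false n C V x j R') /\ (exists R', move true n C V x j R'))].

(** The two directions play symmetric parts, so [b] can be chosen as the direction of the current
    sweep. *)
Lemma nextP b n C V x R : next_visit n C V x R <-> exists j,
  [/\ move b n C V x j R \/ move (~~ b) n C V x j R,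
      forall j' R', move b n C V x j' R' \/ move (~~ b) n C V x j' R' -> (j' <= j)%N
    & ~ ((exists R', move b n C V x j R') /\ (exists R', move (~~ b) n C V x j R'))].
Proof.
case: b => //=; split=> -[j [h1 h2 h3]]; exists j; split.
- by case: h1; [right|left].
- by move=> j' R' [|] h; apply: (h2 j' R'); [right|left].
- by case=> ? ?; apply: h3.
- by case: h1; [right|left].
- by move=> j' R' [|] h; apply: (h2 j' R'); [right|left].
- by case=> ? ?; apply: h3.
Qed.

Lemma next_step n C R0 s R : step n C R0 s R <-> next_visit n C (R0 :: s) (last R0 s) R.
Proof. by []. Qed.

Definition sweep_index b C P : seq nat :=
  let ks := [seq k <- iota 1 (nu P) | `[< C (child k P) >]] in
  if b then rev ks else ks.

Definition sweep b C P := [seq child k P | k <- sweep_index b C P].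

Fixpoint sweeps b C Ps := if Ps is P :: Ps' then
  sweep b C P ++ sweeps (~~ b) C Ps' else [::].

(** Every level starts with a descending sweep because the initial rectangulation is the last child
    of its parent at each level. *)
Fixpoint ordering n C : seq (rectangulation F) := match n with
  | 0 => [::]
  | 1 => [:: square F]
  | m.+1 => sweeps true C (ordering m (@parent F @` C))
  end.

Lemma mem_sweep_index b C P k :
  (k \in sweep_index b C P) = (0 < k <= nu P)%N && `[< C (child k P) >].
Proof.
rewrite /sweep_index; case: b; rewrite ?mem_rev mem_filter mem_iota andbC add1n ltnS //.
Qed.

Lemma sweep_index_sorted b C P : sorted (before b) (sweep_index b C P).
Proof.
have s : sorted ltn [seq k <- iota 1 (nu P) | `[< C (child k P) >]].
  by apply: sorted_filter; [exact: ltn_trans | exact: iota_ltn_sorted].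
by rewrite /sweep_index; case: b; rewrite ?rev_sorted.
Qed.

Lemma before_trans b : transitive (before b).
Proof. by case: b => k l m; rewrite /before; lia. Qed.

Lemma before_irr b k : before b k k = false.
Proof. by case: b; rewrite /before ltnn. Qed.

Lemma mem_sweep b C P R : R \in sweep b C P <->
  C R /\ exists2 k, (0 < k <= nu P)%N & R = child k P.
Proof.
split=> [/mapP[k]|[CR [k kP eR]]].
  by rewrite mem_sweep_index => /andP[kP /asboolP Ck] ->; split=> //; exists k.
apply/mapP; exists k => //; rewrite mem_sweep_index kP /=; apply/asboolP.
by rewrite -eR.
Qed.

Lemma mem_sweep_parent b C P R : R \in sweep b C P -> parent R = P.
Proof. by case/mem_sweep => _ [k kP ->]; rewrite parent_child. Qed.

Lemma mem_sweeps b C Ps R : R \in sweeps b C Ps ->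
  parent R \in Ps /\ C R.
Proof.
elim: Ps b => //= P Ps IH b; rewrite mem_cat inE => /orP[RP|/IH[-> CR]].
  by rewrite (mem_sweep_parent RP) eqxx; case/mem_sweep: RP.
by rewrite orbT.
Qed.

Lemma sweeps_mem b C Ps R : (1 < nrects R)%N -> C R -> parent R \in Ps ->
  R \in sweeps b C Ps.
Proof.
move=> gt1 CR; elim: Ps b => //= P Ps IH b; rewrite inE mem_cat.
case/predU1P => [eP|/IH->]; last by rewrite orbT.
apply/orP; left; apply/mem_sweep; split=> //.
by have [k] := child_onto gt1; rewrite eP; exists k.
Qed.

Lemma uniq_sweep b C P : uniq (sweep b C P).
Proof.
rewrite map_inj_in_uniq.
  have := sweep_index_sorted b C P; apply: sorted_uniq.
    exact: before_trans.
  by move=> k; apply: before_irr.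
move=> k l; rewrite !mem_sweep_index => /andP[kP _] /andP[lP _].
exact: child_inj.
Qed.

Lemma uniq_sweeps b C Ps : uniq Ps -> uniq (sweeps b C Ps).
Proof.
elim: Ps b => //= P Ps IH b /andP[nP uPs]; rewrite cat_uniq uniq_sweep IH // andbT.
apply/hasPn => R /mem_sweeps[RPs _] /=; apply: contra nP => /mem_sweep_parent <-.
by [].
Qed.

Lemma sweeps_cat b C Ps Qs :
  sweeps b C (Ps ++ Qs) = sweeps b C Ps ++ sweeps (b (+) odd (size Ps)) C Qs.
Proof.
elim: Ps b => /= [|P Ps IH] b; first by rewrite addbF.
by rewrite IH catA addNb addbN.
Qed.

Lemma sweeps_split b C Ps pre x post : sweeps b C Ps = pre ++ x :: post ->
  exists Qs P Qs' c l1 l2, [/\ Ps = Qs ++ P :: Qs', sweep c C P = l1 ++ x :: l2,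
    pre = sweeps b C Qs ++ l1 & post = l2 ++ sweeps (~~ c) C Qs'].
Proof.
elim: Ps b pre => /= [|P Ps IH] b pre; first by case: pre.
have [lt|ge] := ltnP (size pre) (size (sweep b C P)) => e.
  exists [::], P, Ps, b, pre, (drop (size pre).+1 (sweep b C P)).
  have ep : pre = take (size pre) (sweep b C P).
    by have := congr1 (take (size pre)) e; rewrite take_cat lt take_size_cat.
  have ex : x :: post = drop (size pre) (sweep b C P) ++ sweeps (~~ b) C Ps.
    by have := congr1 (drop (size pre)) e; rewrite drop_cat lt drop_size_cat.
  rewrite (drop_nth x lt) /= in ex; case: ex => ex epost.
  split=> //; rewrite ex {1}ep -drop_nth // cat_take_drop //.
have ep : pre = sweep b C P ++ drop (size (sweep b C P)) pre.
  have := congr1 (take (size (sweep b C P))) e; rewrite take_cat ltnn subnn take0 cats0.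
  rewrite take_cat; case: (ltngtP (size (sweep b C P)) (size pre)) ge => // [lt _|<- _].
    by move=> {1}->; rewrite cat_take_drop.
  by rewrite subnn take0 cats0 => ->; rewrite drop_size cats0.
have e' : sweeps (~~ b) C Ps = drop (size (sweep b C P)) pre ++ x :: post.
  by move: e; rewrite {1}ep -catA => /eqP; rewrite eqseq_cat // eqxx => /eqP.
have [Qs [Q [Qs' [c [l1 [l2 [-> e2 e3 e4]]]]]]] := IH _ _ e'.
exists (P :: Qs), Q, Qs', c, l1, l2; split=> //.
by rewrite ep e3 /= catA.
Qed.

End Sweeps.

Lemma map_eq_split (T T' : Type) (f : T -> T') (s : seq T) l1 x l2 :
  map f s = l1 ++ x :: l2 ->
  exists s1 k s2, [/\ s = s1 ++ k :: s2, map f s1 = l1, f k = x & map f s2 = l2].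
Proof.
elim: l1 s => [|y l1 IH] [|k s] //= [fk].
  by move=> e; exists [::], k, s.
move=> /IH[s1 [k' [s2 [-> e1 e2 e3]]]].
by exists (k :: s1), k', s2; rewrite /= fk e1.
Qed.

(** * The algorithm follows the ordering *)

Section Ordering.
Variable F : realFieldType.
Implicit Types (P Q R x : rectangulation F) (C : set (rectangulation F)).
Implicit Types (V Ps : seq (rectangulation F)) (b c : bool).

Definition level_zigzag n C := zigzag n C /\ C `<=` rectangulations n.

Lemma nrects_parent n R : (0 < n)%N -> nrects R = n.+1 -> nrects (parent R) = n.
Proof.
move=> n0 eR; have [|i iP e] := @child_onto _ R; first by rewrite eR.
by have := nrects_child iP; rewrite -e eR => -[].
Qed.

Lemma level_zigzag_parent n C : (0 < n)%N -> level_zigzag n.+1 C ->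
  level_zigzag n (@parent F @` C) /\
  forall P, (@parent F @` C) P -> C (child 1 P) /\ C (child (nu P) P).
Proof.
case: n => // n _ [[zC endC] sC]; split=> //; split=> //.
by move=> _ [R /sC CR <-]; apply: nrects_parent.
Qed.

Lemma ordering_step n C : (0 < n)%N ->
  ordering n.+1 C = sweeps true C (ordering n (@parent F @` C)).
Proof. by case: n. Qed.

Lemma orderingP n C : (0 < n)%N -> level_zigzag n C ->
  uniq (ordering n C) /\ forall R, R \in ordering n C <-> C R.
Proof.
case: n => // n _; elim: n C => [|n IH] C lC.
  have [/= eC _] := lC; split=> // R; rewrite eC inE.
  by split=> [/eqP|->].
have [lC' _] := level_zigzag_parent (ltn0Sn n) lC; have [u m] := IH _ lC'.
rewrite ordering_step //; split; first exact: uniq_sweeps.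
move=> R; split=> [/mem_sweeps[]//|CR]; apply: sweeps_mem => //.
  by have [_ /(_ _ CR)->] := lC.
by apply/m; exists R.
Qed.

(** Where a sweep in direction [b] ends and the opposite one begins. It is also the map that
    transports the states of one level to the ends of runs on the next. *)
Definition sweep_last b P := child (if b then 1 else nu P) P.

Lemma sweep_index_split b C P k1s k k2s :
  sweep_index b C P = k1s ++ k :: k2s ->
  {in k1s, forall m, before b m k} /\ {in k2s, forall m, before b k m}.
Proof.
move=> e; have := sweep_index_sorted b C P; rewrite e.
rewrite (sorted_pairwise (@before_trans b)) pairwise_cat /= => /and3P[/allrelP h _ /andP[/allP h' _]].
by split=> // m m1; apply: h; rewrite // mem_head.
Qed.

Lemma sweep_head b C P : C (sweep_last b P) ->
  exists l, sweep (~~ b) C P = sweep_last b P :: l.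
Proof.
set e := if b then 1%N else nu P => Ce; have nuP := nu_ge2 P.
have eI : e \in sweep_index (~~ b) C P.
  by rewrite mem_sweep_index; apply/andP; split; [rewrite /e; case: b {e Ce}; lia | apply/asboolP].
rewrite /sweep /sweep_last -/e; case E : (sweep_index (~~ b) C P) eI => [//|k ks] eI.
exists [seq child i P | i <- ks]; suff -> : e = k by [].
have [_ h] := @sweep_index_split _ _ _ [::] _ _ E.
have : k \in sweep_index (~~ b) C P by rewrite E mem_head.
rewrite mem_sweep_index => /andP[kP _].
move: eI; rewrite inE => /predU1P[//|/h]; rewrite /e /before.
by case: (b) => /=; lia.
Qed.

Section NextStep.
Variables (n : nat) (C : set (rectangulation F)).
Hypotheses (n_gt0 : (0 < n)%N) (lC : level_zigzag n.+1 C).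
Variables (Qs Qs' : seq (rectangulation F)) (P x : rectangulation F) (c : bool).
Variables (l1 l2 : seq (rectangulation F)).
Hypothesis ordP : ordering n (@parent F @` C) = Qs ++ P :: Qs'.
Hypothesis sweepP : sweep c C P = l1 ++ x :: l2.

Let pre := sweeps true C Qs ++ l1.
Let post := l2 ++ sweeps (~~ c) C Qs'.
Let V := rcons pre x.
Hypothesis ordC : ordering n.+1 C = pre ++ x :: post.

Let uV : uniq (pre ++ x :: post).
Proof. by rewrite -ordC; case: (orderingP _ lC). Qed.

Let V_parent R : R \in V -> C R /\ parent R \in rcons Qs P.
Proof.
rewrite /V /pre mem_rcons inE mem_cat mem_rcons inE => h.
have [RQ|RP] : R \in sweeps true C Qs \/ R \in sweep c C P.
  rewrite sweepP mem_cat inE; case/or3P: h => ->; rewrite ?orbT; [right|left|right] => //.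
- by have [-> CR] := mem_sweeps RQ; rewrite orbT.
- by rewrite (mem_sweep_parent RP) eqxx; case/mem_sweep: RP.
Qed.

Lemma sibling_index : exists k1s k k2s,
  [/\ sweep_index c C P = k1s ++ k :: k2s, x = child k P, (0 < k <= nu P)%N,
   [seq child m P | m <- k1s] = l1 & [seq child m P | m <- k2s] = l2].
Proof.
have [k1s [k [k2s [e e1 e2 e3]]]] := map_eq_split sweepP.
exists k1s, k, k2s; split=> //.
have : k \in sweep_index c C P by rewrite e mem_cat mem_head orbT.
by rewrite mem_sweep_index => /andP[].
Qed.

(** Every sibling in [C] behind [x] lies in [l1], hence has been visited. *)
Lemma no_backward_move R : ~ move (~~ c) n.+1 C V x n.+1 R.
Proof.
have [k1s [k [k2s [e ex kP e1 e2]]]] := sibling_index.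
have [h1 h2] := sweep_index_split e; rewrite ex.
case=> -[CR nV] /(jump_child _ _ _ n_gt0 kP)[k' [kP' kk' eR _]].
have : k' \in sweep_index c C P.
  by rewrite mem_sweep_index kP' /=; apply/asboolP; rewrite -eR.
have kk : before c k' k by move: kk'; case: (c).
rewrite e mem_cat inE => /or3P[m1|/eqP ek|/h2 kk2].
- case/negP: nV; have Rl1 : R \in l1.
    by rewrite -e1 eR; apply: (map_f (fun m => child m P)).
  by rewrite /V /pre mem_rcons inE mem_cat Rl1 !orbT.
- by rewrite ek before_irr in kk.
- by have := before_trans kk kk2; rewrite before_irr.
Qed.

(** A jump past [y] is not minimal because [y] is in [C], and no sibling in [C] lies between [x] and
    [y]. *)
Lemma forward_move y l R : l2 = y :: l ->
  move c n.+1 C V x n.+1 R <-> R = y.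
Proof.
have [k1s [k [k2s [e ex kP e1 e2]]]] := sibling_index; have [h1 h2] := sweep_index_split e.
rewrite -e2; case: k2s e e2 h2 => //= k' k2s e e2 h2 [ey _].
have e' : sweep_index c C P = rcons k1s k ++ k' :: k2s by rewrite cat_rcons.
have [h1' h2'] := sweep_index_split e'.
have kk' : before c k k' by apply: h2; rewrite mem_head.
have inI m : (m \in sweep_index c C P) = [|| m \in k1s, m == k, m == k' | m \in k2s].
  by rewrite e mem_cat !inE.
have : k' \in sweep_index c C P by rewrite inI eqxx !orbT.
rewrite mem_sweep_index => /andP[kP' /asboolP Ck'].
rewrite /move {1}ex; split=> [[[CR nV] /(jump_child _ _ _ n_gt0 kP)[m [mP km eR none]]]|->].
  have : m \in sweep_index c C P.
    by rewrite mem_sweep_index mP /=; apply/asboolP; rewrite -eR.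
  rewrite inI => /or4P[/h1 mk|/eqP mk|/eqP mk|/h2' mk].
  - by have := before_trans km mk; rewrite before_irr.
  - by rewrite mk before_irr in km.
  - by rewrite eR mk.
  - by case: (none k').
split; [split; first by rewrite -ey|].
  move: uV; rewrite -cat_rcons cat_uniq => /and3P[_ /hasPn h _].
  by apply: h; rewrite /post -e2 ey mem_head.
apply/(jump_child _ _ _ n_gt0 kP); exists k'; split=> // m km mk' Cm.
have : m \in sweep_index c C P.
  rewrite mem_sweep_index; apply/andP; split; last exact/asboolP.
  by move: km mk'; rewrite /before; case: (c); lia.
rewrite inI => /or4P[/h1 mk|/eqP mk|/eqP mk|/h2' mk].
- by have := before_trans km mk; rewrite before_irr.
- by rewrite mk before_irr in km.
- by rewrite mk before_irr in mk'.
- by have := before_trans mk' mk; rewrite before_irr.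
Qed.

Lemma next_sibling y l R : l2 = y :: l -> next_visit n.+1 C V x R <-> R = y.
Proof.
move=> e2; have fw := @forward_move y l _ e2.
split=> [/(nextP c)[j [h1 h2 _]]|->].
  have ej : j = n.+1.
    have := h2 n.+1 y (or_introl ((fw y).2 erefl)).
    by case: h1 => -[_ /jump_range]; lia.
  subst j; case: h1; first by move/fw.
  by move/no_backward_move.
apply/(nextP c); exists n.+1; split; first by left; apply/fw.
  by move=> j' R' [] [_ /jump_range]; lia.
by case=> _ [R' /no_backward_move].
Qed.

Section LastSibling.
Hypothesis l2_nil : l2 = [::].

Let CP : (@parent F @` C) P.
Proof.
have [lC' _] := level_zigzag_parent n_gt0 lC.
by have [_ m] := orderingP n_gt0 lC'; apply/m; rewrite ordP mem_cat mem_head orbT.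
Qed.

Lemma no_sibling_move b R : ~ move b n.+1 C V x n.+1 R.
Proof.
have [|ne] := boolP (b == ~~ c); first by move/eqP->; apply: no_backward_move.
have -> : b = c by case: (b) (c) ne => -[].
have [k1s [k [k2s [e ex kP e1 e2]]]] := sibling_index.
have [h1 h2] := sweep_index_split e; rewrite ex.
case=> -[CR nV] /(jump_child _ _ _ n_gt0 kP)[k' [kP' kk' eR _]].
have : k' \in sweep_index c C P.
  by rewrite mem_sweep_index kP' /=; apply/asboolP; rewrite -eR.
rewrite e mem_cat inE => /or3P[/h1 k'k|/eqP ek|m2].
- by have := before_trans kk' k'k; rewrite before_irr.
- by rewrite ek before_irr in kk'.
- by move: e2 m2; rewrite l2_nil; case: (k2s).
Qed.

(** The zigzag property puts the extreme child in [C], so a run with no sibling left has reached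
    it. *)
Lemma sweep_lastE : x = sweep_last c P.
Proof.
have [k1s [k [k2s [e ex kP e1 e2]]]] := sibling_index.
have [h1 h2] := sweep_index_split e.
have [_ /(_ _ CP)[C1 Cnu]] := level_zigzag_parent n_gt0 lC.
have nuP := nu_ge2 P; rewrite ex /sweep_last; congr child.
set f := if c then 1%N else nu P.
have : f \in sweep_index c C P.
  rewrite mem_sweep_index; apply/andP; split; first by rewrite /f; case: (c); lia.
  by apply/asboolP; rewrite /f; case: (c).
rewrite e mem_cat inE => /or3P[/h1|/eqP-> //|m2].
  by rewrite /f /before; case: (c); lia.
by move: e2 m2; rewrite l2_nil; case: (k2s).
Qed.

(** [x] is the first or the last child of [P], so the side condition on bases forces the target to
    be the same extreme child of its own parent. As the run of [P] is finished, an element of [C]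
    has been visited exactly when its parent has been visited one level below. *)
Lemma lower_move b j R : (j <= n)%N ->
  move b n.+1 C V x j R <->
  exists2 P', R = sweep_last c P' & move b n (@parent F @` C) (rcons Qs P) P j P'.
Proof.
move=> jn; have nuP := nu_ge2 P.
have kP : (0 < (if c then 1%N else nu P) <= nu P)%N by case: (c); lia.
split.
  case=> -[CR nV] /(jump_parent _ _ _ _ jn)[ss jmp].
  have xP : parent x = P by rewrite sweep_lastE parent_child.
  rewrite xP in jmp; have CR' : (@parent F @` C) (parent R) by exists R.
  have gt1 : (1 < nrects R)%N by have [_ /(_ _ CR)->] := lC; rewrite ltnS.
  have [k kR eR] := child_onto gt1; have nuR := nu_ge2 (parent R).
  exists (parent R).
    (* [nu > 1] keeps the two bases apart: a first child is never right-based, a last child never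
       bottom-based. *)
    rewrite {1}eR; congr child; move: ss; rewrite /same_side sweep_lastE eR.
    rewrite !(bottom_based_child, right_based_child) // -eR.
    by case: (c) => /=; lia.
  split=> //; split=> //; apply: contra nV => RV.
  rewrite /V /pre -cats1 -catA cats1.
  move: RV; rewrite mem_rcons inE => /predU1P[eP|RQ].
    have : R \in sweep c C P by apply/mem_sweep; split=> //; exists k; rewrite -eP.
    by rewrite sweepP l2_nil cats1 => RS; rewrite mem_cat RS orbT.
  by rewrite mem_cat sweeps_mem.
case=> P' -> [[CP' nP'] jmp]; have nuP' := nu_ge2 P'.
have kP' : (0 < (if c then 1%N else nu P') <= nu P')%N by case: (c); lia.
have [_ /(_ _ CP')[C1 Cnu]] := level_zigzag_parent n_gt0 lC.
split; [split|].
- by rewrite /sweep_last; case: (c).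
- apply: contra nP' => /V_parent[_]; by rewrite parent_child.
apply/(jump_parent _ _ _ _ jn); rewrite sweep_lastE !parent_child //; split=> //.
rewrite /same_side /sweep_last !(bottom_based_child, right_based_child) //.
by case: (c); rewrite !eqxx ?orbT.
Qed.

Lemma next_parent R : next_visit n.+1 C V x R <->
  exists2 P', R = sweep_last c P' & next_visit n (@parent F @` C) (rcons Qs P) P P'.
Proof.
have top j b R' : move b n.+1 C V x j R' -> (j <= n)%N.
  move=> mv; have [_ /jump_range] := mv.
  case: (ltngtP j n.+1) => // [|e _]; first by lia.
  by subst j; have := no_sibling_move mv.
have low j b P' : move b n (@parent F @` C) (rcons Qs P) P j P' -> (j <= n)%N.
  by case=> _ /jump_range /andP[].
have up j b P' : move b n (@parent F @` C) (rcons Qs P) P j P' ->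
    move b n.+1 C V x j (sweep_last c P').
  by move=> mv; apply/(lower_move _ _ (low _ _ _ mv)); exists P'.
have down j b R' : move b n.+1 C V x j R' -> exists2 P', R' = sweep_last c P' &
    move b n (@parent F @` C) (rcons Qs P) P j P'.
  by move=> mv; apply/(lower_move _ _ (top _ _ _ mv)).
split=> [[j [h1 h2 h3]]|[P' -> [j [h1 h2 h3]]]].
  have [b mvb] : exists b, move b n.+1 C V x j R by case: h1; [exists false|exists true].
  have [P' eR mv] := down _ _ _ mvb; exists P' => //; exists j; split.
  - by case: b {mvb} mv; [right|left].
  - by move=> j' P'' [] /up mv'; apply: (h2 j' (sweep_last c P'')); [left|right].
  - by case=> -[P1 /up m1] [P2 /up m2]; apply: h3; split; eexists; eassumption.
exists j; split.
- by case: h1 => /up; [left|right].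
- by move=> j' R' [] /down[P'' _ mv']; apply: (h2 j' P''); [left|right].
- by case=> -[R1 /down[P1 _ m1]] [R2 /down[P2 _ m2]]; apply: h3; split; eexists; eassumption.
Qed.

End LastSibling.
End NextStep.

(** At the end of a run the state mirrors the one just after the visit of [P] on the level below, so
    the induction hypothesis applies with [Qs] as prefix; inside a run the siblings alone decide. *)
Lemma next_ordering n C pre x post R : (0 < n)%N -> level_zigzag n C ->
  ordering n C = pre ++ x :: post ->
  next_visit n C (rcons pre x) x R <-> exists post', post = R :: post'.
Proof.
case: n => // n _; elim: n C pre x post R => [|n IH] C pre x post R lC.
  case: pre => [|y [|z pre]] //= [_ <-]; split=> [|[]//].
  by case=> j [[] [_ /jump_range]]; lia.
move=> ordC; have [lC' ends] := level_zigzag_parent (ltn0Sn n) lC.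
have := ordC; rewrite ordering_step // => /sweeps_split.
case=> Qs [P [Qs' [c [l1 [l2 [ordP sw epre epost]]]]]]; subst pre post.
case: l2 sw ordC => [|y l] sw ordC; last first.
  rewrite (next_sibling (ltn0Sn n) lC sw ordC _ (erefl (y :: l))).
  by split=> [->|[post' [->]]] //; exists (l ++ sweeps (~~ c) C Qs').
rewrite (next_parent (ltn0Sn n) lC ordP sw ordC) // cat0s.
(* The transported move lands on [sweep_last c P'], which is where the next run, in direction
   [~~ c], begins. *)
have hd P' : P' \in Qs' -> exists l, sweep (~~ c) C P' = sweep_last c P' :: l.
  move=> P'Q; apply: sweep_head.
  have CP' : (@parent F @` C) P'.
    by have [_ m] := orderingP (ltn0Sn n) lC'; apply/m; rewrite ordP mem_cat inE P'Q !orbT.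
  by have [C1 Cnu] := ends _ CP'; rewrite /sweep_last; case: (c).
split=> [[P' -> /(IH _ _ _ _ _ lC' ordP)[Qs'' eQ]]|[post' e]].
  have [|l el] := hd P'; first by rewrite eQ mem_head.
  by rewrite eQ /= el; eexists.
case: Qs' ordP hd e {ordC} => // P' Qs' ordP hd /=.
have [|l ->] := hd P'; first by rewrite mem_head.
case=> <- _; exists P' => //; apply/(IH _ _ _ _ _ lC' ordP).
by exists Qs'.
Qed.

End Ordering.

(** * Output and cyclic closure *)

Section Output.
Variable F : realFieldType.
Implicit Types (P Q R x : rectangulation F) (C : set (rectangulation F)).
Implicit Types (s Ps : seq (rectangulation F)).

Lemma ordering_head n C R0 : (0 < n)%N -> level_zigzag n C -> C R0 -> columns R0 ->
  exists s, ordering n C = R0 :: s.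
Proof.
case: n => // n _; elim: n C R0 => [|n IH] C R0 lC CR0 colR0.
  by have [/= eC _] := lC; exists [::]; move: CR0; rewrite /= eC => ->.
have [lC' ends] := level_zigzag_parent (ltn0Sn n) lC.
have gt1 : (1 < nrects R0)%N by have [_ /(_ _ CR0)->] := lC.
have CP : (@parent F @` C) (parent R0) by exists R0.
have [Ps eP] := IH _ _ lC' CP (columns_parent gt1 colR0).
have [k kP eR0] := child_onto gt1.
have ek : k = nu (parent R0).
  by apply/eqP; rewrite -(right_based_child kP) -eR0 columns_right_based.
rewrite ordering_step // eP /=.
have [|l] := @sweep_head _ false C (parent R0); first by case: (ends _ CP).
by rewrite /sweep_last -ek -eR0 => ->; exists (l ++ sweeps false C Ps).
Qed.

Section Run.
Variables (n : nat) (C : set (rectangulation F)) (R0 : rectangulation F).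
Hypotheses (n_gt0 : (0 < n)%N) (lC : level_zigzag n C).
Hypotheses (CR0 : C R0) (colR0 : columns R0).

Lemma step_ordering s post R : ordering n C = (R0 :: s) ++ post ->
  step n C R0 s R <-> exists post', post = R :: post'.
Proof.
rewrite {1}lastI cat_rcons => /(next_ordering R n_gt0 lC).
by rewrite -lastI; apply: iff_trans; apply: next_step.
Qed.

Lemma visited_ordering s : visited n C R0 s <->
  exists post, ordering n C = (R0 :: s) ++ post.
Proof.
split.
  elim=> [|{}s R _ [post e] st]; first exact: ordering_head.
  have [post' e'] := (step_ordering R e).1 st.
  by exists post'; rewrite e e' /= cat_rcons.
elim/last_ind: s => [_|s R IH [post e]]; first exact: J1.
have e' : ordering n C = (R0 :: s) ++ R :: post by rewrite e /= cat_rcons.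
apply: J2; first by apply: IH; exists (R :: post).
by apply/(step_ordering R e'); exists post.
Qed.

Lemma outputP out : algorithmJ_output n C R0 out <-> out = ordering n C.
Proof.
split=> [[s [-> /visited_ordering[post e] stop]]|->].
  case: post e => [->|R post e]; first by rewrite cats0.
  by case: stop; exists R; apply/(step_ordering R e); exists post.
have [s e] := ordering_head n_gt0 lC CR0 colR0; exists s; split=> //.
  by apply/visited_ordering; exists [::]; rewrite cats0.
have e' : ordering n C = (R0 :: s) ++ [::] by rewrite cats0.
by case=> R /(step_ordering R e')[].
Qed.

End Run.

Lemma symmetric_parent n C : (0 < n)%N -> C `<=` rectangulations n.+1 ->
  symmetric_set C -> symmetric_set (@parent F @` C).
Proof.
move=> n0 sC symC G [R CR eR]; have := sC _ CR => /= eN.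
exists (reflectR R); first exact: symmetric_reflectR.
by rewrite parent_reflectR ?eN // eR reflectR_class.
Qed.

(** [n] deletions leave two parts. A rectangulation with two parts is the first or the last of two
    children, and reflection exchanges these. *)
Lemma bottom_based_ancestor n R : nrects R = n.+2 ->
  bottom_based (iter n (@parent F) (reflectR R)) =
  ~~ bottom_based (iter n (@parent F) R).
Proof.
elim: n R => [|n IH] R eR; last first.
  by rewrite !iterSr parent_reflectR ?eR // IH // (nrects_parent (ltn0Sn _) eR).
have [|k kP eRk] := @child_onto _ R; first by rewrite eR.
have := nu_single (nrects_parent (ltn0Sn 0) eR) => nu2.
rewrite /= bottom_based_reflectR eRk (right_based_child kP) (bottom_based_child kP).
by rewrite nu2; rewrite nu2 in kP; lia.
Qed.

(** Reflection permutes [C] and exchanges the elements whose ancestor with two parts is bottom-based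
    with all others, so the two groups have equal size. *)
Lemma even_ordering n C : (1 < n)%N -> level_zigzag n C -> symmetric_set C ->
  ~~ odd (size (ordering n C)).
Proof.
case: n => [|[|n]] // _ lC symC; have [u m] := orderingP (ltn0Sn n.+1) lC.
pose a R := bottom_based (iter n (@parent F) R).
have pr : perm_eq (map (@reflectR F) (ordering n.+2 C)) (ordering n.+2 C).
  apply: uniq_perm => //.
    by rewrite map_inj_uniq //; apply: inv_inj; apply: reflectRK.
  move=> R; apply/mapP/idP => [[R' /m CR' ->]|/m CR].
    by apply/m; apply: symmetric_reflectR.
  by exists (reflectR R); rewrite ?reflectRK //; apply/m; apply: symmetric_reflectR.
rewrite -(count_predC a) -(permP pr a) count_map.
rewrite (eq_in_count (a2 := predC a)); first by rewrite addnn odd_double.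
move=> R /m CR /=; apply: bottom_based_ancestor.
by case: lC => _ /(_ _ CR).
Qed.

Lemma sweep_rev C P : sweep false C P = rev (sweep true C P).
Proof. by rewrite /sweep /sweep_index map_rev revK. Qed.

(** [R] is a default value for [last] and [head]; its membership in [C] makes the list nonempty. *)
Lemma cyclic_ordering n C R : (1 < n)%N -> level_zigzag n C -> symmetric_set C ->
  C R -> exists j, minimal_jump n C j (last R (ordering n C)) (head R (ordering n C)).
Proof.
case: n => [|[|n]] // _; elim: n C R => [|n IH] C R lC symC CR.
  have [lC' ends] := level_zigzag_parent (ltn0Sn 0) lC.
  have eC : @parent F @` C = [set square F] := lC'.1.
  have Cs : (@parent F @` C) (square F) by rewrite eC.
  have [C1 C2] := ends _ Cs.
  have sq1 : nrects (square F) = 1%N by case: lC' => _ /(_ _ Cs).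
  have nu2 := nu_single sq1; rewrite nu2 in C2.
  (* With two parts the list is [c_2], [c_1], and a right jump of [r_2] by one step closes the
     cycle. *)
  have eO : ordering 2 C = [:: child 2 (square F); child 1 (square F)].
    by rewrite /= cats0 /sweep /sweep_index nu2 /= (asboolT C1) (asboolT C2).
  rewrite eO /=; exists 2%N; left.
  apply/(@jump_child _ false) => //; first by rewrite nu2.
  by exists 2%N; rewrite nu2; split=> // l; rewrite /before; lia.
have [lC' ends] := level_zigzag_parent (ltn0Sn n.+1) lC.
have symC' := symmetric_parent (ltn0Sn n.+1) lC.2 symC.
have CR' : (@parent F @` C) (parent R) by exists R.
have ev := even_ordering (isT : (1 < n.+2)%N) lC' symC'.
have [j jmp] := IH _ _ lC' symC' CR'.
have [_ m] := orderingP (ltn0Sn n.+1) lC'.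
have last_sweep P : (@parent F @` C) P ->
    exists l, sweep true C P = child (nu P) P :: l.
  by move=> /ends[_ Cnu]; apply: (@sweep_head _ false).
rewrite ordering_step //; set Ps := ordering n.+2 _ in ev jmp m *.
have RPs : parent R \in Ps by apply/m.
have [P [Ps' eP CP]] : exists P, exists2 Ps', Ps = P :: Ps' & (@parent F @` C) P.
  case: Ps RPs m {ev jmp} => // P Ps' _ m; exists P, Ps' => //.
  by apply/m; rewrite mem_head.
have [Q [Qs eQ CQ]] : exists Q, exists2 Qs, Ps = rcons Qs Q & (@parent F @` C) Q.
  case: (lastP Ps) RPs m {ev jmp eP} => // Qs Q _ m; exists Q, Qs => //.
  by apply/m; rewrite mem_rcons mem_head.
have hd : head R (sweeps true C Ps) = child (nu P) P.
  by have [l el] := last_sweep P CP; rewrite eP /= el.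
(* [Ps] has even size, so the sweep over its last element [Q] is ascending and ends with the last
   child. First and last element are then both right-based, which the lifting of the jump
   requires. *)
have tl : last R (sweeps true C Ps) = child (nu Q) Q.
  move: ev; rewrite eQ size_rcons /= negbK -cats1 sweeps_cat => -> /=.
  have [l el] := last_sweep Q CQ.
  by rewrite cats0 sweep_rev el rev_cons last_cat last_rcons.
have nuP := nu_ge2 P; have nuQ := nu_ge2 Q.
have rP : (0 < nu P <= nu P)%N by lia.
have rQ : (0 < nu Q <= nu Q)%N by lia.
have ss : same_side (child (nu Q) Q) (child (nu P) P).
  by rewrite /same_side !right_based_child // !eqxx orbT.
have eh : head (parent R) Ps = P by rewrite eP.
have el : last (parent R) Ps = Q by rewrite eQ last_rcons.
rewrite hd tl; rewrite eh el in jmp; exists j.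
have lift b : jump b n.+2 (@parent F @` C) j Q P ->
    jump b n.+3 C j (child (nu Q) Q) (child (nu P) P).
  move=> jb; apply/jump_parent; first by have /andP[] := jump_range jb.
  by rewrite !parent_child.
by case: jmp => [/(lift false)|/(lift true)]; [left|right].
Qed.

End Output.

Theorem theorem5 (F : realFieldType) (n : nat) (n_gt0 : (0 < n)%N)
    (C : set (rectangulation F)) (C_sub : C `<=` rectangulations n)
    (C_zigzag : zigzag n C) (C_id : C (id_rect F n_gt0)) :
  ((exists out, algorithmJ_output n C (id_rect F n_gt0) out) /\
   (forall out, algorithmJ_output n C (id_rect F n_gt0) out ->
      uniq out /\ forall R, R \in out <-> C R)) /\
  ((2 <= n)%N -> symmetric_set C ->
   forall out, algorithmJ_output n C (id_rect F n_gt0) out ->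
     exists j, minimal_jump n C j (last (id_rect F n_gt0) out)
                                  (head (id_rect F n_gt0) out)).
Proof.
have lC : level_zigzag n C by split.
have outE out := outputP n_gt0 lC C_id (columns_id F n_gt0) out.
split; first split.
- by exists (ordering n C); apply/outE.
- by move=> out /outE->; apply: orderingP.
- by move=> n_gt1 symC out /outE->; apply: cyclic_ordering.
Qed.
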